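(* Let $T>\pi$ and let $\mathcal{G}_{\mathrm{Burg}}$ and $\mu$ be as in the context. There exists a constant $C>0$ such that for any $\epsilon\in(0,\tfrac12]$ and any grid size $N\ge3$ there exists a (ReLU) FNO $\mathcal{N}^{\mathrm{FNO}}_\epsilon$ with \[ \mathbb{E}_{\bar u\sim\mu}\big[\|\mathcal{G}_{\mathrm{Burg}}(\bar u)-\mathcal{N}^{\mathrm{FNO}}_\epsilon(\bar u)\|_{L^1(\mathbb{T})}\big]\le\epsilon, \] Fourier cut-off $k_{\max}=1$, lifting dimension $d_v\le C$, $\mathrm{depth}(\mathcal{N}^{\mathrm{FNO}}_\epsilon)\le C\log(\epsilon^{-1})^2$ and $\mathrm{size}(\mathcal{N}^{\mathrm{FNO}}_\epsilon)\le C\log(\epsilon^{-1})^2$.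
   Context: $\mathbb{T}=\mathbb{R}/2\pi\mathbb{Z}$. $\mu$ is the law of $\bar u(x)=-\sin(x-\xi)$, $\xi\sim\mathrm{Unif}[0,2\pi]$; $\mathcal{G}_{\mathrm{Burg}}(\bar u)=u(\cdot,T)$ with $u$ the entropy solution of $\partial_tu+\partial_x(u^2/2)=0$ on $\mathbb{T}$, $u(\cdot,0)=\bar u$. FNO with grid size $N$: $x_j=2\pi j/N$, $\mathcal{F}_Nv(k)=\frac1N\sum_{j=1}^Nv(x_j)e^{-ikx_j}$. An FNO with lifting dimension $d_v$, cut-off $k_{\max}$, depth $L$, ReLU activation $\sigma$ is $\mathcal{N}=Q\circ\mathcal{L}_L\circ\dots\circ\mathcal{L}_1\circ R$, $(R\bar u)(x)=R(\bar u(x),x)$ with $R$ a shallow ReLU network into $\mathbb{R}^{d_v}$, $(\mathcal{L}_\ell v)(x)=\sigma(W_\ell v(x)+b_\ell(x)+(K_\ell v)(x))$, $W_\ell\in\mathbb{R}^{d_v\times d_v}$, $(K_\ell v)(x)=\sum_{|k|\le k_{\max}}P_\ell(k)\mathcal{F}_Nv(k)e^{ikx}$, $P_\ell(k)\in\mathbb{C}^{d_v\times d_v}$, real bias $b_\ell(x)=\sum_{|k|\le k_{\max}}\hat b_\ell(k)e^{ikx}$, $Q$ linear pointwise. Outputs are defined for all $x\in\mathbb{T}$. Depth $=L$; size = total number of tunable parameters. *)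

(* Defs.v *)
From HB Require Import structures.
From mathcomp Require Import all_boot all_order all_algebra.
From mathcomp Require Import all_classical all_reals all_analysis.
Set Implicit Arguments. Unset Strict Implicit. Unset Printing Implicit Defensive.
Import Order.TTheory GRing.Theory Num.Theory.
Import numFieldNormedType.Exports.
Local Open Scope classical_set_scope.
Local Open Scope ring_scope.

Definition test_fun (R : realType) (phi phit phix : R -> R -> R) : Prop :=
  (forall t x, 0 <= phi t x) /\
  (forall t x : R, is_derive t (1:R) (fun s => phi s x) (phit t x)) /\
  (forall t x : R, is_derive x (1:R) (fun y => phi t y) (phix t x)) /\
  continuous (fun p : R * R => phit p.1 p.2) /\
  continuous (fun p : R * R => phix p.1 p.2) /\
  (exists a b c : R, 0 < a /\
     forall t x, phi t x != 0 -> a <= t <= b /\ `|x| <= c).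

Definition per_dom (R : realType) : set R := `[0, 2 * pi].

Definition burgers_flux (R : realType) (v : R) : R := v ^+ 2 / 2.

(* Entropy solution of  d_t u + d_x (u^2/2) = 0  on T with u(.,0) = u0:
   2pi-periodic in x, bounded and measurable, satisfying Kruzhkov's entropy
   inequalities for all constants k and all test functions, continuous in
   time with values in L^1(T), and with initial datum u0. *)
Definition entropy_solution (R : realType) (u : R -> R -> R) (u0 : R -> R)
  : Prop :=
  (forall x t, u (x + 2 * pi) t = u x t) /\
  (exists M : R, forall x t, 0 <= t -> `|u x t| <= M) /\
  measurable_fun setT (fun p : R * R => u p.2 p.1) /\
  (forall (k : R) (phi phit phix : R -> R -> R), test_fun phi phit phix ->
     (0 <= \int[(@lebesgue_measure R) \x (@lebesgue_measure R)]_(p in setT)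
        ((`|u p.2 p.1 - k| * phit p.1 p.2
          + Num.sg (u p.2 p.1 - k)
            * (burgers_flux (u p.2 p.1) - burgers_flux k) * phix p.1 p.2)%:E))%E) /\
  (forall t0 : R, 0 <= t0 -> forall e : R, 0 < e -> exists d : R, 0 < d /\
     forall t : R, 0 <= t -> `|t - t0| < d ->
       (\int[@lebesgue_measure R]_(x in @per_dom R) (`|u x t - u x t0|)%:E
          <= e%:E)%E) /\
  (forall x, u x 0 = u0 x).

Definition ubar (R : realType) (xi : R) : R -> R := fun x => - sin (x - xi).

Unset Implicit Arguments.
Record FNO (R : realType) := MkFNO {
  fno_dv : nat;
  fno_kmax : nat;
  fno_width : nat;
  fno_depth : nat;
  fno_A1 : 'M[R]_(fno_width, 2);
  fno_c1 : 'cV[R]_fno_width;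
  fno_A2 : 'M[R]_(fno_dv, fno_width);
  fno_c2 : 'cV[R]_fno_dv;
  (* layer weights: W_l, P_l(k) = PA_l(k) + i PB_l(k), and bias
     coefficients bhat_l(k) = bA_l(k) + i bB_l(k), k = -kmax..kmax
     (index i : 'I_(2 kmax + 1) stands for k = i - kmax) *)
  fno_W : 'I_fno_depth -> 'M[R]_fno_dv;
  fno_PA : 'I_fno_depth -> 'I_(2 * fno_kmax + 1) -> 'M[R]_fno_dv;
  fno_PB : 'I_fno_depth -> 'I_(2 * fno_kmax + 1) -> 'M[R]_fno_dv;
  fno_bA : 'I_fno_depth -> 'I_(2 * fno_kmax + 1) -> 'cV[R]_fno_dv;
  fno_bB : 'I_fno_depth -> 'I_(2 * fno_kmax + 1) -> 'cV[R]_fno_dv;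
  fno_Q : 'rV[R]_fno_dv }.
Arguments MkFNO {R}.
Arguments fno_dv {R}.
Arguments fno_kmax {R}.
Arguments fno_width {R}.
Arguments fno_depth {R}.
Arguments fno_A1 {R}.
Arguments fno_c1 {R}.
Arguments fno_A2 {R}.
Arguments fno_c2 {R}.
Arguments fno_W {R}.
Arguments fno_PA {R}.
Arguments fno_PB {R}.
Arguments fno_bA {R}.
Arguments fno_bB {R}.
Arguments fno_Q {R}.
Set Implicit Arguments.

Section FNOdefs.
Variable R : realType.

Definition relu_mx m n (A : 'M[R]_(m, n)) : 'M[R]_(m, n) :=
  map_mx (fun a => Num.max a 0) A.

Definition trep (x : R) : R := x - 2 * pi * (Num.floor (x / (2 * pi)))%:~R.

Definition grid (N : nat) (j : 'I_N) : R := 2 * pi * (j.+1)%:R / N%:R.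

Variable net : FNO R.

Local Notation dv := (fno_dv net).
Local Notation kmax := (fno_kmax net).

Definition wnum (i : 'I_(2 * kmax + 1)) : R := i%:R - kmax%:R.

Definition fno_lift (a x : R) : 'cV[R]_dv :=
  fno_A2 net *m relu_mx (fno_A1 net *m (\col_(i < 2) (if i == ord0 then a else trep x))
                         + fno_c1 net) + fno_c2 net.

(* Real part of  sum_{|k|<=kmax} bhat(k) e^{ikx} *)
Definition fno_bias (l : 'I_(fno_depth net)) (x : R) : 'cV[R]_dv :=
  \sum_(i < 2 * kmax + 1)
    (cos (wnum i * x) *: fno_bA net l i - sin (wnum i * x) *: fno_bB net l i).

(* Real part of  sum_{|k|<=kmax} P(k) F_N v(k) e^{ikx},  with
   F_N v(k) = 1/N sum_j v(x_j) e^{-ikx_j}: writing P = PA + i PB,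
   Re[P(k) F_N v(k) e^{ikx}] = PA alpha_k(x) - PB beta_k(x) where
   alpha_k(x) = 1/N sum_j cos(k (x - x_j)) v(x_j),
   beta_k(x)  = 1/N sum_j sin(k (x - x_j)) v(x_j). *)
Definition fno_K (N : nat) (l : 'I_(fno_depth net)) (v : R -> 'cV[R]_dv) (x : R)
  : 'cV[R]_dv :=
  \sum_(i < 2 * kmax + 1)
    (fno_PA net l i *m ((N%:R)^-1 *:
        \sum_(j < N) (cos (wnum i * (x - grid j)) *: v (grid j)))
     - fno_PB net l i *m ((N%:R)^-1 *:
        \sum_(j < N) (sin (wnum i * (x - grid j)) *: v (grid j)))).

Definition fno_layer (N : nat) (l : 'I_(fno_depth net)) (v : R -> 'cV[R]_dv)
  : R -> 'cV[R]_dv :=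
  fun x => relu_mx (fno_W net l *m v x + fno_bias l x + fno_K N l v x).

Definition fno_eval (N : nat) (u : R -> R) : R -> R :=
  let v0 := fun x => fno_lift (u x) x in
  let vL := foldl (fun v l => fno_layer N l v) v0 (enum 'I_(fno_depth net)) in
  fun x => (fno_Q net *m vL x) ord0 ord0.

(* total number of real tunable parameters (complex entries count twice) *)
Definition fno_size : nat :=
  (fno_width net * 2 + fno_width net + dv * fno_width net + dv)
  + fno_depth net * (dv * dv + (2 * kmax + 1) * (2 * (dv * dv))
                     + (2 * kmax + 1) * (2 * dv))
  + dv.

End FNOdefs.

(* Main.v *)
(* In the coordinate z = x - (xi - pi) the datum is sin z on [-pi, pi], with the
   shock at z = +-pi, and for T > pi the solution at time T is hw z = sin y,
   where y + T sin y = z and |y| <= pi / 2.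

   Uniqueness is proved without doubling of variables.  For m > 0 the branch
   V = sin y, (1 + m) y + t sin y = x, is a C^1 solution of the Burgers equation
   that is defined beyond |x| = pi.  Kruzhkov's inequality is summed against a
   partition of unity in the value V, the constant k running over a fine
   lattice; in the limit this gives the L^1 contraction between u and V.  At the
   shock the two traces of V are opposite, and the entropy flux has there the
   right sign.  Then m tends to 0.

   For the network, the layer-one Fourier mode turns the samples of sin z into
   cos z exactly, whatever N >= 3.  So the network has |sin z| and cos z, hence
   sin (|z| - a_j) for fixed centres a_j.  Clamping these values to
   [- sin h, sin h] and summing over j writes hw |z| as a fixed finite sum of
   functions t |-> hw (a_j + asin t), which are analytic in t: a family of functions
   closed under differentiation bounds the Taylor coefficients, and Horner's rule
   with Yarotsky's ReLU multiplication costs n^2 layers for an error 2^-n.  A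
   final gate restores the sign of z and is wrong only on a set of measure
   O(2^-n), near z = 0 and z = +-pi. *)

Require Import Defs.
From HB Require Import structures.
From mathcomp Require Import all_boot all_order all_algebra.
From mathcomp Require Import all_classical all_reals all_analysis.
From mathcomp Require Import measurable_realfun zify ring lra.
Import Order.TTheory GRing.Theory Num.Theory.
Import numFieldNormedType.Exports.
Local Open Scope classical_set_scope.
Local Open Scope ring_scope.

Lemma is_derive_quad (R : realType) (f : R -> R) (a l C d : R) : 0 < d ->
  (forall h, `|h| < d -> `|f (a + h) - f a - l * h| <= C * h ^+ 2) ->
  is_derive a (1 : R) f l.
Proof.
move=> d0 H.
have C0 : 0 <= C.
  have := H (d / 2); rewrite gtr0_norm ?divr_gt0// => /(_ ltac:(lra)).
  move=> /(le_trans (normr_ge0 _)); rewrite pmulr_lge0//.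
  by rewrite exprn_gt0// divr_gt0.
suff cv : h^-1 *: ((f \o shift a) (h *: (1:R)) - f a) @[h --> 0^'] --> (l : R).
  by apply: DeriveDef; [apply/cvg_ex; exists l | exact: (cvg_lim _ cv)].
apply/cvgrPdist_le => e e0.
have q0 : 0 < e / (C + 1) by apply: divr_gt0 => //; lra.
have dd0 : 0 < Num.min d (e / (C + 1)) by rewrite lt_min d0.
near=> h.
have h0 : h != 0 by near: h; exact: nbhs_dnbhs_neq.
have hd : `|h| < Num.min d (e / (C + 1)).
  near: h; apply: dnbhs0_lt => //.
rewrite lt_min in hd; case/andP: hd => hd he.
have hp : 0 < `|h| by rewrite normr_gt0.
rewrite /= /shift /= scaler1 -(ler_pM2l hp) -normrM.
have -> : h * (l - h^-1 *: (f (h + a) - f a)) = - (f (a + h) - f a - l * h).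
  by rewrite /GRing.scale /= (addrC h a); field.
rewrite normrN; apply: (le_trans (H h hd)).
rewrite -real_normK ?num_real// expr2 mulrA mulrC ler_pM2l//.
rewrite ltr_pdivlMr in he; last by lra.
have := normr_ge0 h; nra.
Unshelve. all: by end_near.
Qed.

Section trig.
Variable R : realType.
Implicit Types x y t m : R.

Lemma MVT_le (f df : R -> R) (a b : R) : a <= b ->
  (forall x, is_derive x (1:R) f (df x)) ->
  exists2 c, a <= c <= b & f b - f a = df c * (b - a).
Proof.
move=> ab Hd.
have [c cab E] := @MVT_segment R f df a b ab (fun x _ => Hd x)
  (continuous_subspaceT (fun x => @differentiable_continuous _ _ _ x f
     (iffLR (derivable1_diffP _ _) (@ex_derive _ _ _ _ _ _ _ (Hd x))))).
by exists c.
Qed.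

Lemma lip_of_derive (f df : R -> R) (x y : R) :
  (forall x, is_derive x (1:R) f (df x)) -> (forall x, `|df x| <= 1) ->
  `|f x - f y| <= `|x - y|.
Proof.
move=> Hd Hb.
wlog le : x y / y <= x => [W|].
  by case: (leP y x) => [|/ltW] /W //; rewrite distrC [X in _ <= X]distrC.
have [c _ ->] := MVT_le _ _ _ _ le Hd.
by rewrite normrM ler_piMl.
Qed.

Lemma sin_lip x y : `|sin x - sin y| <= `|x - y|.
Proof. by apply: (lip_of_derive sin cos) => z; rewrite cos_max. Qed.

Lemma cos_lip x y : `|cos x - cos y| <= `|x - y|.
Proof. by apply: (lip_of_derive cos (-%R \o sin)) => z; rewrite /= normrN sin_max. Qed.

Lemma sin_taylor1 x y : `|sin x - sin y - cos y * (x - y)| <= (x - y) ^+ 2.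
Proof.
have [c H ->] : exists2 c, `|c - y| <= `|x - y| & sin x - sin y = cos c * (x - y).
  have [le|/ltW le] := leP y x.
    have [c /andP[c1 c2] E] := MVT_le _ _ _ _ le (@is_derive_sin R).
    by exists c => //; rewrite !ger0_norm ?subr_ge0// lerD2r.
  have [c /andP[c1 c2] E] := MVT_le _ _ _ _ le (@is_derive_sin R).
  exists c; first by rewrite !ler0_norm ?subr_le0//; lra.
  by lra.
rewrite -mulrBl normrM -(real_normK (num_real (x - y))) expr2.
by rewrite ler_wpM2r// (le_trans (cos_lip _ _)).
Qed.

Lemma cos_le x y : 0 <= x -> x <= y -> y <= pi -> cos y <= cos x.
Proof.
move=> x0; rewrite le_eqVlt => /predU1P[->//|xy] yp.
by apply/ltW; rewrite ltr_cos ?in_itv /=; lra.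
Qed.

Lemma sin_ge_xcos x : 0 <= x <= pi -> x * cos x <= sin x.
Proof.
move=> /andP[x0 xp].
have [c /andP[c0 cx] E] := MVT_le _ _ _ _ x0 (@is_derive_sin R).
rewrite sin0 !subr0 in E; rewrite E mulrC ler_wpM2r//.
by apply: cos_le; lra.
Qed.

Definition clamp (a b x : R) : R := Num.max a (Num.min b x).

Lemma clamp_itv (a b x : R) : a <= b -> a <= clamp a b x <= b.
Proof. by move=> ab; rewrite /clamp le_max lexx /= ge_max ab ge_min lexx. Qed.

Lemma clamp_id (a b x : R) : a <= x <= b -> clamp a b x = x.
Proof. by case/andP=> ax xb; rewrite /clamp (min_r xb) (max_r ax). Qed.

Lemma clampN (b x : R) : 0 <= b -> clamp (- b) b (- x) = - clamp (- b) b x.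
Proof.
move=> b0; rewrite /clamp /Order.max /Order.min.
by repeat case: ifP; intros; lra.
Qed.

Lemma clamp_lip (a b x y : R) : a <= b -> `|clamp a b x - clamp a b y| <= `|x - y|.
Proof.
move=> ab; rewrite ler_norml.
have := ler_norm (x - y); have := ler_norm (y - x); rewrite distrC => h1 h2.
rewrite /clamp /Order.max /Order.min.
by repeat case: ifP; intros; lra.
Qed.
End trig.

(** * Regularised characteristics *)

Section kepler.
Variable R : realType.
Implicit Types x y t m : R.

(* kep m t y is the position at time t of the characteristic of speed sin y that
   starts at (1 + m) y; good t y says that it has not run into its neighbours,
   even for m = 0. *)
Definition kep m t y := (1 + m) * y + t * sin y.
Definition good t y := - pi <= y <= pi /\ 0 <= 1 + t * cos y.

Lemma cos_min_itv (y1 y2 c : R) : - pi <= y1 -> y2 <= pi -> y1 <= c <= y2 ->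
  cos y1 <= cos c \/ cos y2 <= cos c.
Proof.
move=> h1 h2 /andP[c1 c2].
have [c0|/ltW c0] := leP 0 c.
  by right; apply: cos_le; lra.
by left; rewrite -(cosN y1) -(cosN c); apply: cos_le; lra.
Qed.

Lemma good_le t t' y : 0 <= t <= t' -> good t' y -> good t y.
Proof.
move=> /andP[t0 tt'] [yp H]; split=> //.
have [c0|/ltW c0] := leP 0 (cos y); first by nra.
nra.
Qed.

Lemma goodN t y : good t y -> good t (- y).
Proof. by case=> h H; split; rewrite ?cosN//; lra. Qed.

Lemma kepN m t y : kep m t (- y) = - kep m t y.
Proof. by rewrite /kep sinN; ring. Qed.

Lemma kep_slope m t y1 y2 : 0 <= t -> good t y1 -> good t y2 -> y1 <= y2 ->
  m * (y2 - y1) <= kep m t y2 - kep m t y1.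
Proof.
move=> t0 [/andP[p1 p1'] g1] [/andP[p2 p2'] g2] le.
have [c cab E] := MVT_le _ _ _ _ _ le (@is_derive_sin R).
have gc : 0 <= 1 + t * cos c.
  by have [h|h] := cos_min_itv _ _ _ p1 p2' cab; nra.
rewrite /kep; suff : 0 <= (y2 - y1) + t * (sin y2 - sin y1) by lra.
by rewrite E; nra.
Qed.

Lemma kep_lip m t t' y y' : 0 < m -> 0 <= t -> 0 <= t' -> good t y -> good t' y' ->
  m * `|y' - y| <= `|kep m t' y' - kep m t y| + `|t' - t|.
Proof.
move=> m0 t0 t0'.
wlog le : t t' y y' t0 t0' / t <= t' => [W g g'|g g'].
  have [le|/ltW le] := leP t t'; first exact: W.
  by rewrite (distrC y') (distrC (kep _ _ _)) (distrC t'); exact: W.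
have g2 : good t y' by apply: good_le g'; rewrite t0 le.
have K : m * `|y' - y| <= `|kep m t y' - kep m t y|.
  have [yy|/ltW yy] := leP y y'.
    rewrite (ger0_norm (_ : 0 <= y' - y)); last by lra.
    by apply: le_trans (ler_norm _); exact: kep_slope.
  rewrite distrC [X in _ <= X]distrC (ger0_norm (_ : 0 <= y - y')); last by lra.
  by apply: le_trans (ler_norm _); exact: kep_slope.
apply: (le_trans K).
have -> : kep m t y' - kep m t y = (kep m t' y' - kep m t y) - (t' - t) * sin y'.
  by rewrite /kep; ring.
apply: (le_trans (ler_normB _ _)); rewrite lerD2l normrM ler_piMr// sin_max//.
Qed.

Lemma kep_exists m t x : 0 <= m -> 0 <= t -> `|x| <= pi + m * (pi / 2) ->
  exists y, good t y /\ kep m t y = x.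
Proof.
move=> m0 t0.
wlog x0 : x / 0 <= x => [W xp|].
  have [x0|/ltW x0] := leP 0 x; first exact: W.
  have [||y [gy yE]] := W (- x); first by rewrite oppr_ge0.
    by rewrite normrN.
  by exists (- y); split; [exact: goodN | rewrite kepN yE opprK].
rewrite ger0_norm// => xp.
have pi0 := pi_gt0 R.
suff [c [/andP[c0 cp] gc Hc]] : exists c : R,
    [/\ 0 <= c <= pi, 0 <= 1 + t * cos c & pi + m * (pi / 2) <= kep m t c].
  have [|||y] := @IVT R (kep m t) 0 c x => //.
    apply: continuous_subspaceT => z.
    apply: continuousD; apply: continuousM => //; try exact: cst_continuous.
    exact: continuous_sin.
    rewrite {1 3}/kep mulr0 sin0 mulr0 addr0.
    have k0 : 0 <= kep m t c by nra.
    by rewrite (min_l k0) (max_r k0) x0 /=; lra.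
  rewrite in_itv /= => /andP[y0 yc] yE; exists y; split=> //; split; first by lra.
  have : cos c <= cos y by apply: cos_le; lra.
  by nra.
have [t1|t1] := leP t 1.
  exists pi; split; rewrite ?lexx ?andbT ?(ltW pi0)//; rewrite /kep ?cospi ?sinpi; nra.
have t_gt0 : 0 < t by lra.
have it : 0 < t^-1 < 1 by rewrite invr_gt0 t_gt0 invf_lt1.
pose b := acos t^-1.
have b0 : 0 <= b by apply: acos_ge0; lra.
have b2 : b <= pi / 2.
  rewrite leNgt; apply/negP => h.
  have : cos b <= cos (pi / 2) by apply: cos_le; have := @acos_lepi R t^-1 ltac:(lra); rewrite -/b; lra.
  by rewrite cos_pihalf /b acosK ?in_itv /=; lra.
have cb : cos b = t^-1 by rewrite /b acosK// in_itv /=; lra.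
have tb : t * cos b = 1 by rewrite cb divff// gt_eqF.
exists (pi - b); split; first by lra.
  by rewrite cosB cospi sinpi; lra.
have := sin_ge_xcos R b ltac:(lra).
rewrite /kep sinB cospi sinpi => h.
have : b <= t * sin b by nra.
nra.
Qed.

Definition kep_sols m T x t : set R :=
  [set y | good (clamp _ 0 T t) y /\ kep m (clamp _ 0 T t) y
    = clamp _ (- (pi + m * (pi / 2))) (pi + m * (pi / 2)) x].

Definition yroot m T x t : R := xget 0 (kep_sols m T x t).

Section yroot.
Variables m T : R.
Hypotheses (m0 : 0 < m) (T0 : 0 <= T).
Local Notation X := (pi + m * (pi / 2)).
Local Notation y := (yroot m T).

Let X0 : 0 <= X. Proof. by have p0 := pi_ge0 R; rewrite addr_ge0// mulr_ge0 ?divr_ge0// ltW. Qed.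

Lemma yrootP x t : good (clamp _ 0 T t) (y x t) /\
  kep m (clamp _ 0 T t) (y x t) = clamp _ (- X) X x.
Proof.
have /andP[h1 h2] := clamp_itv _ 0 T t T0.
have [z Hz] : exists z, good (clamp _ 0 T t) z /\ kep m (clamp _ 0 T t) z = clamp _ (- X) X x.
  apply: kep_exists => //; first exact: ltW.
  by rewrite ler_norml; apply: clamp_itv; have := X0; lra.
exact: (@xgetPex _ 0 (kep_sols m T x t) (ex_intro _ z Hz)).
Qed.

Lemma yroot_lip x t x' t' : m * `|y x' t' - y x t| <= `|x' - x| + `|t' - t|.
Proof.
have [g E] := yrootP x t; have [g' E'] := yrootP x' t'.
have /andP[h1 h2] := clamp_itv _ 0 T t T0.
have /andP[h1' h2'] := clamp_itv _ 0 T t' T0.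
apply: (le_trans (kep_lip _ _ _ _ _ m0 h1 h1' g g')).
rewrite E E'; apply: lerD; apply: clamp_lip => //.
by have := X0; lra.
Qed.

Lemma yrootN x t : y (- x) t = - y x t.
Proof.
have [g E] := yrootP x t; have [g' E'] := yrootP (- x) t.
have /andP[h1 h2] := clamp_itv _ 0 T t T0.
have := kep_lip _ _ _ _ _ m0 h1 h1 (goodN _ _ g) g'.
rewrite kepN E E' clampN; last exact: X0.
rewrite subrr normr0 add0r subrr normr0.
move=> h; apply/eqP; rewrite -subr_eq0 -normr_le0.
by rewrite -(pmulr_rle0 _ m0).
Qed.

Definition den x t := 1 + m + t * cos (y x t).

Lemma den_ge x t : 0 <= t <= T -> m <= den x t.
Proof. by move=> tT; have [[_ g] _] := yrootP x t; rewrite clamp_id// in g; rewrite /den; lra. Qed.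

Lemma is_derive_yroot_x x t : `|x| < X -> 0 <= t <= T ->
  is_derive x (1:R) (fun z => y z t) (den x t)^-1.
Proof.
move=> xX tT.
have d0 : 0 < X - `|x| by rewrite subr_gt0.
apply: (@is_derive_quad _ _ _ _ (T / m ^+ 3) (X - `|x|)) => // h hd.
have xhX : `|x + h| <= X by apply: (le_trans (ler_normD _ _)); lra.
have [g E] := yrootP x t; have [g' E'] := yrootP (x + h) t.
rewrite (clamp_id _ 0 T t tT) in g E g' E'.
rewrite clamp_id in E; last by rewrite -ler_norml ltW.
rewrite clamp_id in E'; last by rewrite -ler_norml.
have := yroot_lip x t (x + h) t.
rewrite subrr normr0 addr0 (_ : x + h - x = h); last by ring.
move: (den_ge x t tT) E E' (sin_taylor1 _ (y (x + h) t) (y x t)).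
rewrite /den /kep; set A := 1 + m + _; move=> mA E E'.
move: (y (x + h) t) (y x t) (cos (y x t)) @A mA E E' => y2 y1 C1 A mA E E'.
set rem := sin y2 - sin y1 - C1 * (y2 - y1) => Hrem Hlip.
have A0 : 0 < A by exact: lt_le_trans mA.
have -> : y2 - y1 - A^-1 * h = - (t / A) * rem.
  have -> : h = A * (y2 - y1) + t * rem by rewrite /rem /A; lra.
  by field; rewrite gt_eqF.
case/andP: tT => t0 tT.
have Hy : (y2 - y1) ^+ 2 <= h ^+ 2 / m ^+ 2.
  rewrite ler_pdivlMr ?exprn_gt0// -exprMn -[X in _ <= X]real_normK ?num_real//.
  rewrite -real_normK ?num_real// normrM (gtr0_norm m0) mulrC.
  by rewrite ler_sqr ?nnegrE// mulr_ge0// ltW.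
rewrite normrM normrN (ger0_norm (_ : 0 <= t / A)); last by rewrite divr_ge0// ltW.
have -> : T / m ^+ 3 * h ^+ 2 = (T / m) * (h ^+ 2 / m ^+ 2) by field; rewrite gt_eqF.
apply: ler_pM => //; first by rewrite divr_ge0// ltW.
  by apply: ler_pM => //; [rewrite invr_ge0 ltW | rewrite lef_pV2].
exact: le_trans Hrem Hy.
Qed.

Lemma is_derive_yroot_t x t : `|x| <= X -> 0 < t < T ->
  is_derive t (1:R) (fun s => y x s) (- sin (y x t) / den x t).
Proof.
move=> xX /andP[t0 tT].
have d0 : 0 < Num.min t (T - t) by rewrite lt_min t0 subr_gt0.
apply: (@is_derive_quad _ _ _ _ ((T / m ^+ 2 + m^-1) / m) (Num.min t (T - t))) => // h.
rewrite lt_min => /andP[h1 h2].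
have tT1 : 0 <= t <= T by lra.
have tT2 : 0 <= t + h <= T.
  by move: h1 h2; rewrite !ltr_norml; lra.
have [g E] := yrootP x t; have [g' E'] := yrootP x (t + h).
rewrite (clamp_id _ 0 T _ tT1) in g E; rewrite (clamp_id _ 0 T _ tT2) in g' E'.
rewrite clamp_id in E; last by rewrite -ler_norml.
rewrite clamp_id in E'; last by rewrite -ler_norml.
have := yroot_lip x t x (t + h).
rewrite subrr normr0 add0r (_ : t + h - t = h); last by ring.
move: (den_ge x t tT1) E E' (sin_taylor1 _ (y x (t + h)) (y x t)) (sin_lip _ (y x (t + h)) (y x t)).
rewrite /den /kep; set A := 1 + m + _; move=> mA E E'.
move: (y x (t + h)) (y x t) (cos (y x t)) @A mA E E' => y2 y1 C1 A mA E E'.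
set rem := sin y2 - sin y1 - C1 * (y2 - y1) => Hrem Hs Hlip.
have A0 : 0 < A by exact: lt_le_trans mA.
have -> : y2 - y1 - (- sin y1 / A) * h = - ((t * rem + h * (sin y2 - sin y1)) / A).
  apply: (mulIf (lt0r_neq0 A0)); rewrite mulrBl mulNr.
  rewrite (_ : - (sin y1 / A) * h * A = - (sin y1 * h)); last by field; rewrite gt_eqF.
  rewrite mulNr divfK ?gt_eqF//.
  by rewrite /rem /A; lra.
have Hl : `|y2 - y1| <= `|h| / m by rewrite ler_pdivlMr// mulrC.
have Hy : (y2 - y1) ^+ 2 <= h ^+ 2 / m ^+ 2.
  rewrite -[h ^+ 2]real_normK ?num_real// -real_normK ?num_real// -expr_div_n.
  by rewrite ler_sqr ?nnegrE// divr_ge0// ltW.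
rewrite normrN normrM normfV (gtr0_norm A0).
rewrite -mulrA [m^-1 * _]mulrC mulrA.
apply: ler_pM => //; first by rewrite invr_ge0 ltW.
  apply: (le_trans (ler_normD _ _)); rewrite mulrDl !normrM (gtr0_norm t0).
  apply: lerD.
    rewrite -mulrA [_^-1 * _]mulrC; apply: ler_pM => //; [exact: ltW | exact: ltW|].
    exact: le_trans Hrem Hy.
  rewrite -[h ^+ 2]real_normK ?num_real// expr2 mulrCA; apply: ler_pM => //.
  by rewrite mulrC; exact: le_trans Hs Hl.
by rewrite lef_pV2.
Qed.

End yroot.
End kepler.

Section smoothstep.
Variable R : realType.
Implicit Types s x : R.

Definition sstep s := let c := clamp R 0 1 s in 3 * c ^+ 2 - 2 * c ^+ 3.
Definition dstep s := let c := clamp R 0 1 s in 6 * c * (1 - c).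

Lemma clamp01_cases s : [\/ s <= 0 /\ clamp R 0 1 s = 0, 0 <= s <= 1 /\ clamp R 0 1 s = s
  | 1 <= s /\ clamp R 0 1 s = 1].
Proof.
have [h|h] := leP s 0.
  apply: Or31; split=> //; rewrite /clamp /Order.max /Order.min.
  by repeat case: ifP; intros; lra.
have [h'|h'] := leP s 1.
  by apply: Or32; split; [lra | apply: clamp_id; lra].
apply: Or33; split; first lra.
rewrite /clamp /Order.max /Order.min.
by repeat case: ifP; intros; lra.
Qed.

Lemma sstep_itv s : 0 <= sstep s <= 1.
Proof.
rewrite /sstep /=; have := clamp_itv R 0 1 s ler01.
move: (clamp R 0 1 s) => c /andP[c0 c1]; apply/andP; split.
  have -> : 3 * c ^+ 2 - 2 * c ^+ 3 = c ^+ 2 * (1 + 2 * (1 - c)) by ring.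
  by rewrite mulr_ge0 ?sqr_ge0//; lra.
rewrite -subr_ge0 (_ : _ - _ = (1 - c) ^+ 2 * (1 + 2 * c)); last ring.
by rewrite mulr_ge0 ?sqr_ge0//; lra.
Qed.

Lemma dstep_itv s : 0 <= dstep s <= 3 / 2.
Proof.
rewrite /dstep /=; have := clamp_itv R 0 1 s ler01.
move: (clamp R 0 1 s) => c /andP[c0 c1]; have := sqr_ge0 (2 * c - 1).
rewrite (_ : (2 * c - 1) ^+ 2 = 1 - 4 * (c * (1 - c))); last ring.
by have := mulr_ge0 c0 (_ : 0 <= 1 - c); rewrite -mulrA; lra.
Qed.

Lemma clamp01_le0 s : s <= 0 -> clamp R 0 1 s = 0.
Proof. by move=> s0; case: (clamp01_cases s) => -[h ->]; lra. Qed.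

Lemma clamp01_ge1 s : 1 <= s -> clamp R 0 1 s = 1.
Proof. by move=> s0; case: (clamp01_cases s) => -[h ->]; lra. Qed.

Lemma sstep_le0 s : s <= 0 -> sstep s = 0.
Proof. by move=> s0; rewrite /sstep clamp01_le0//; ring. Qed.

Lemma sstep_ge1 s : 1 <= s -> sstep s = 1.
Proof. by move=> s0; rewrite /sstep clamp01_ge1//; ring. Qed.

Lemma dstep_le0 s : s <= 0 -> dstep s = 0.
Proof. by move=> s0; rewrite /dstep clamp01_le0//; ring. Qed.

Lemma dstep_ge1 s : 1 <= s -> dstep s = 0.
Proof. by move=> s0; rewrite /dstep clamp01_ge1//; ring. Qed.

Lemma sstep_mono s s' : s <= s' -> sstep s <= sstep s'.
Proof.
move=> ss'; rewrite /sstep /=.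
have le : clamp R 0 1 s <= clamp R 0 1 s'.
  by rewrite /clamp /Order.max /Order.min; repeat case: ifP; intros; lra.
have /andP[a1 a2] := clamp_itv R 0 1 s ler01; have /andP[b1 b2] := clamp_itv R 0 1 s' ler01.
move: (clamp R 0 1 s) (clamp R 0 1 s') le a1 a2 b1 b2 => c d le a1 a2 b1 b2.
have -> : 3 * d ^+ 2 - 2 * d ^+ 3 = 3 * c ^+ 2 - 2 * c ^+ 3
  + (d - c) * (2 * (c * (1 - c)) + 2 * (d * (1 - d)) + c * (1 - d) + d * (1 - c)) by ring.
rewrite lerDl; apply: mulr_ge0; first lra.
by rewrite !addr_ge0// ?mulr_ge0//; lra.
Qed.

Lemma is_derive_sstep s : is_derive s (1 : R) sstep (dstep s).
Proof.
apply: (@is_derive_quad _ _ _ _ 17 1) => // h h1.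
rewrite ltr_norml in h1; case/andP: h1 => h1 h2.
pose c := clamp R 0 1 s; pose d := clamp R 0 1 (s + h).
have /andP[c0 c1] : 0 <= c <= 1 := clamp_itv R 0 1 s ler01.
have /andP[d0 d1] : 0 <= d <= 1 := clamp_itv R 0 1 (s + h) ler01.
have eh : (d - c) ^+ 2 <= h ^+ 2.
  rewrite -real_normK ?num_real// -[h ^+ 2]real_normK ?num_real// ler_sqr ?nnegrE//.
  by apply: (le_trans (clamp_lip _ _ _ _ _ ler01)); rewrite (_ : s + h - s = h)//; ring.
have H2 : `|6 * c * (1 - c) * (d - c - h)| <= 6 * h ^+ 2.
  rewrite ler_norml /c /d; case: (clamp01_cases s) => -[hs ->].
  - by rewrite mulr0 !mul0r; have := sqr_ge0 h; lra.
  - case: (clamp01_cases (s + h)) => -[hsh ->].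
    + have e1 : 0 <= s * (1 - s) <= - h by nra.
      by apply/andP; split; nra.
    + by rewrite (_ : s + h - s - h = 0) ?mulr0; [have := sqr_ge0 h; lra | ring].
    + have e1 : 0 <= s * (1 - s) <= h by nra.
      by apply/andP; split; nra.
  - by rewrite subrr mulr0 mul0r; have := sqr_ge0 h; lra.
rewrite /sstep /dstep -/c -/d.
have -> : 3 * d ^+ 2 - 2 * d ^+ 3 - (3 * c ^+ 2 - 2 * c ^+ 3) - 6 * c * (1 - c) * h
  = (d - c) ^+ 2 * (3 - 6 * c - 2 * (d - c)) + 6 * c * (1 - c) * (d - c - h) by ring.
apply: (le_trans (ler_normD _ _)).
rewrite (_ : 17 * h ^+ 2 = h ^+ 2 * 11 + 6 * h ^+ 2); last ring.
apply: lerD => //; rewrite normrM (ger0_norm (sqr_ge0 _)); apply: ler_pM => //.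
  exact: sqr_ge0.
by rewrite ler_norml; lra.
Qed.

Lemma continuous_of_lip (f : R -> R) (L : R) : (forall x y, `|f x - f y| <= L * `|x - y|) ->
  continuous f.
Proof.
move=> Hf x; apply/cvgrPdist_le => e e0.
have L0 : 0 <= L.
  have := Hf 1 0; rewrite subr0 normr1 mulr1; exact: le_trans (normr_ge0 _).
near=> z.
apply: (le_trans (Hf _ _)).
have : `|x - z| <= e / (L + 1).
  near: z; apply: cvgr_dist_le; first exact: cvg_id.
  by rewrite divr_gt0//; lra.
rewrite ler_pdivlMr; last lra.
have := normr_ge0 (x - z); nra.
Unshelve. all: by end_near. Qed.

Lemma continuous_clamp (a b : R) : a <= b -> continuous (clamp R a b).
Proof. by move=> ab; apply: (@continuous_of_lip _ 1) => x y; rewrite mul1r; exact: clamp_lip. Qed.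

Lemma continuous_dstep : continuous dstep.
Proof.
move=> s; rewrite /dstep /=.
have c := continuous_clamp 0 1 ler01.
apply: cvgM; last by apply: cvgB; [exact: cvg_cst | exact: c].
by apply: cvgM; [exact: cvg_cst | exact: c].
Qed.

Lemma continuous_sstep : continuous sstep.
Proof.
move=> s; exact: (@differentiable_continuous _ _ _ s sstep
  (iffLR (derivable1_diffP _ _) (@ex_derive _ _ _ _ _ _ _ (is_derive_sstep s)))).
Qed.

Lemma hat_sum_gen (g : R -> R) (b : R) (F : nat -> R) (n j : nat) (x : R) :
  (forall s, s <= 0 -> g s = 0) -> (forall s, 1 <= s -> g s = b) ->
  j%:R <= x <= j.+1%:R -> (j.+1 < n)%N ->
  \sum_(i < n) F i * (g (x - i%:R + 1) - g (x - i%:R))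
  = F j * (b - g (x - j%:R)) + F j.+1 * g (x - j%:R).
Proof.
move=> g0 g1 /andP[jx xj] jn.
pose G i := F i * (g (x - i%:R + 1) - g (x - i%:R)).
rewrite -(big_mkord xpredT G) (@big_cat_nat _ _ _ j) //=; last by rewrite ltnW // ltnW.
rewrite big_nat big1 ?add0r => [|i /andP[_ ij]]; last first.
  have : i.+1%:R <= j%:R :> R by rewrite ler_nat.
  rewrite -natr1 => ij'; rewrite /G !g1 ?subrr ?mulr0//; lra.
rewrite big_ltn ?(ltnW jn)// big_ltn// big_nat big1 ?addr0 => [|i /andP[ij _]]; last first.
  have : j.+2%:R <= i%:R :> R by rewrite ler_nat.
  rewrite -natr1 => ij'; rewrite /G !g0 ?subrr ?mulr0//; lra.
rewrite /G -natr1 (g1 (x - j%:R + 1)); last lra.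
rewrite (_ : x - (j%:R + 1) + 1 = x - j%:R); last ring.
by rewrite (g0 (x - (j%:R + 1))) ?subr0//; rewrite -natr1 in xj; lra.
Qed.

Lemma sstep_sum (F : nat -> R) (n j : nat) (x : R) :
  j%:R <= x <= j.+1%:R -> (j.+1 < n)%N ->
  \sum_(i < n) F i * (sstep (x - i%:R + 1) - sstep (x - i%:R))
  = F j * (1 - sstep (x - j%:R)) + F j.+1 * sstep (x - j%:R).
Proof. by apply: hat_sum_gen; [exact: sstep_le0 | exact: sstep_ge1]. Qed.

Lemma dstep_sum (F : nat -> R) (n j : nat) (x : R) :
  j%:R <= x <= j.+1%:R -> (j.+1 < n)%N ->
  \sum_(i < n) F i * (dstep (x - i%:R + 1) - dstep (x - i%:R))
  = (F j.+1 - F j) * dstep (x - j%:R).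
Proof.
move=> hx hj; rewrite (hat_sum_gen _ 0 _ _ j)//; [lra | exact: dstep_le0 | exact: dstep_ge1].
Qed.
End smoothstep.

(** * Kruzhkov's inequality against a smooth solution *)

Section kruzkov.
Variable R : realType.
Implicit Types u k V h : R.

Definition kq u k : R := `|u - k| * (u + k) / 2.

Lemma kqE u k : Num.sg (u - k) * (burgers_flux u - burgers_flux k) = kq u k.
Proof.
rewrite /kq /burgers_flux normrEsg.
have -> : u ^+ 2 / 2 - k ^+ 2 / 2 = (u - k) * (u + k) / 2 by field.
by rewrite !mulrA.
Qed.

Lemma norm_cases x : (0 <= x /\ `|x| = x) \/ (x <= 0 /\ `|x| = - x :> R).
Proof. by have [h|h] := leP 0 x; [left; rewrite ger0_norm | right; rewrite ler0_norm ltW]. Qed.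

Lemma kq_lip M u k V : `|k| <= M -> `|V| <= M -> `|kq u k - kq u V| <= M * `|k - V|.
Proof.
rewrite !ler_norml => /andP[k1 k2] /andP[v1 v2]; rewrite /kq.
wlog le : k V k1 k2 v1 v2 / k <= V => [W|].
  have [le|/ltW le] := leP k V; first exact: W.
  have := W V k v1 v2 k1 k2 le; rewrite (distrC V k) => /andP[a b]; lra.
rewrite (ler0_norm (_ : k - V <= 0)); last lra.
case: (norm_cases (u - k)) => -[hk ->]; case: (norm_cases (u - V)) => -[hv ->];
  apply/andP; split; nra.
Qed.

Lemma kq_opp u a : 0 <= a -> kq u (- a) <= kq u a.
Proof.
move=> a0; rewrite /kq.
case: (norm_cases (u - a)) => -[hk ->]; case: (norm_cases (u - - a)) => -[hv ->]; nra.
Qed.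

Lemma kq_bound M u k : `|u| <= M -> `|k| <= M -> `|kq u k| <= 2 * M ^+ 2.
Proof.
move=> uM kM; have M0 := le_trans (normr_ge0 _) uM.
rewrite /kq !normrM normfV normr_id (ger0_norm (_ : 0 <= 2 :> R))//.
have h1 := le_trans (ler_normB u k) (lerD uM kM).
have h2 := le_trans (ler_normD u k) (lerD uM kM).
have := ler_pM (normr_ge0 _) (normr_ge0 _) h1 h2; lra.
Qed.

Lemma kq_remainder u k V h : 0 <= h -> k <= V <= k + h ->
  `|(kq u (k + h) - V * `|u - (k + h)|) - (kq u k - V * `|u - k|)| <= h ^+ 2.
Proof.
move=> h0 /andP[kV Vk]; rewrite /kq ler_norml.
case: (norm_cases (u - k)) => -[hk ->]; case: (norm_cases (u - (k + h))) => -[hv ->];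
  apply/andP; split; nra.
Qed.

(* Discretization in the level k of Kruzhkov's inequality with the constant k
   replaced by V: the hats psi sum up to 1, and the terms in dpsi nearly cancel
   because d/dk [q(u,k) - V |u - k|] = O(|k - V|). *)
Lemma kruzkov_sum (K : nat) (h u V M L a a2 b vx : R) :
  0 < h -> `|V| < K%:R * h -> K%:R * h <= M -> 0 <= b -> `|vx| <= L ->
  \sum_(i < (2 * K).+1) (let k := (i%:R - K%:R) * h in
     let x := V / h + K%:R in
     let psi := sstep R (x - i%:R + 1) - sstep R (x - i%:R) in
     let dpsi := (dstep R (x - i%:R + 1) - dstep R (x - i%:R)) / h in
     `|u - k| * (a * psi + b * (dpsi * (- V * vx)))
     + kq u k * (a2 * psi + b * (dpsi * vx)))
  <= a * `|u - V| + a2 * kq u V + h * (`|a| + `|a2| * M + b * L * 2).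
Proof.
move=> h0 VK KM b0 vL.
set x := V / h + K%:R.
have xK : 0 < x < (2 * K)%:R.
  move: VK; rewrite ltr_norml => /andP[v1 v2].
  rewrite /x natrM; apply/andP; split.
    rewrite -ltrBlDr sub0r ltr_pdivlMr//; lra.
  rewrite -ltrBrDr ltr_pdivrMr//; lra.
case/andP: xK => x0 x2K.
have [j jx xj] : exists2 j : nat, j%:R <= x & x < j.+1%:R.
  by exists (Num.truncn x); have /andP[] := truncn_itv (ltW x0).
have jK : (j.+1 < (2 * K).+1)%N by rewrite ltnS -(@ltr_nat R) (le_lt_trans jx).
pose k0 := (j%:R - K%:R) * h.
have E1 : (j.+1%:R - K%:R) * h = k0 + h by rewrite /k0 -natr1; ring.
have Vx : V = k0 + (x - j%:R) * h by rewrite /k0 /x; field; rewrite gt_eqF.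
pose s := x - j%:R.
have s0 : 0 <= s <= 1 by rewrite /s; rewrite -natr1 in xj; lra.
have kV : k0 <= V <= k0 + h by rewrite Vx -/s; nra.
have bnd : forall i, (i <= (2 * K))%N -> `|(i%:R - K%:R) * h| <= M.
  move=> i iK; apply: le_trans KM; rewrite normrM (gtr0_norm h0) ler_pM2r//.
  rewrite ler_norml; have : i%:R <= (2 * K)%:R :> R by rewrite ler_nat.
  by rewrite natrM; have := ler0n R i; lra.
have k0M : `|k0| <= M by apply: bnd; rewrite -ltnS ltnW.
have k1M : `|k0 + h| <= M by rewrite -E1; apply: bnd; rewrite -ltnS.
have VM : `|V| <= M by apply: le_trans KM; exact: ltW.
pose F i := `|u - (i%:R - K%:R) * h|.
pose Q i := kq u ((i%:R - K%:R) * h).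
have -> : \sum_(i < (2 * K).+1) (let k := (i%:R - K%:R) * h in
     let psi := sstep R (x - i%:R + 1) - sstep R (x - i%:R) in
     let dpsi := (dstep R (x - i%:R + 1) - dstep R (x - i%:R)) / h in
     `|u - k| * (a * psi + b * (dpsi * (- V * vx)))
     + kq u k * (a2 * psi + b * (dpsi * vx)))
  = a * (\sum_(i < (2 * K).+1) F i * (sstep R (x - i%:R + 1) - sstep R (x - i%:R)))
  + a2 * (\sum_(i < (2 * K).+1) Q i * (sstep R (x - i%:R + 1) - sstep R (x - i%:R)))
  + b * vx / h * (\sum_(i < (2 * K).+1) (Q i - V * F i) * (dstep R (x - i%:R + 1) - dstep R (x - i%:R))).
  rewrite !mulr_sumr -!big_split /=; apply: eq_bigr => i _.
  by rewrite /F /Q; field; rewrite gt_eqF.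
rewrite (dstep_sum _ (fun i => Q i - V * F i) _ j) ?(ltW xj) ?jx//.
rewrite !(sstep_sum _ _ _ j) ?(ltW xj) ?jx// -/s /F /Q E1 -/k0.
have /andP[S0 S1] := sstep_itv R s; have /andP[D0 D1] := dstep_itv R s.
move: (sstep R s) (dstep R s) S0 S1 D0 D1 => S D S0 S1 D0 D1.
have d0 : `|k0 - V| <= h by rewrite ler_norml; lra.
have d1 : `|k0 + h - V| <= h by rewrite ler_norml; lra.
have M0 := le_trans (normr_ge0 _) VM.
have conv : forall c p q r, `|p - r| <= c -> `|q - r| <= c ->
    `|p * (1 - S) + q * S - r| <= c :> R.
  by move=> c p q r; rewrite !ler_norml => /andP[? ?] /andP[? ?]; apply/andP; split; nra.
have T1 : a * (`|u - k0| * (1 - S) + `|u - (k0 + h)| * S) <= a * `|u - V| + h * `|a|.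
  rewrite -lerBlDl -mulrBr; apply: (le_trans (ler_norm _)).
  rewrite normrM [h * _]mulrC ler_wpM2l//; apply: conv.
    apply: (le_trans (ler_dist_dist _ _)).
    by rewrite (_ : u - k0 - (u - V) = - (k0 - V)) ?normrN//; ring.
  apply: (le_trans (ler_dist_dist _ _)).
  by rewrite (_ : u - (k0 + h) - (u - V) = - (k0 + h - V)) ?normrN//; ring.
have T2 : a2 * (kq u k0 * (1 - S) + kq u (k0 + h) * S) <= a2 * kq u V + h * (`|a2| * M).
  rewrite -lerBlDl -mulrBr; apply: (le_trans (ler_norm _)).
  rewrite normrM mulrCA ler_wpM2l// [h * M]mulrC; apply: conv.
    by apply: (le_trans (kq_lip M _ _ _ _ _)) => //; rewrite ler_wpM2l.
  by apply: (le_trans (kq_lip M _ _ _ _ _)) => //; rewrite ler_wpM2l.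
have T3 : b * vx / h * ((kq u (k0 + h) - V * `|u - (k0 + h)| - (kq u k0 - V * `|u - k0|)) * D)
    <= h * (b * L * 2).
  apply: (le_trans (ler_norm _)); rewrite !normrM normfV (gtr0_norm h0) (ger0_norm b0) (ger0_norm D0).
  have H := kq_remainder u k0 V h (ltW h0) kV.
  rewrite [b * `|vx| / h * _]mulrAC ler_pdivrMr//.
  have H2 : `|kq u (k0 + h) - V * `|u - (k0 + h)| - (kq u k0 - V * `|u - k0|)| * D <= h ^+ 2 * 2.
    by apply: ler_pM => //; lra.
  have H3 : b * `|vx| <= b * L by rewrite ler_wpM2l.
  have := ler_pM (mulr_ge0 b0 (normr_ge0 vx)) (mulr_ge0 (normr_ge0 _) D0) H3 H2; lra.
lra.
Qed.
End kruzkov.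

Section measure_tools.
Variable R : realType.
Local Notation leb := (@lebesgue_measure R).
Local Notation MR := (measurableTypeR R).

Lemma open2_measurable (O : set (R * R)) : open O -> measurable (O : set (MR * MR)).
Proof.
move=> oO.
pose box (q : rat * rat * nat) : set (R * R) :=
  (ball (ratr q.1.1 : R) (q.2.+1%:R^-1)) `*` (ball (ratr q.1.2 : R) (q.2.+1%:R^-1)).
have -> : O = \bigcup_q (if `[< box q `<=` O >] then box q else set0).
  apply/seteqP; split=> [[x y] Oxy|p [q _]]; last by case: asboolP => // qO /qO.
  have [e e0 He] : exists2 e : R, 0 < e & ball (x, y) e `<=` O.
    by have /nbhs_ballP[e e0 He] := open_nbhs_nbhs (conj oO Oxy); exists e.
  have [n Hn] : exists n : nat, n.+1%:R^-1 < e / 2.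
    by exists (Num.truncn (e / 2)^-1); rewrite invf_plt ?posrE// ?divr_gt0// truncnS_gt.
  have n0 : 0 < n.+1%:R^-1 :> R by rewrite invr_gt0.
  have aux (z q k : R) : 0 < k -> z < q -> q < z + k -> `|z - q| < k.
    by move=> *; rewrite ltr_norml; lra.
  have rn (z : R) : exists q : rat, `|z - ratr q| < n.+1%:R^-1.
    have [q] : exists q, ratr q \in `]z, (z + n.+1%:R^-1)[ by apply: rat_in_itvoo; rewrite ltrDl.
    by rewrite in_itv /= => /andP[h1 h2]; exists q; exact: aux.
  have [[q1 H1] [q2 H2]] := (rn x, rn y).
  exists (q1, q2, n) => //; case: asboolP => [_|[]].
    by split; rewrite /ball /= distrC.
  move=> [a b] [h1 h2]; apply: He.
  have {}h1 : `|ratr q1 - a| < n.+1%:R^-1 := h1.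
  have {}h2 : `|ratr q2 - b| < n.+1%:R^-1 := h2.
  suff : `|x - a| < e /\ `|y - b| < e by [].
  rewrite (_ : x - a = (x - ratr q1) + (ratr q1 - a)); last by ring.
  rewrite (_ : y - b = (y - ratr q2) + (ratr q2 - b)); last by ring.
  have aux2 (p q k : R) : `|p| < k -> `|q| < k -> k < e / 2 -> `|p + q| < e.
    by move=> *; apply: (le_lt_trans (ler_normD _ _)); lra.
  by split; [exact: (aux2 _ _ _ H1 h1) | exact: (aux2 _ _ _ H2 h2)].
apply: countable_bigcupT_measurable; first exact: countableP.
move=> q; case: ifP => // _.
by apply: measurableX; apply: open_measurable; exact: ball_open.
Qed.

Lemma continuous2_measurable (f : R * R -> R) : continuous f ->
  measurable_fun setT (f : MR * MR -> R).
Proof.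
move=> /continuousP cf; apply: (measurability _ (RGenOpens.measurableE R)).
move=> _ [_ [a [b ->] <-]]; rewrite setTI; apply: open2_measurable.
exact/cf/interval_open.
Qed.

Let shift_meas (c : R) : measurable_fun setT (fun x : MR => (x + c : MR)).
Proof. by apply: continuous_measurable_fun => x; apply: cvgD; [exact: cvg_id | exact: cvg_cst]. Qed.

Lemma lebesgue_translate (c : R) (A : set MR) : measurable A ->
  pushforward leb (fun x : MR => (x + c : MR)) A = leb A.
Proof.
move=> mA; apply/esym.
unshelve refine (@lebesgue_measure_unique R (pushforward leb (fun x : MR => (x + c : MR))) _ A mA).
  exact: shift_meas.
move=> X [[a b] /= _ <-]; rewrite /= /pushforward.
have -> : (fun x : R => x + c) @^-1` `]a, b] = `]a - c, b - c]%classic.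
  by apply/seteqP; split=> x /=; rewrite !in_itv /=; lra.
rewrite !lebesgue_measure_itv /= !lte_fin.
rewrite (_ : (a - c < b - c) = (a < b)); last by apply/idP/idP; lra.
by case: ifP => // _; rewrite -!EFinD; congr EFin; ring.
Qed.

Lemma ge0_integral_translate (c : R) (f : R -> \bar R) (D : set R) :
  measurable (D : set MR) -> measurable_fun D (f : MR -> _) ->
  (forall x, D x -> (0 <= f x)%E) ->
  (\int[leb]_(x in D) f x = \int[leb]_(x in [set x | D (x + c)%R]) f (x + c)%R)%E.
Proof.
move=> mD mf f0.
rewrite -(@ge0_integral_pushforward _ _ _ _ _ (fun x : MR => (x + c : MR)) (shift_meas c) leb D f)//.
- unshelve refine (@eq_measure_integral _ MR R D (pushforward leb (fun x : MR => (x + c : MR))) leb f _).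
    exact: shift_meas.
  by move=> A mA _; exact/esym/lebesgue_translate.
- by move=> x; rewrite inE => /f0.
Qed.
Lemma bounded_integrable d (X : measurableType d) (mu : {measure set X -> \bar R})
  (f : X -> R) (D : set X) (M : R) : measurable D -> (mu D < +oo)%E ->
  measurable_fun setT f -> (forall x, `|f x| <= M) -> (forall x, ~ D x -> f x = 0) ->
  mu.-integrable setT (EFin \o f).
Proof.
move=> mD muD mf fM f0.
have -> : f = f \_ D.
  apply/funext => x; rewrite patchE; case: ifPn => // /negP; rewrite inE => /f0//.
rewrite -restrict_EFin; apply/integrable_restrict => //; rewrite setTI.
apply: measurable_bounded_integrable => //.
  exact: measurable_funS mf.
by exists M; split; [exact: num_real | move=> M' MM' x _; apply: le_trans (ltW MM')].
Qed.

End measure_tools.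

Section derive_tools.
Variable R : realType.

Lemma is_derive_mul (f g : R -> R) (x df dg : R) :
  is_derive x (1 : R) f df -> is_derive x (1 : R) g dg ->
  is_derive x (1 : R) (fun z => f z * g z) (df * g x + f x * dg).
Proof.
move=> Hf Hg; apply: (is_derive_eq (is_deriveM Hf Hg)).
by rewrite /GRing.scale /=; ring.
Qed.

Lemma is_derive_affine (f : R -> R) (al be x d : R) :
  is_derive (al * x + be) (1 : R) f d ->
  is_derive x (1 : R) (fun z => f (al * z + be)) (al * d).
Proof.
move=> Hf; rewrite mulrC.
apply: (@is_derive1_comp R f (fun z => al * z + be)) => //.
apply: (@is_derive_quad _ _ _ _ 0 1) => // h _.
by rewrite (_ : _ - _ - _ = 0) ?normr0 ?mul0r//; ring.
Qed.

Lemma is_derive_cstmul (f : R -> R) (c x d : R) :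
  is_derive x (1 : R) f d -> is_derive x (1 : R) (fun z => c * f z) (c * d).
Proof. by move=> Hf; have := is_derive_mul _ _ _ _ _ (is_derive_cst c x (1 : R)) Hf; rewrite mul0r add0r. Qed.

Lemma is_derive_const (c x : R) : is_derive x (1 : R) (fun=> c) 0.
Proof. exact: is_derive_cst. Qed.

Lemma is_derive_near0 (f g : R -> R) (x d : R) : 0 < d ->
  (forall h, `|h| < d -> f (x + h) = 0) -> is_derive x (1 : R) f 0.
Proof.
move=> d0 H; apply: (@is_derive_quad _ _ _ _ 0 d) => // h hd.
have := H 0; rewrite addr0 normr0 => /(_ d0) ->.
by rewrite H// !mul0r !subr0 normr0.
Qed.

Lemma norm_mul_le (x y X Y : R) : `|x| <= X -> `|y| <= Y -> `|x * y| <= X * Y.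
Proof. by move=> h1 h2; rewrite normrM; apply: ler_pM. Qed.

Lemma norm_add_le (x y X Y : R) : `|x| <= X -> `|y| <= Y -> `|x + y| <= X + Y.
Proof. by move=> h1 h2; apply: (le_trans (ler_normD _ _)); apply: lerD. Qed.

Lemma continuous2_lip (f : R * R -> R) (L : R) : 0 <= L ->
  (forall p q, `|f p - f q| <= L * (`|p.1 - q.1| + `|p.2 - q.2|)) -> continuous f.
Proof.
move=> L0 Hf p; apply/cvgrPdist_le => e e0.
have d0 : 0 < e / (2 * L + 1) by rewrite divr_gt0//; lra.
exists (ball p.1 (e / (2 * L + 1)), ball p.2 (e / (2 * L + 1))).
  by split; exact: nbhsx_ballx.
move=> q [/= h1 h2]; apply: (le_trans (Hf _ _)).
have {}h1 : `|p.1 - q.1| < e / (2 * L + 1) := h1.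
have {}h2 : `|p.2 - q.2| < e / (2 * L + 1) := h2.
have E : (2 * L + 1) * (e / (2 * L + 1)) = e by field; lra.
by nra.
Qed.
End derive_tools.

Section kruzkov_smooth.
Variables (R : realType) (T X s a b c B : R).
Variables (phi dphi chi dchi : R -> R) (V Vx : R -> R -> R).
Hypotheses (a0 : 0 < a) (bT : b < T) (cX : c < X).
Hypotheses (Dphi : forall t, is_derive t (1 : R) phi (dphi t)) (Cdphi : continuous dphi)
  (phi0 : forall t, 0 <= phi t <= 1) (dphiB : forall t, `|dphi t| <= B)
  (phiS : forall t, ~~ (a <= t <= b) -> phi t = 0)
  (dphiS : forall t, ~~ (a <= t <= b) -> dphi t = 0).
Hypotheses (Dchi : forall t, is_derive t (1 : R) chi (dchi t)) (Cdchi : continuous dchi)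
  (chi0 : forall t, 0 <= chi t <= 1) (dchiB : forall t, `|dchi t| <= B)
  (chiS : forall t, ~~ (`|t| <= c) -> chi t = 0)
  (dchiS : forall t, ~~ (`|t| <= c) -> dchi t = 0).
Hypotheses (CV : continuous (fun p : R * R => V p.2 p.1))
  (CVx : continuous (fun p : R * R => Vx p.2 p.1))
  (VB : forall x t, `|V x t| <= 1) (VxB : forall x t, `|Vx x t| <= B)
  (DVx : forall x t, `|x| < X -> 0 < t < T -> is_derive x (1 : R) (V ^~ t) (Vx x t))
  (DVt : forall x t, `|x| < X -> 0 < t < T ->
     is_derive t (1 : R) (V x) (- V x t * Vx x t)).

Let cont_derive (f df : R -> R) : (forall t, is_derive t (1 : R) f (df t)) -> continuous f.
Proof.
move=> H z; exact: (@differentiable_continuous _ _ _ z f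
  (iffLR (derivable1_diffP _ _) (@ex_derive _ _ _ _ _ _ _ (H z)))).
Qed.

Lemma continuous_comp2 (f : R -> R) (g : R * R -> R) :
  continuous f -> continuous g -> continuous (fun p => f (g p)).
Proof. by move=> cf cg p; apply: continuous_comp; [exact: cg | exact: cf]. Qed.

Lemma continuous_mul2 (f g : R * R -> R) :
  continuous f -> continuous g -> continuous (fun p => f p * g p).
Proof. by move=> cf cg p; apply: cvgM; [exact: cf | exact: cg]. Qed.

Lemma continuous_add2 (f g : R * R -> R) :
  continuous f -> continuous g -> continuous (fun p => f p + g p).
Proof. by move=> cf cg p; apply: cvgD; [exact: cf | exact: cg]. Qed.

Lemma continuous_p1 : continuous (fun p : R * R => p.1).
Proof. by move=> p; exact: cvg_fst. Qed.

Lemma continuous_shift2 (f : R * R -> R) : continuous f ->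
  continuous (fun p : R * R => f (p.1, p.2 - s)).
Proof.
move=> cf p.
apply: (@continuous_comp _ _ _ (fun p : R * R => (p.1, p.2 - s)) f); last exact: cf.
apply: (@cvg_pair _ _ _ (nbhs p) (nbhs p.1) (nbhs (p.2 - s)) _ _ _ fst (fun q => q.2 - s)).
  exact: cvg_fst.
by apply: cvgB; [exact: cvg_snd | exact: cvg_cst].
Qed.

Lemma continuous_p2s : continuous (fun p : R * R => p.2 - s).
Proof. by move=> p; apply: cvgB; [exact: cvg_snd | exact: cvg_cst]. Qed.

Section testfun.
Variables psi dpsi : R -> R.
Hypotheses (Dpsi : forall v, is_derive v (1 : R) psi (dpsi v)) (Cdpsi : continuous dpsi)
  (psi0 : forall v, 0 <= psi v).

Definition th t x := phi t * (chi (x - s) * psi (V (x - s) t)).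
Definition tht t x := dphi t * (chi (x - s) * psi (V (x - s) t))
  + phi t * (chi (x - s) * (dpsi (V (x - s) t) * (- V (x - s) t * Vx (x - s) t))).
Definition thx t x := phi t * (dchi (x - s) * psi (V (x - s) t)
  + chi (x - s) * (dpsi (V (x - s) t) * Vx (x - s) t)).

Lemma test_fun_th : test_fun th tht thx.
Proof.
have CVs := continuous_shift2 _ CV.
have CVxs := continuous_shift2 _ CVx.
have Cphi := cont_derive _ _ Dphi; have Cchi := cont_derive _ _ Dchi.
have Cpsi := cont_derive _ _ Dpsi.
have C1 (f : R -> R) : continuous f -> continuous (fun p : R * R => f p.1).
  by move=> cf; exact: (continuous_comp2 f (fun p => p.1) cf continuous_p1).
have C2 (f : R -> R) : continuous f -> continuous (fun p : R * R => f (p.2 - s)).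
  by move=> cf; exact: (continuous_comp2 f (fun p => p.2 - s) cf continuous_p2s).
have CN : continuous (fun p : R * R => - V (p.2 - s) p.1).
  by move=> p; apply: cvgN; exact: CVs.
have Cps := continuous_comp2 _ _ Cpsi CVs; have Cdps := continuous_comp2 _ _ Cdpsi CVs.
have [c1 c2 c3 c4] := And4 (C1 _ Cphi) (C1 _ Cdphi) (C2 _ Cchi) (C2 _ Cdchi).
split; first by move=> t x; have [/andP[? _] /andP[? _]] := (phi0 t, chi0 (x - s)); rewrite !mulr_ge0.
split; [|split; [|split; [|split]]].
- move=> t x; rewrite /tht.
  have [xX|xX] := ltP `|x - s| X; last first.
    have z0 : chi (x - s) = 0 by apply: chiS; rewrite -ltNge (lt_le_trans cX).
    rewrite !z0 !mul0r !mulr0 addr0.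
    have -> : th ^~ x = fun=> 0 by apply/funext => z; rewrite /th z0 mul0r mulr0.
    exact: is_derive_const.
  have [tT|tT] := boolP (0 < t < T).
    apply: is_derive_mul => //.
    apply: is_derive_cstmul.
    by apply: (@is_derive1_comp R psi (V (x - s))) => //; exact: DVt.
  have nt : ~~ (a <= t <= b).
    by apply: contra tT => /andP[h1 h2]; rewrite (lt_le_trans a0 h1) (le_lt_trans h2 bT).
  rewrite (phiS _ nt) (dphiS _ nt) !mul0r addr0.
  apply: (@is_derive_near0 _ _ (fun=> 0) _ (Num.min a (T - b))).
    by rewrite lt_min a0 subr_gt0.
  move=> h; rewrite lt_min !ltr_norml /th => /andP[/andP[h1 h2] /andP[h3 h4]].
  rewrite phiS ?mul0r//; apply/negP => /andP[h5 h6].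
  by move/negP: tT; apply; lra.
- move=> t x; rewrite /thx.
  have [tT|tT] := boolP (0 < t < T); last first.
    have nt : ~~ (a <= t <= b).
      by apply: contra tT => /andP[h1 h2]; rewrite (lt_le_trans a0 h1) (le_lt_trans h2 bT).
    rewrite (phiS _ nt) mul0r.
    have -> : th t = fun=> 0 by apply/funext => z; rewrite /th phiS// mul0r.
    exact: is_derive_const.
  have [xX|xX] := ltP `|x - s| X; last first.
    have nx : ~~ (`|x - s| <= c) by rewrite -ltNge (lt_le_trans cX).
    rewrite (chiS _ nx) (dchiS _ nx) !mul0r addr0 mulr0.
    apply: (@is_derive_near0 _ _ (fun=> 0) _ (X - c)); first by rewrite subr_gt0.
    move=> h hh; rewrite /th chiS ?mul0r ?mulr0// -ltNge.
    have := ler_normD (x + h - s) (- h).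
    rewrite (_ : x + h - s - h = x - s) ?normrN; [lra | ring].
  apply: (@is_derive_cstmul _ (fun z => chi (z - s) * psi (V (z - s) t))).
  have sh (f : R -> R) d : is_derive (x - s) (1 : R) f d ->
      is_derive x (1 : R) (fun z => f (z - s)) d.
    move=> Hf.
    have -> : (fun z => f (z - s)) = (fun z => f (1 * z + - s)).
      by apply/funext => z; rewrite mul1r.
    rewrite -[d]mul1r; apply: is_derive_affine; rewrite mul1r//.
  apply: (@is_derive_mul _ (fun z => chi (z - s)) (fun z => psi (V (z - s) t))).
  apply: (sh (fun z => psi (V z t))).
  apply: (@is_derive1_comp R psi (V ^~ t)) => //; exact: (DVx (x - s) t xX tT).
- exact: (continuous_add2 _ _ (continuous_mul2 _ _ c2 (continuous_mul2 _ _ c3 Cps))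
    (continuous_mul2 _ _ c1 (continuous_mul2 _ _ c3 (continuous_mul2 _ _ Cdps
      (continuous_mul2 _ _ CN CVxs))))).
- exact: (continuous_mul2 _ _ c1 (continuous_add2 _ _ (continuous_mul2 _ _ c4 Cps)
    (continuous_mul2 _ _ c3 (continuous_mul2 _ _ Cdps CVxs)))).
exists a, b, (c + `|s|); split=> // t x; rewrite /th => h.
split.
  by apply: contraNT h => nt; rewrite phiS// mul0r.
have xs : `|x - s| <= c by apply: contraNT h => nt; rewrite chiS// mul0r mulr0.
by rewrite -[x](subrK s); apply: (le_trans (ler_normD _ _)); rewrite lerD2r.
Qed.

End testfun.

Local Notation leb := (@lebesgue_measure R).
Local Notation MR := (measurableTypeR R).

Lemma measurable_kq d (Y : measurableType d) (f g : Y -> R) :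
  measurable_fun setT f -> measurable_fun setT g -> measurable_fun setT (fun y => kq R (f y) (g y)).
Proof.
move=> mf mg; rewrite /kq.
apply: measurable_funM; last exact: measurable_cst.
apply: measurable_funM; last exact: measurable_funD.
by apply: measurableT_comp => //; exact: measurable_funB.
Qed.

Lemma measurable_norm_sub d (Y : measurableType d) (f g : Y -> R) :
  measurable_fun setT f -> measurable_fun setT g -> measurable_fun setT (fun y => `|f y - g y|).
Proof. by move=> mf mg; apply: measurableT_comp => //; exact: measurable_funB. Qed.

Section main.
Variables (u : R -> R -> R) (M : R).
Hypothesis mu : measurable_fun setT (fun p : R * R => u p.2 p.1).
Hypothesis uM : forall x t, 0 <= t -> `|u x t| <= M.
Hypothesis Eu : forall (k : R) (f ft fx : R -> R -> R), test_fun f ft fx ->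
     (0 <= \int[leb \x leb]_(p in setT)
        ((`|u p.2 p.1 - k| * ft p.1 p.2
          + Num.sg (u p.2 p.1 - k)
            * (burgers_flux (u p.2 p.1) - burgers_flux k) * fx p.1 p.2)%:E))%E.

Let D : set (MR * MR) := `[a, b] `*` `[s - c, s + c].

Let mD : measurable D. Proof. exact: measurableX. Qed.

Let Dfin : ((leb \x leb) D < +oo)%E.
Proof.
have -> : (leb \x leb)%E D = (leb `[a, b]%classic * leb `[(s - c)%R, (s + c)%R]%classic)%E.
  exact: product_measure1E.
rewrite !lebesgue_measure_itv /=.
by case: ifP => _; case: ifP => _; rewrite ?mule0 ?mul0e ?ltry.
Qed.

Let notD p : ~ D p -> ~~ (a <= p.1 <= b) \/ ~~ (`|p.2 - s| <= c).
Proof.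
move=> nD; have [h1|] := boolP (a <= p.1 <= b); last by left.
have [h2|] := boolP (`|p.2 - s| <= c); last by right.
exfalso; apply: nD; split; rewrite /= in_itv //=.
by move: h2; rewrite ler_norml; lra.
Qed.

Let inD (p : R * R) : a <= p.1 <= b -> 0 <= p.1.
Proof. by case/andP => h _; rewrite ltW// (lt_le_trans a0). Qed.

Let uB p : D p -> `|u p.2 p.1| <= M.
Proof. by move=> [/= h _]; apply: uM; apply: inD; rewrite in_itv in h. Qed.

Let bint (f : R * R -> R) (C : R) :
  measurable_fun setT (f : MR * MR -> R) ->
  (forall p, ~~ (a <= p.1 <= b) \/ ~~ (`|p.2 - s| <= c) -> f p = 0) ->
  (forall p, D p -> `|f p| <= C) ->
  (leb \x leb)%E.-integrable setT (EFin \o f : MR * MR -> \bar R).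
Proof.
move=> mf f0 fC.
apply: (@bounded_integrable R _ (MR * MR)%type (leb \x leb)%E f D `|C|) => //.
  move=> p; have [/fC h|nD] := pselect (D p).
    exact: le_trans h (ler_norm _).
  by rewrite f0 ?normr0//; exact: notD.
by move=> p nD; apply: f0; exact: notD.
Qed.

Let hs (K : nat) : R := 2 / K.+1%:R.
Let psi (K i : nat) v := sstep R (v / hs K + K.+1%:R - i%:R + 1) - sstep R (v / hs K + K.+1%:R - i%:R).
Let dpsi (K i : nat) v := (dstep R (v / hs K + K.+1%:R - i%:R + 1) - dstep R (v / hs K + K.+1%:R - i%:R)) / hs K.

Let hs0 K : 0 < hs K. Proof. by rewrite divr_gt0. Qed.

Let Dpsi K i v : is_derive v (1 : R) (psi K i) (dpsi K i v).
Proof.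
have H (be w : R) : is_derive w (1 : R) (fun z => sstep R ((hs K)^-1 * z + be))
    ((hs K)^-1 * dstep R ((hs K)^-1 * w + be)).
  by apply: is_derive_affine; exact: is_derive_sstep.
have -> : psi K i = (fun z => sstep R ((hs K)^-1 * z + (K.+1%:R - i%:R + 1)))
    - (fun z => sstep R ((hs K)^-1 * z + (K.+1%:R - i%:R))).
  by apply/funext => z; rewrite /psi !fctE; congr (sstep R _ - sstep R _); ring.
apply: (is_derive_eq (is_deriveB (H _ _) (H _ _))).
rewrite /dpsi mulrBl; congr (_ - _); rewrite [RHS]mulrC; congr (_ * dstep R _); ring.
Qed.

Let Cdpsi K i : continuous (dpsi K i).
Proof.
have H (be : R) : continuous (fun z : R => dstep R (z / hs K + be)).
  move=> z; apply: (@continuous_comp _ _ _ (fun z : R => z / hs K + be) (dstep R)).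
    by apply: cvgD; [apply: cvgM; [exact: cvg_id | exact: cvg_cst] | exact: cvg_cst].
  exact: continuous_dstep.
have -> : dpsi K i = (fun v => (dstep R (v / hs K + (K.+1%:R - i%:R + 1))
   - dstep R (v / hs K + (K.+1%:R - i%:R))) / hs K).
  by apply/funext => z; rewrite /dpsi !addrA.
by move=> v; apply: cvgM; [apply: cvgB; exact: H | exact: cvg_cst].
Qed.

Let psi01 K i v : 0 <= psi K i v <= 1.
Proof.
rewrite /psi; set x := _ - i%:R.
have := sstep_mono R x (x + 1) ltac:(lra).
by have := sstep_itv R x; have := sstep_itv R (x + 1); lra.
Qed.

Let dpsiB K i v : `|dpsi K i v| <= 3 / hs K.
Proof.
rewrite /dpsi normrM normfV (gtr0_norm (hs0 K)) ler_pM2r ?invr_gt0//.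
set x := _ - i%:R; rewrite ler_norml.
by have := dstep_itv R x; have := dstep_itv R (x + 1); lra.
Qed.

Let kk (K i : nat) : R := (i%:R - K.+1%:R) * hs K.

Let g K i (p : R * R) := `|u p.2 p.1 - kk K i| * tht (psi K i) (dpsi K i) p.1 p.2
  + kq R (u p.2 p.1) (kk K i) * thx (psi K i) (dpsi K i) p.1 p.2.

Definition G0 (p : R * R) := dphi p.1 * (chi (p.2 - s) * `|u p.2 p.1 - V (p.2 - s) p.1|)
  + phi p.1 * (dchi (p.2 - s) * kq R (u p.2 p.1) (V (p.2 - s) p.1)).

Let Err (p : R * R) := `|dphi p.1 * chi (p.2 - s)| + `|phi p.1 * dchi (p.2 - s)| * 2
  + phi p.1 * chi (p.2 - s) * B * 2.

Let B0 : 0 <= B. Proof. exact: le_trans (dphiB 0). Qed.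
Let M0 : 0 <= M. Proof. by apply: le_trans (uM 0 0 _). Qed.

Let C1 (f : R -> R) : continuous f -> continuous (fun p : R * R => f p.1).
Proof. by move=> cf; exact: (continuous_comp2 f (fun p => p.1) cf continuous_p1). Qed.
Let C2 (f : R -> R) : continuous f -> continuous (fun p : R * R => f (p.2 - s)).
Proof. by move=> cf; exact: (continuous_comp2 f (fun p => p.2 - s) cf continuous_p2s). Qed.
Let Cphi := cont_derive _ _ Dphi.
Let Cchi := cont_derive _ _ Dchi.

Let phi1 t : `|phi t| <= 1. Proof. by have /andP[? ?] := phi0 t; rewrite ger0_norm. Qed.
Let chi1 t : `|chi t| <= 1. Proof. by have /andP[? ?] := chi0 t; rewrite ger0_norm. Qed.

Let g_int K i : (leb \x leb)%E.-integrable setT (EFin \o g K i : MR * MR -> \bar R).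
Proof.
have [_ [_ [_ [ct [cx _]]]]] := test_fun_th (psi K i) (dpsi K i) (Dpsi K i) (@Cdpsi K i)
  (fun v => proj1 (andP (psi01 K i v))).
have psi1 v : `|psi K i v| <= 1 by have /andP[? ?] := psi01 K i v; rewrite ger0_norm.
apply: (bint (g K i) ((M + `|kk K i|) * (B * (1 * 1) + 1 * (1 * (3 / hs K * (1 * B))))
   + (M + `|kk K i|) * (M + `|kk K i|) / 2 * (1 * (B * 1 + 1 * (3 / hs K * B))))).
- apply: measurable_funD; apply: measurable_funM.
  + by apply: measurable_norm_sub => //; exact: measurable_cst.
  + exact: continuous2_measurable ct.
  + by apply: measurable_kq => //; exact: measurable_cst.
  + exact: continuous2_measurable cx.
- move=> p [np|np]; rewrite /g /tht /thx.
    by rewrite (phiS _ np) (dphiS _ np) !mul0r !addr0 !mulr0 addr0.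
  by rewrite (chiS _ np) (dchiS _ np) !(mul0r, mulr0, addr0).
move=> p /uB up.
have n1 : `|u p.2 p.1 - kk K i| <= M + `|kk K i|.
  by apply: (le_trans (ler_normB _ _)); rewrite lerD2r.
have n2 : `|u p.2 p.1 + kk K i| <= M + `|kk K i|.
  by apply: (le_trans (ler_normD _ _)); rewrite lerD2r.
apply: norm_add_le; apply: norm_mul_le; rewrite ?normr_id//.
- apply: norm_add_le; apply: norm_mul_le => //; apply: norm_mul_le => //; apply: norm_mul_le => //.
  by apply: norm_mul_le; rewrite ?normrN.
- rewrite /kq; apply: norm_mul_le; last by rewrite ger0_norm.
  by apply: norm_mul_le; rewrite ?normr_id.
- apply: norm_mul_le => //; apply: norm_add_le; apply: norm_mul_le => //; exact: norm_mul_le.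
Qed.

Lemma measurable_V : measurable_fun setT ((fun p => V (p.2 - s) p.1) : MR * MR -> R).
Proof. exact: continuous2_measurable (continuous_shift2 _ CV). Qed.

Lemma G0_int : (leb \x leb)%E.-integrable setT (EFin \o G0 : MR * MR -> \bar R).
Proof.
apply: (bint G0 (B * (1 * (M + 1)) + 1 * (B * (2 * (M + 1) ^+ 2)))).
- apply: measurable_funD; apply: measurable_funM.
  + exact: continuous2_measurable (C1 _ Cdphi).
  + apply: measurable_funM; first exact: continuous2_measurable (C2 _ Cchi).
    by apply: measurable_norm_sub => //; exact: measurable_V.
  + exact: continuous2_measurable (C1 _ Cphi).
  + apply: measurable_funM; first exact: continuous2_measurable (C2 _ Cdchi).
    by apply: measurable_kq => //; exact: measurable_V.
- move=> p [np|np]; rewrite /G0.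
    by rewrite (phiS _ np) (dphiS _ np) !mul0r addr0.
  by rewrite (chiS _ np) (dchiS _ np) !(mul0r, mulr0, addr0).
move=> p /uB up; apply: (le_trans (ler_normD _ _)); apply: lerD; apply: norm_mul_le => //; apply: norm_mul_le => //.
  by rewrite normr_id; apply: (le_trans (ler_normB _ _)); apply: lerD.
by apply: kq_bound; [apply: (le_trans up) | apply: (le_trans (VB _ _))]; have := M0; lra.
Qed.

Let Err_int : (leb \x leb)%E.-integrable setT (EFin \o Err : MR * MR -> \bar R).
Proof.
have mphi := continuous2_measurable _ _ (C1 _ Cphi).
have mdphi := continuous2_measurable _ _ (C1 _ Cdphi).
have mchi := continuous2_measurable _ _ (C2 _ Cchi).
have mdchi := continuous2_measurable _ _ (C2 _ Cdchi).
have mc (r : R) := @measurable_cst _ _ (MR * MR)%type R setT r.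
apply: (bint Err (B * 1 + 1 * B * 2 + 1 * 1 * B * 2)).
- apply: measurable_funD; [apply: measurable_funD|].
  + by apply: measurableT_comp => //; exact: measurable_funM.
  + apply: measurable_funM => //.
    by apply: measurableT_comp => //; exact: measurable_funM.
  + by apply: measurable_funM => //; apply: measurable_funM => //; exact: measurable_funM.
- move=> p [np|np]; rewrite /Err.
    by rewrite (phiS _ np) (dphiS _ np) !mul0r normr0 !mul0r !addr0.
  by rewrite (chiS _ np) (dchiS _ np) !(mul0r, mulr0) normr0 !mul0r !addr0.
move=> p _; rewrite ger0_norm; last first.
  have := phi0 p.1; have := chi0 (p.2 - s) => /andP[? _] /andP[? _].
  by rewrite !(mulr_ge0, addr_ge0).
apply: lerD; [apply: lerD|].
- exact: norm_mul_le.
- by rewrite ler_pM2r//; exact: norm_mul_le.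
have /andP[? ?] := phi0 p.1; have /andP[? ?] := chi0 (p.2 - s).
by rewrite ler_pM2r// ler_wpM2r//; apply: ler_pM.
Qed.

Lemma kruzkov_smooth : (0 <= \int[leb \x leb]_(p in setT) (G0 p)%:E)%E.
Proof.
have G0i := G0_int.
have fG := integrable_fin_num measurableT G0i.
have fE := integrable_fin_num measurableT Err_int.
set I0 := (\int[_]_(p in setT) _)%E.
have hG : I0 = (fine I0)%:E by rewrite fineK.
pose IE := fine (\int[leb \x leb]_(p in setT) (Err p)%:E)%E.
have hE : (\int[leb \x leb]_(p in setT) (Err p)%:E)%E = IE%:E by rewrite fineK.
have key K : 0 <= fine I0 + hs K * IE.
  rewrite -lee_fin EFinD EFinM -hG -hE.
  have EZ := integrableZl measurableT (hs K) Err_int.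
  have <- := integralZl measurableT Err_int (hs K).
  have <- := integralD measurableT G0i EZ.
  apply: (@le_trans _ _ (\int[leb \x leb]_(p in setT) \sum_(i < (2 * K.+1).+1) (g K i p)%:E)%E).
    rewrite (@integral_sum _ _ _ (leb \x leb)%E setT measurableT _ (fun i p => (g K (nat_of_ord i) p)%:E)).
      apply: sume_ge0 => i _.
      have Ht := test_fun_th (psi K i) (dpsi K i) (Dpsi K i) (@Cdpsi K i)
        (fun v => proj1 (andP (psi01 K i v))).
      apply: (le_trans (Eu (kk K i) _ _ _ Ht)).
      rewrite le_eqVlt; apply/orP; left; apply/eqP; apply: eq_integral => p _.
      by rewrite /g -kqE.
    by move=> i; exact: g_int.
  apply: le_integral => //.
  - by apply: integrable_sum => // i _; exact: g_int.
  - exact: integrableD.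
  move=> p _; rewrite sumEFin -EFinM -EFinD lee_fin.
  pose t := p.1; pose x := p.2 - s.
  have := @kruzkov_sum R K.+1 (hs K) (u p.2 p.1) (V x t) 2 B (dphi t * chi x) (phi t * dchi x) (phi t * chi x) (Vx x t) (hs0 K).
  have e2 : K.+1%:R * hs K = 2 by rewrite /hs; field.
  rewrite e2 => /(_ (le_lt_trans (VB _ _) _) (lexx _) _ (VxB _ _)).
  have /andP[p0 _] := phi0 t; have /andP[q0 _] := chi0 x.
  move=> /(_ ltac:(lra) (mulr_ge0 p0 q0)) H.
  apply: le_trans (le_trans H _); last first.
    by rewrite /G0 /Err -/t -/x; lra.
  rewrite le_eqVlt; apply/orP; left; apply/eqP; apply: eq_bigr => i _ /=.
  rewrite /g /tht /thx -/t -/x /kk /psi /dpsi; ring.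
rewrite hG lee_fin leNgt; apply/negP => I0neg.
have [IEp|IEn] := leP IE 0.
  by have := key 0%N; have := hs0 0%N; nra.
pose K := Num.truncn (2 * IE / - fine I0).
have hK : hs K * IE < - fine I0.
  have I1 : 0 < - fine I0 by lra.
  rewrite /hs mulrAC ltr_pdivrMr//.
  have := truncnS_gt (2 * IE / - fine I0); rewrite ltr_pdivrMr// => h.
  by rewrite [- fine I0 * _]mulrC.
by have := key K; lra.
Qed.

End main.
End kruzkov_smooth.

Section integral_tools.
Variable R : realType.
Local Notation leb := (@lebesgue_measure R).
Local Notation MR := (measurableTypeR R).

Lemma integral_translate (c : R) (f : R -> R) :
  measurable_fun setT (f : MR -> R) ->
  leb.-integrable setT (EFin \o (fun x => f (x + c)) : MR -> \bar R) ->
  (\int[leb]_(x in setT) (f x)%:E = \int[leb]_(x in setT) (f (x + c))%:E)%E.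
Proof.
move=> mf fi.
have ms : measurable_fun setT (fun x : MR => (x + c : MR)).
  by apply: continuous_measurable_fun => x; apply: cvgD; [exact: cvg_id | exact: cvg_cst].
have mf' : measurable_fun setT (EFin \o f : MR -> \bar R) by exact/measurable_EFinP.
have H := @integral_pushforward _ _ MR MR R _ ms leb setT (EFin \o f) mf' fi measurableT.
rewrite preimage_setT in H.
have -> : (\int[leb]_(x in setT) (f (x + c))%:E = \int[leb]_(x in setT) (((EFin \o f) \o (fun x => (x + c)%R)) x))%E by [].
rewrite -H.
unshelve refine (@eq_measure_integral _ MR R setT (pushforward leb (fun x : MR => (x + c : MR))) leb _ _).
  exact: ms.
by move=> A mA _; exact/esym/lebesgue_translate.
Qed.

Lemma bounded_integrable1 (f : R -> R) (a b C : R) :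
  measurable_fun setT (f : MR -> R) -> (forall x, `|f x| <= C) ->
  (forall x, ~~ (a <= x <= b) -> f x = 0) ->
  leb.-integrable setT (EFin \o f : MR -> \bar R).
Proof.
move=> mf fC f0.
apply: (@bounded_integrable R _ MR leb f `[a, b]%classic C) => //.
  suff : (leb `[a, b]%classic < +oo)%E by [].
  by rewrite lebesgue_measure_itv /=; case: ifP => _; rewrite ?ltry.
by move=> x /negP h; apply: f0; move: h; rewrite /= in_itv.
Qed.

Definition bump (r w x : R) : R := dstep R ((x - r) / w) / w.

Lemma bump_ge0 r w x : 0 < w -> 0 <= bump r w x.
Proof. by move=> w0; have /andP[h _] := dstep_itv R ((x - r) / w); rewrite /bump divr_ge0// ltW. Qed.

Lemma bump_le r w x : 0 < w -> bump r w x <= 3 / w.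
Proof. by move=> w0; have /andP[_ h] := dstep_itv R ((x - r) / w); rewrite /bump ler_pM2r ?invr_gt0//; lra. Qed.

Lemma bump_out r w x : 0 < w -> ~~ (r <= x <= r + w) -> bump r w x = 0.
Proof.
move=> w0; rewrite negb_and -!ltNge /bump => /orP[h|h].
  by rewrite dstep_le0 ?mul0r// pmulr_lle0 ?invr_gt0//; lra.
by rewrite dstep_ge1 ?mul0r// ler_pdivlMr//; lra.
Qed.

Lemma sstep_affine_continuous r w : continuous (fun x : R => sstep R ((x - r) / w)).
Proof.
move=> x; apply: (@continuous_comp _ _ _ (fun x : R => (x - r) / w) (sstep R)).
  by apply: cvgM; [apply: cvgB; [exact: cvg_id | exact: cvg_cst] | exact: cvg_cst].
exact: continuous_sstep.
Qed.

Lemma bump_continuous r w : continuous (bump r w).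
Proof.
move=> x; apply: cvgM; last exact: cvg_cst.
apply: (@continuous_comp _ _ _ (fun x : R => (x - r) / w) (dstep R)).
  by apply: cvgM; [apply: cvgB; [exact: cvg_id | exact: cvg_cst] | exact: cvg_cst].
exact: continuous_dstep.
Qed.

Lemma bump_derive r w x : is_derive x (1 : R) (fun x : R => sstep R ((x - r) / w)) (bump r w x).
Proof.
have -> : (fun x : R => sstep R ((x - r) / w)) = (fun x => sstep R (w^-1 * x + (- r / w))).
  by apply/funext => z; congr sstep; ring.
have -> : bump r w x = w^-1 * dstep R (w^-1 * x + - r / w).
  by rewrite /bump mulrC; congr (_ * dstep R _); ring.
exact: (@is_derive_affine R (sstep R) _ _ _ _ (is_derive_sstep R _)).
Qed.

Lemma bump_integrable r w : 0 < w -> leb.-integrable setT (EFin \o bump r w : MR -> \bar R).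
Proof.
move=> w0; apply: (bounded_integrable1 (bump r w) r (r + w) (3 / w)).
- by apply: continuous_measurable_fun; exact: bump_continuous.
- by move=> x; rewrite ger0_norm ?bump_ge0// bump_le.
- by move=> x; exact: bump_out.
Qed.

Lemma integral_bump r w : 0 < w -> (\int[leb]_(x in setT) (bump r w x)%:E = 1)%E.
Proof.
move=> w0.
have -> : (\int[leb]_(x in setT) (bump r w x)%:E = \int[leb]_(x in `[r, (r + w)%R]%classic) (bump r w x)%:E)%E.
  rewrite [RHS]integral_mkcond; apply: eq_integral => x _.
  rewrite patchE; case: ifPn => //; rewrite notin_setE /= in_itv /= => /negP h.
  by rewrite bump_out.
rewrite (@continuous_FTC2 _ (bump r w) (fun x : R => sstep R ((x - r) / w))).
- rewrite subrr mul0r (_ : r + w - r = w); last by ring.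
  by rewrite divff ?gt_eqF// (sstep_le0 R 0 (lexx 0)) (sstep_ge1 R 1 (lexx 1)) -EFinB subr0.
- lra.
- by apply: continuous_subspaceT; exact: bump_continuous.
- split.
  + by move=> x _; have [] := bump_derive r w x.
  + by apply: cvg_at_right_filter; exact: sstep_affine_continuous.
  + by apply: cvg_at_left_filter; exact: sstep_affine_continuous.
- by move=> x _; rewrite derive1E; have [_ ->] := bump_derive r w x.
Qed.
End integral_tools.

(** * Comparison and stability *)

Section branch.
Variables (R : realType) (m T : R).
Hypotheses (m0 : 0 < m) (T0 : 0 <= T).
Local Notation X := (pi + m * (pi / 2)).
Local Notation y := (yroot R m T).

(* V is an exact C^1 solution on |x| < X, 0 < t < T with data
   sin (x / (1 + m)) on [-X, X]; the stretching by 1 + m keeps V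
   Lipschitz up to x = pi, past the time of shock formation. *)
Definition V (x t : R) : R := sin (y x t).
Definition Vx (x t : R) : R := cos (y x t) / (1 + m + clamp R 0 T t * cos (y x t)).

Lemma den_ge' x t : m <= 1 + m + clamp R 0 T t * cos (y x t).
Proof. by have [[_ g] _] := yrootP R m T m0 T0 x t; lra. Qed.

Lemma V_lip x t x' t' : `|V x t - V x' t'| <= m^-1 * (`|x - x'| + `|t - t'|).
Proof.
apply: (le_trans (sin_lip _ _ _)).
by rewrite mulrC ler_pdivlMr// mulrC; exact: yroot_lip.
Qed.

Lemma V_le1 x t : `|V x t| <= 1. Proof. exact: sin_max. Qed.

Lemma VN x t : V (- x) t = - V x t.
Proof. by rewrite /V yrootN// sinN. Qed.

Lemma Vx_le x t : `|Vx x t| <= m^-1.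
Proof.
have d := den_ge' x t; have d0 := lt_le_trans m0 d.
rewrite /Vx normrM normfV (gtr0_norm d0) -[m^-1]mul1r.
apply: ler_pM => //; [by rewrite invr_ge0 ltW | exact: cos_max | ].
by rewrite lef_pV2.
Qed.

Lemma continuous_yroot2 : continuous (fun p : R * R => y p.2 p.1).
Proof.
apply: (@continuous2_lip R _ m^-1); first by rewrite invr_ge0 ltW.
move=> p q; rewrite mulrC ler_pdivlMr// mulrC [leRHS]addrC.
exact: (yroot_lip R m T m0 T0 q.2 q.1 p.2 p.1).
Qed.

Lemma continuous_V2 : continuous (fun p : R * R => V p.2 p.1).
Proof. by apply: continuous_comp2; [exact: continuous_sin | exact: continuous_yroot2]. Qed.

Lemma continuous_Vx2 : continuous (fun p : R * R => Vx p.2 p.1).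
Proof.
have cc : continuous (fun p : R * R => cos (y p.2 p.1)).
  by apply: continuous_comp2; [exact: continuous_cos | exact: continuous_yroot2].
have cl : continuous (fun p : R * R => clamp R 0 T p.1).
  by apply: (@continuous_comp2 R (clamp R 0 T) (fun p => p.1));
    [exact: continuous_clamp | exact: continuous_p1].
move=> p; apply: cvgM; first exact: cc.
apply: cvgV; first by rewrite gt_eqF// (lt_le_trans m0) ?den_ge'.
by apply: cvgD; [exact: cvg_cst | apply: cvgM; [exact: cl | exact: cc]].
Qed.

Lemma is_derive_Vx x t : `|x| < X -> 0 < t < T -> is_derive x (1 : R) (V ^~ t) (Vx x t).
Proof.
move=> xX /andP[t0 tT].
have tT' : 0 <= t <= T by rewrite !ltW.
apply: (@is_derive1_comp R sin (y ^~ t)).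
have := is_derive_yroot_x R m T m0 T0 x t xX tT'.
by rewrite /den (clamp_id _ _ _ _ tT').
Qed.

Lemma is_derive_Vt x t : `|x| < X -> 0 < t < T ->
  is_derive t (1 : R) (V x) (- V x t * Vx x t).
Proof.
move=> xX tT.
have tT' : 0 <= t <= T by case/andP: tT => *; rewrite !ltW.
have -> : - V x t * Vx x t = cos (y x t) * (- sin (y x t) / den R m T x t).
  rewrite /V /Vx /den (clamp_id _ _ _ _ tT'); ring.
apply: (@is_derive1_comp R sin (y x)).
exact: (is_derive_yroot_t R m T m0 T0 x t (ltW xX) tT).
Qed.

Lemma V_pi_ge0 t : 0 <= V pi t.
Proof.
have [g E] := yrootP R m T m0 T0 pi t.
have /andP[t1 t2] := clamp_itv R 0 T t T0.
have pi0 := pi_gt0 R.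
have mp : 0 <= m * (pi / 2) by rewrite mulr_ge0// ?divr_ge0// ltW.
rewrite (clamp_id _ _ _ pi) in E; last by lra.
rewrite /V; apply: sin_ge0_pi.
have [/andP[_ h] _] := g; rewrite h andbT leNgt; apply/negP => y0.
have g0 : good R (clamp R 0 T t) 0 by split; rewrite ?cos0; lra.
have := kep_slope R m _ _ _ t1 g g0 (ltW y0).
rewrite E /kep sin0 !mulr0 addr0 !sub0r.
have H0 : 0 < - y pi t by lra.
      have := mulr_gt0 m0 H0; lra.
Qed.

Lemma V0E x : `|x| <= X -> `|V x 0 - sin x| <= m * pi.
Proof.
move=> xX; have [[g _] E] := yrootP R m T m0 T0 x 0.
have c0 : clamp R 0 T 0 = 0 by apply: clamp_id; rewrite lexx.
rewrite c0 clamp_id in E; last by rewrite -ler_norml.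
rewrite /kep mul0r addr0 in E.
apply: (le_trans (sin_lip _ _ _)).
have -> : y x 0 - x = - (m * y x 0) by lra.
by rewrite normrN normrM (gtr0_norm m0); apply: (ler_wpM2l (ltW m0)); rewrite ler_norml.
Qed.

Lemma VTE x z : `|x| <= X -> pi < T -> - (pi / 2) <= z <= pi / 2 -> z + T * sin z = x ->
  `|x| <= pi -> `|V x T - sin z| <= m * pi.
Proof.
move=> xX pT zp zE xp; have [[g g'] E] := yrootP R m T m0 T0 x T.
have cT : clamp R 0 T T = T by apply: clamp_id; rewrite lexx andbT.
rewrite cT in g' E; rewrite clamp_id in E; last by rewrite -ler_norml.
have pi0 := pi_gt0 R.
apply: (le_trans (sin_lip _ _ _)).
set y1 := y x T in g g' E *.
have kE : y1 + T * sin y1 = x - m * y1 by move: E; rewrite /kep; lra.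
have cz : 0 <= cos z by apply: cos_ge0_pihalf.
have my : `|m * y1| <= m * pi.
  by rewrite normrM (gtr0_norm m0); apply: (ler_wpM2l (ltW m0)); rewrite ler_norml.
have key : `|y1 - z| <= `|m * y1|.
  have H : (y1 - z) + T * (sin y1 - sin z) = - (m * y1) by lra.
  have gz : good R T z by split; [lra | rewrite addr_ge0// mulr_ge0].
  (* both points lie where cos >= 0: for y1 because kep (pi / 2) > pi *)
  have y1p : - (pi / 2) <= y1 <= pi / 2.
    have gp : good R T (pi / 2) by split; [lra | rewrite cos_pihalf mulr0 addr0].
    have kp : kep R m T (pi / 2) > pi by rewrite /kep sin_pihalf; have := mulr_gt0 m0 pi0; lra.
    have gy : good R T y1 by split.
    move: xp; rewrite ler_norml => /andP[xp1 xp2].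
    have [h1|h1] := leP y1 (pi / 2); last first.
      have := kep_slope R m T _ _ T0 gp gy (ltW h1); rewrite E.
      have H0 : 0 < y1 - pi / 2 by lra.
      have := mulr_gt0 m0 H0; lra.
    rewrite andbT; have [h2|h2] := leP (- (pi / 2)) y1; first by [].
    have := kep_slope R m T _ _ T0 gy (goodN R T _ gp) (ltW h2); rewrite kepN E.
    have H0 : 0 < - (pi / 2) - y1 by lra.
    have := mulr_gt0 m0 H0; lra.
  have same : 0 <= (y1 - z) * (sin y1 - sin z).
    have [h|h] := leP y1 z.
      have [c cc E2] := MVT_le _ _ _ _ _ h (@is_derive_sin R).
      have c0 : 0 <= cos c by apply: cos_ge0_pihalf; lra.
      have -> : (y1 - z) * (sin y1 - sin z) = cos c * (y1 - z) ^+ 2 by nra.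
      by rewrite mulr_ge0 ?sqr_ge0.
    have [c cc E2] := MVT_le _ _ _ _ _ (ltW h) (@is_derive_sin R).
    have c0 : 0 <= cos c by apply: cos_ge0_pihalf; lra.
    have -> : (y1 - z) * (sin y1 - sin z) = cos c * (y1 - z) ^+ 2 by rewrite E2; ring.
    by rewrite mulr_ge0 ?sqr_ge0.
  rewrite -[leRHS]normrN -H.
  have S0 : 0 <= (y1 - z) * (T * (sin y1 - sin z)) by rewrite mulrCA mulr_ge0.
  move: S0; set p := T * _; set q := y1 - z => S0.
  case: (norm_cases R q) => -[h ->]; case: (norm_cases R (q + p)) => -[h' ->]; nra.
exact: le_trans key my.
Qed.
End branch.

Section comparison.
Variables (R : realType) (m T s dl s1 s2 tau M : R) (u : R -> R -> R).
Hypotheses (m0 : 0 < m) (dl0 : 0 < dl) (dlm : dl < m * (pi / 2)).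
Hypotheses (tau0 : 0 < tau) (s10 : 0 < s1) (s12 : s1 <= s2) (s2T : s2 + tau < T).
Local Notation leb := (@lebesgue_measure R).
Local Notation MR := (measurableTypeR R).
Local Notation V := (V R m T).
Local Notation Vx := (Vx R m T).
Hypothesis uper : forall x t, u (x + 2 * pi) t = u x t.
Hypothesis mu : measurable_fun setT (fun p : R * R => u p.2 p.1).
Hypothesis uM : forall x t, 0 <= t -> `|u x t| <= M.
Hypothesis Eu : forall (k : R) (f ft fx : R -> R -> R), test_fun f ft fx ->
     (0 <= \int[leb \x leb]_(p in setT)
        ((`|u p.2 p.1 - k| * ft p.1 p.2
          + Num.sg (u p.2 p.1 - k)
            * (burgers_flux (u p.2 p.1) - burgers_flux k) * fx p.1 p.2)%:E))%E.

Let T0 : 0 <= T. Proof. by move: tau0 s10 s12 s2T; lra. Qed.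
Let w0 : 0 < 2 * dl. Proof. by move: dl0; lra. Qed.
Let M0 : 0 <= M. Proof. by apply: le_trans (uM 0 0 _). Qed.

Definition xcut z := sstep R ((z - (- pi - dl)) / (2 * dl)) - sstep R ((z - (pi - dl)) / (2 * dl)).
Definition dxcut z := bump R (- pi - dl) (2 * dl) z - bump R (pi - dl) (2 * dl) z.
Let phi t := sstep R ((t - s1) / tau) - sstep R ((t - s2) / tau).
Let dphi t := bump R s1 tau t - bump R s2 tau t.

Let cut_itv r1 r2 w x : 0 < w -> r1 <= r2 ->
  0 <= sstep R ((x - r1) / w) - sstep R ((x - r2) / w) <= 1.
Proof.
move=> ww r12.
have : sstep R ((x - r2) / w) <= sstep R ((x - r1) / w).
  by apply: sstep_mono; rewrite ler_pM2r ?invr_gt0//; lra.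
by have := sstep_itv R ((x - r2) / w); have := sstep_itv R ((x - r1) / w); lra.
Qed.

Let cut_out r1 r2 w x : 0 < w -> r1 <= r2 -> ~~ (r1 <= x <= r2 + w) ->
  sstep R ((x - r1) / w) - sstep R ((x - r2) / w) = 0.
Proof.
move=> ww r12; rewrite negb_and -!ltNge => /orP[h|h].
  by rewrite !sstep_le0 ?subrr// pmulr_lle0 ?invr_gt0//; lra.
by rewrite !sstep_ge1 ?subrr// ler_pdivlMr//; lra.
Qed.

Let dcut_out r1 r2 w x : 0 < w -> r1 <= r2 -> ~~ (r1 <= x <= r2 + w) ->
  bump R r1 w x - bump R r2 w x = 0.
Proof.
move=> ww r12 h; rewrite !bump_out ?subrr//; apply: contra h => /andP[h1 h2]; apply/andP; split; lra.
Qed.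

Let dcut_le r1 r2 w x : 0 < w -> `|bump R r1 w x - bump R r2 w x| <= 3 / w.
Proof.
move=> ww; have := bump_ge0 R r1 w x ww; have := bump_ge0 R r2 w x ww.
have := bump_le R r1 w x ww; have := bump_le R r2 w x ww; rewrite ler_norml; lra.
Qed.

Let cut_derive r1 r2 w x : is_derive x (1 : R)
  (fun x => sstep R ((x - r1) / w) - sstep R ((x - r2) / w)) (bump R r1 w x - bump R r2 w x).
Proof. exact: (is_deriveB (bump_derive R r1 w x) (bump_derive R r2 w x)). Qed.

Let dcut_cont r1 r2 w : continuous (fun x => bump R r1 w x - bump R r2 w x).
Proof. by move=> x; apply: cvgB; exact: bump_continuous. Qed.

Let pi0 := pi_gt0 R.

Lemma xcut_itv z : 0 <= xcut z <= 1.
Proof. by apply: cut_itv => //; move: pi0; lra. Qed.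

Lemma xcut_out z : ~~ (`|z| <= pi + dl) -> xcut z = 0.
Proof.
move=> h; move: pi0 dl0 => p0 d0; apply: cut_out => //; first lra.
by apply: contra h; rewrite ler_norml => /andP[h1 h2]; apply/andP; split; lra.
Qed.

Lemma xcut_in z : `|z| <= pi - dl -> xcut z = 1.
Proof.
move: pi0 dl0 => p0 d0.
rewrite ler_norml => /andP[h1 h2]; rewrite /xcut.
rewrite sstep_ge1 ?ler_pdivlMr//; last lra.
rewrite sstep_le0 ?subr0// pmulr_lle0 ?invr_gt0//; lra.
Qed.

Let dxcut_out z : ~~ (`|z| <= pi + dl) -> dxcut z = 0.
Proof.
move=> h; move: pi0 dl0 => p0 d0; apply: dcut_out => //; first lra.
by apply: contra h; rewrite ler_norml => /andP[h1 h2]; apply/andP; split; lra.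
Qed.

Let B := m^-1 + 3 / tau + 3 / (2 * dl).

Let i0 : 0 <= m^-1. Proof. by rewrite invr_ge0 ltW. Qed.
Let i1 : 0 <= 3 / tau. Proof. by rewrite divr_ge0 ?ltW. Qed.
Let i2 : 0 <= 3 / (2 * dl). Proof. by rewrite divr_ge0 ?ltW. Qed.

Let G := G0 R s phi dphi xcut dxcut V u.

Let dphiB t : `|dphi t| <= B.
Proof. by apply: (le_trans (dcut_le _ _ _ _ _)) => //; rewrite /B; move: i0 i1 i2; lra. Qed.
Let dxcutB t : `|dxcut t| <= B.
Proof. by apply: (le_trans (dcut_le _ _ _ _ _)) => //; rewrite /B; move: i0 i1 i2; lra. Qed.
Let VxB x t : `|Vx x t| <= B.
Proof. by apply: (le_trans (Vx_le R m T m0 T0 x t)); rewrite /B; move: i0 i1 i2; lra. Qed.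
Let phi01 t : 0 <= phi t <= 1. Proof. exact: cut_itv. Qed.

Let hX : pi + dl < pi + m * (pi / 2). Proof. by rewrite ltrD2l. Qed.

Let phiS t : ~~ (s1 <= t <= s2 + tau) -> phi t = 0. Proof. exact: cut_out. Qed.
Let dphiS t : ~~ (s1 <= t <= s2 + tau) -> dphi t = 0. Proof. exact: dcut_out. Qed.
Let Dphi t : is_derive t (1 : R) phi (dphi t). Proof. exact: cut_derive. Qed.
Let Dxcut t : is_derive t (1 : R) xcut (dxcut t). Proof. exact: cut_derive. Qed.
Let Cdphi : continuous dphi. Proof. exact: dcut_cont. Qed.
Let Cdxcut : continuous dxcut. Proof. exact: dcut_cont. Qed.

Let G_int : (leb \x leb)%E.-integrable setT (EFin \o G : MR * MR -> \bar R).
Proof.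
exact: (@G0_int R s s1 (s2 + tau) (pi + dl) B phi dphi xcut dxcut V s10 Dphi Cdphi
  phi01 dphiB phiS dphiS Dxcut Cdxcut xcut_itv dxcutB xcut_out dxcut_out
  (continuous_V2 R m T m0 T0) (V_le1 R m T) u M mu uM).
Qed.

Let G_ge0 : (0 <= \int[leb \x leb]_(p in setT) (G p)%:E)%E.
Proof.
exact: (@kruzkov_smooth R T (pi + m * (pi / 2)) s s1 (s2 + tau) (pi + dl) B phi dphi xcut dxcut V Vx
  s10 s2T hX Dphi Cdphi
  phi01 dphiB phiS dphiS Dxcut Cdxcut xcut_itv dxcutB xcut_out dxcut_out
  (continuous_V2 R m T m0 T0) (continuous_Vx2 R m T m0 T0) (V_le1 R m T) VxB
  (is_derive_Vx R m T m0 T0) (is_derive_Vt R m T m0 T0) u M mu uM Eu).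
Qed.

Let sub_meas (f : R -> R) (c : R) : continuous f -> measurable_fun setT ((fun x => f (x - c)) : MR -> R).
Proof.
move=> cf; apply: continuous_measurable_fun => x.
apply: (@continuous_comp _ _ _ (fun x : R => x - c) f); last exact: cf.
by apply: cvgB; [exact: cvg_id | exact: cvg_cst].
Qed.

Lemma slice_u t : measurable_fun setT (u ^~ t : MR -> R).
Proof. exact: (measurable_fun_pair2 t mu). Qed.

Lemma slice_V c t : measurable_fun setT ((fun x => V (x - c) t) : MR -> R).
Proof.
apply: (@sub_meas (V ^~ t)); apply: (@continuous_of_lip _ _ m^-1) => x y.
by apply: (le_trans (V_lip R m T m0 T0 _ _ _ _)); rewrite subrr normr0 addr0.
Qed.

Let xcut_cont : continuous xcut.
Proof. by move=> x; apply: cvgB; exact: sstep_affine_continuous. Qed.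

Let E1 t x := xcut (x - s) * `|u x t - V (x - s) t|.
Let E2 t x := dxcut (x - s) * kq R (u x t) (V (x - s) t).

Let out_of x : ~~ (s - (pi + dl) <= x <= s + (pi + dl)) -> ~~ (`|x - s| <= pi + dl).
Proof. by apply: contra; rewrite ler_norml => /andP[? ?]; apply/andP; split; lra. Qed.

Let kqM t x V' : 0 <= t -> `|V'| <= 1 -> `|kq R (u x t) V'| <= 2 * (M + 1) ^+ 2.
Proof.
move=> t0 V1; apply: kq_bound.
  by apply: le_trans (uM x t t0) _; lra.
by apply: le_trans V1 _; move: M0; lra.
Qed.

Lemma E1_int t : 0 <= t -> leb.-integrable setT (EFin \o E1 t : MR -> \bar R).
Proof.
move=> t0; apply: (@bounded_integrable1 R _ (s - (pi + dl)) (s + (pi + dl)) (1 * (M + 1))).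
- apply: measurable_funM; first exact: sub_meas.
  by apply: measurable_norm_sub; [exact: slice_u | exact: slice_V].
- move=> x; apply: norm_mul_le.
    by have /andP[? ?] := xcut_itv (x - s); rewrite ger0_norm.
  rewrite normr_id; apply: (le_trans (ler_normB _ _)); apply: lerD; first exact: uM.
  exact: V_le1.
- by move=> x /out_of h; rewrite /E1 xcut_out// mul0r.
Qed.

Lemma E2_int t : 0 <= t -> leb.-integrable setT (EFin \o E2 t : MR -> \bar R).
Proof.
move=> t0; apply: (@bounded_integrable1 R _ (s - (pi + dl)) (s + (pi + dl)) (B * (2 * (M + 1) ^+ 2))).
- apply: measurable_funM; first exact: sub_meas.
  by apply: measurable_kq; [exact: slice_u | exact: slice_V].
- by move=> x; apply: norm_mul_le => //; apply: kqM => //; exact: V_le1.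
- by move=> x /out_of h; rewrite /E2 dxcut_out// mul0r.
Qed.

(* The bump of dxcut at -pi is moved to pi by periodicity of u; there the two
   traces of V are opposite up to O(dl), and kq_opp gives the sign. *)
Lemma shock_le t : 0 <= t -> (\int[leb]_(x in setT) (E2 t x)%:E <= (2 * dl / m)%:E)%E.
Proof.
move=> t0.
pose f x := bump R (- pi - dl) (2 * dl) (x - s) * kq R (u x t) (V (x - s) t).
pose g x := bump R (pi - dl) (2 * dl) (x - s) * kq R (u x t) (V (x - s) t).
pose f' x := bump R (pi - dl) (2 * dl) (x - s) * kq R (u x t) (V (x - (s + 2 * pi)) t).
have fE x : f (x + - (2 * pi)) = f' x.
  rewrite /f /f'; congr (_ * kq R _ _).
  - by rewrite /bump; congr (dstep R (_ / _) / _); ring.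
  - by rewrite -(uper (x + _)) subrK.
  - by congr (V _ t); ring.
have bb r x : `|bump R r (2 * dl) x| <= 3 / (2 * dl).
  by rewrite ger0_norm ?bump_ge0// bump_le.
have mb r : measurable_fun setT ((fun x => bump R r (2 * dl) (x - s)) : MR -> R).
  by apply: sub_meas; exact: bump_continuous.
have mk c : measurable_fun setT ((fun x => kq R (u x t) (V (x - c) t)) : MR -> R).
  by apply: measurable_kq; [exact: slice_u | exact: slice_V].
have int_b r c : leb.-integrable setT (EFin \o
    (fun x => bump R r (2 * dl) (x - s) * kq R (u x t) (V (x - c) t)) : MR -> \bar R).
  apply: (@bounded_integrable1 R _ (s + r) (s + r + 2 * dl) (3 / (2 * dl) * (2 * (M + 1) ^+ 2))).
  - by apply: measurable_funM.
  - by move=> x; apply: norm_mul_le => //; apply: kqM => //; exact: V_le1.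
  - move=> x h; rewrite bump_out ?mul0r//; apply: contra h => /andP[? ?]; apply/andP; split; lra.
have If := int_b (- pi - dl) s; have Ig := int_b (pi - dl) s.
have If' := int_b (pi - dl) (s + 2 * pi).
have -> : (\int[leb]_(x in setT) (E2 t x)%:E =
    \int[leb]_(x in setT) ((f x)%:E - (g x)%:E))%E.
  by apply: eq_integral => x _; rewrite -EFinB /E2 /dxcut mulrBl.
rewrite integralB_EFin//.
have -> : (\int[leb]_(x in setT) (f x)%:E = \int[leb]_(x in setT) (f' x)%:E)%E.
  rewrite (integral_translate R (- (2 * pi)) f).
  - by apply: eq_integral => x _; rewrite fE.
  - by apply: measurable_funM.
  - have -> : (fun x => f (x + - (2 * pi))) = f' by apply/funext.
    exact: If'.
rewrite -integralB_EFin//.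
have -> : (2 * dl / m)%:E = ((2 * dl / m)%:E * \int[leb]_(x in setT) (bump R (s + pi - dl) (2 * dl) x)%:E)%E.
  by rewrite integral_bump// mule1.
have Ib := bump_integrable R (s + pi - dl) (2 * dl) w0.
have <- := integralZl measurableT Ib (2 * dl / m).
apply: le_integral => //.
- by apply: integrableB.
- exact: integrableZl.
move=> x _; rewrite -EFinB -EFinM lee_fin /f' /g -mulrBr.
have -> : bump R (s + pi - dl) (2 * dl) x = bump R (pi - dl) (2 * dl) (x - s).
  by rewrite /bump; congr (dstep R (_ / _) / _); ring.
rewrite [leRHS]mulrC.
have [zr|/(bump_out _ _ _ _ w0) ->] := boolP (pi - dl <= x - s <= pi - dl + 2 * dl); last by rewrite !mul0r.
apply: ler_wpM2l; first exact: bump_ge0.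
have -> : x - (s + 2 * pi) = - (2 * pi - (x - s)) by ring.
rewrite VN//.
set z := x - s in zr *; case/andP: zr => z1 z2.
have a0 := V_pi_ge0 R m T m0 T0 t.
have k0 := kq_opp R (u x t) _ a0.
have lip z' : pi - dl <= z' <= pi + dl -> `|V z' t - V pi t| <= dl / m.
  move=> hz; apply: (le_trans (V_lip R m T m0 T0 _ _ _ _)).
  rewrite subrr normr0 addr0 mulrC ler_pM2r ?invr_gt0// ler_norml; lra.
have l1 : `|kq R (u x t) (- V (2 * pi - z) t) - kq R (u x t) (- V pi t)| <= dl / m.
  apply: (le_trans (kq_lip R 1 _ _ _ _ _)); rewrite ?normrN ?V_le1//.
  rewrite mul1r (_ : - V _ t - - V _ t = - (V (2 * pi - z) t - V pi t)); last by ring.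
  by rewrite normrN; apply: lip; lra.
have l2 : `|kq R (u x t) (V z t) - kq R (u x t) (V pi t)| <= dl / m.
  apply: (le_trans (kq_lip R 1 _ _ _ _ _)); rewrite ?V_le1//.
  by rewrite mul1r; apply: lip; lra.
move: l1 l2; rewrite !ler_norml => /andP[_ l1] /andP[l2 _].
have -> : 2 * dl / m = dl / m + dl / m by field; rewrite gt_eqF.
lra.
Qed.

Lemma comparison (F : R -> R) (A1 A2 : R) :
  (forall t, 0 <= t -> (\int[leb]_(x in setT) (E1 t x)%:E = (F t)%:E)%E) ->
  (forall t, s1 <= t <= s1 + tau -> F t <= A1) ->
  (forall t, s2 <= t <= s2 + tau -> A2 <= F t) ->
  A2 <= A1 + 2 * dl / m * T.
Proof.
move=> HF H1 H2.
have T00 : 0 < T by move: s10 s12 tau0 s2T; lra.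
pose ind t := T * bump R 0 T t.
pose up t := A1 * bump R s1 tau t - A2 * bump R s2 tau t + 2 * dl / m * phi t.
have mphi : measurable_fun setT (phi : MR -> R).
  by apply: continuous_measurable_fun => x; apply: cvgB; exact: sstep_affine_continuous.
have Ib1 := bump_integrable R s1 tau tau0.
have Ib2 := bump_integrable R s2 tau tau0.
have Ip : leb.-integrable setT (EFin \o phi : MR -> \bar R).
  apply: (@bounded_integrable1 R phi s1 (s2 + tau) 1) => // x.
  by have /andP[? ?] := phi01 x; rewrite ger0_norm.
have I1 := integrableZl measurableT A1 Ib1.
have I2 := integrableZl measurableT A2 Ib2.
have I3 := integrableZl measurableT (2 * dl / m) Ip.
have pT : (\int[leb]_(t in setT) (phi t)%:E <= T%:E)%E.
  have -> : (\int[leb]_(t in setT) (phi t)%:E = \int[leb]_(t in `[0%R, T]%classic) (phi t)%:E)%E.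
    rewrite [RHS]integral_mkcond; apply: eq_integral => x _.
    rewrite patchE; case: ifPn => //; rewrite notin_setE /= in_itv /= => /negP h.
    rewrite phiS//; apply: contra h => /andP[h1 h2].
    by move: s10 s2T => ? ?; apply/andP; split; lra.
  have -> : (T%:E = \int[leb]_(t in `[0%R, T]%classic) (cst 1%:E t))%E.
    rewrite integral_cst// mul1e; change (T%:E = leb `[0%R, T]%classic).
    by rewrite lebesgue_measure_itv /= lte_fin T00 -EFinB subr0.
  apply: ge0_le_integral => //.
  - by move=> x _; rewrite lee_fin; have /andP[] := phi01 x.
  - by apply/measurable_EFinP; apply: measurable_funS mphi.
  - by move=> x _; rewrite lee_fin; have /andP[] := phi01 x.
have upi : leb.-integrable setT (EFin \o up : MR -> \bar R).
  have -> : EFin \o up = (fun t => ((A1%:E * (bump R s1 tau t)%:E - A2%:E * (bump R s2 tau t)%:E) + (2 * dl / m)%:E * (phi t)%:E)%E).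
    by apply/funext => t; rewrite /up /= EFinD EFinB !EFinM.
  by apply: integrableD => //; exact: integrableB.
have : (0 <= \int[leb]_(t in setT) (up t)%:E)%E.
  apply: (le_trans G_ge0).
  have <- := integral12_prod_meas1 G_int.
  apply: le_integral => //; first exact: integrable_fubini_F.
  move=> t _; rewrite /fubini_F /=.
  have [tin|tout] := boolP (s1 <= t <= s2 + tau); last first.
    have -> : (\int[leb]_x (G (t, x))%:E = 0)%E.
      rewrite integral0_eq// => x _; rewrite /G /G0 /= phiS// dphiS//.
      by rewrite !mul0r addr0.
    rewrite lee_fin /up phiS// mulr0 addr0.
    rewrite !bump_out ?mulr0 ?subrr//.
      by apply: contra tout => /andP[h1 h2]; apply/andP; split=> //; move: s12; lra.
    by apply: contra tout => /andP[h1 h2]; apply/andP; split; move: s12; lra.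
  have t0 : 0 <= t by case/andP: tin => h _; move: s10; lra.
  have J1 := E1_int t t0; have J2 := E2_int t t0.
  have K1 := integrableZl measurableT (dphi t) J1.
  have K2 := integrableZl measurableT (phi t) J2.
  have -> : (\int[leb]_x (G (t, x))%:E = \int[leb]_x ((dphi t)%:E * (E1 t x)%:E + (phi t)%:E * (E2 t x)%:E))%E.
    by apply: eq_integral => x _; rewrite -!EFinM -EFinD.
  have -> := integralD measurableT K1 K2.
  have -> := integralZl measurableT J1 (dphi t).
  have -> := integralZl measurableT J2 (phi t).
  have -> : (\int[leb]_(x in setT) (EFin \o E1 t) x = (F t)%:E)%E := HF t t0.
  rewrite /up [leRHS]EFinD; apply: leeD.
    rewrite -EFinM lee_fin /dphi mulrBl; apply: lerB.
      rewrite mulrC; have [h|h] := boolP (s1 <= t <= s1 + tau).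
        by apply: ler_wpM2r; [exact: bump_ge0 | exact: H1].
      by rewrite bump_out// !mulr0.
    rewrite [leRHS]mulrC; have [h|h] := boolP (s2 <= t <= s2 + tau).
      by apply: ler_wpM2r; [exact: bump_ge0 | exact: H2].
    by rewrite bump_out// !mulr0.
  rewrite [leRHS]EFinM [leRHS]muleC; apply: lee_wpmul2l.
    by rewrite lee_fin; have /andP[] := phi01 t.
  exact: shock_le.
have -> : (\int[leb]_(t in setT) (up t)%:E = A1%:E - A2%:E + (2 * dl / m)%:E * \int[leb]_(t in setT) (phi t)%:E)%E.
  have -> : (\int[leb]_(t in setT) (up t)%:E = \int[leb]_(t in setT) ((A1%:E * (bump R s1 tau t)%:E - A2%:E * (bump R s2 tau t)%:E) + (2 * dl / m)%:E * (phi t)%:E))%E.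
    by apply: eq_integral => t _; rewrite /up EFinD EFinB !EFinM.
  have I12 := integrableB measurableT I1 I2.
  have -> := integralD measurableT I12 I3.
  have -> := integralB measurableT I1 I2.
  have -> := integralZl measurableT Ib1 A1.
  have -> := integralZl measurableT Ib2 A2.
  have -> := integralZl measurableT Ip (2 * dl / m).
  have -> := integral_bump R s1 tau tau0.
  have -> := integral_bump R s2 tau tau0.
  by rewrite !mule1.
move=> H.
have : (0 <= A1%:E - A2%:E + (2 * dl / m)%:E * T%:E)%E.
  apply: (le_trans H); apply: leeD => //; apply: lee_wpmul2l => //.
  by rewrite lee_fin divr_ge0 ?(ltW m0)// mulr_ge0// ltW.
by rewrite -EFinB -EFinM -EFinD lee_fin; lra.
Qed.
End comparison.

Section interval_integrals.
Variable R : realType.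
Local Notation leb := (@lebesgue_measure R).
Local Notation MR := (measurableTypeR R).
Implicit Types (f g h : R -> R) (a b c : R).

Lemma ge0_int_le_add (D : set MR) f g h : measurable D ->
  measurable_fun setT (f : MR -> R) -> measurable_fun setT (g : MR -> R) ->
  measurable_fun setT (h : MR -> R) ->
  (forall x, 0 <= f x) -> (forall x, 0 <= g x) -> (forall x, 0 <= h x) ->
  (forall x, D x -> f x <= g x + h x) ->
  (\int[leb]_(x in D) (f x)%:E <= \int[leb]_(x in D) (g x)%:E + \int[leb]_(x in D) (h x)%:E)%E.
Proof.
move=> mD mf mg mh f0 g0 h0 fgh.
have M (k : R -> R) : measurable_fun setT (k : MR -> R) -> measurable_fun D (EFin \o k : MR -> \bar R).
  by move=> mk; apply/measurable_EFinP; exact: measurable_funS mk.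
have <- := @ge0_integralD _ MR R leb D mD (EFin \o g) (EFin \o h) (fun x _ => g0 x) (M _ mg) (fun x _ => h0 x) (M _ mh).
apply: (@ge0_le_integral _ MR R leb D mD (EFin \o f)).
- by move=> x _; rewrite lee_fin.
- exact: M.
- by apply: emeasurable_funD; exact: M.
- by move=> x Dx; rewrite /= -EFinD lee_fin; exact: fgh.
Qed.

Lemma int_cst_itv a b c : a <= b -> (\int[leb]_(x in `[a, b]%classic) (cst c x)%:E = (c * (b - a))%:E)%E.
Proof.
move=> ab; have -> : (\int[leb]_(x in `[a, b]%classic) (cst c x)%:E = c%:E * leb `[a, b]%classic)%E.
  exact: (@integral_cst _ MR R leb `[a, b]%classic (measurable_itv _) c%:E).
have -> : leb `[a, b]%classic = (b - a)%:E.
  rewrite lebesgue_measure_itv /= lte_fin; move: ab; rewrite le_eqVlt => /predU1P[->|->]; by rewrite ?ltxx ?subrr -?EFinB.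
by rewrite -EFinM.
Qed.

Lemma int_indic_le (D : set MR) a b c : measurable D -> a <= b -> 0 <= c ->
  (\int[leb]_(x in D) (c * \1_(`[a, b]%classic : set R) x)%:E <= (c * (b - a))%:E)%E.
Proof.
move=> mD ab c0.
have mI : measurable_fun D (EFin \o (\1_(`[a, b]%classic : set R) : MR -> R)).
  by apply/measurable_EFinP; exact: measurable_indic.
have -> : (\int[leb]_(x in D) (c * \1_(`[a, b]%classic : set R) x)%:E = \int[leb]_(x in D) (c%:E * (EFin \o (\1_(`[a, b]%classic : set R) : MR -> R)) x))%E.
  by apply: eq_integral => x _; rewrite /= EFinM.
rewrite (@ge0_integralZl_EFin _ MR R leb D mD _ _ mI c c0); last first.
  by move=> x _; rewrite lee_fin.
rewrite EFinM; apply: lee_wpmul2l; first by rewrite lee_fin.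
rewrite (@integral_indic _ MR R leb D mD `[a, b]%classic (measurable_itv _)).
apply: (@le_trans _ _ (leb `[a, b]%classic)).
  by apply: le_measure; rewrite ?inE//; exact: measurableI.
rewrite lebesgue_measure_itv /= lte_fin; move: ab; rewrite le_eqVlt => /predU1P[->|->]; by rewrite ?ltxx ?subrr -?EFinB.
Qed.

Lemma int_itv_split_le a b c f : a <= b -> b <= c -> measurable_fun setT (f : MR -> R) ->
  (forall x, 0 <= f x) ->
  (\int[leb]_(x in `[a, c]%classic) (f x)%:E <=
   \int[leb]_(x in `[a, b]%classic) (f x)%:E + \int[leb]_(x in `[b, c]%classic) (f x)%:E)%E.
Proof.
move=> ab bc mf f0.
have M (D : set MR) : measurable_fun D (EFin \o f : MR -> \bar R).
  by apply/measurable_EFinP; exact: measurable_funS mf.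
have -> : (`[a, c]%classic = `[a, b]%classic `|` `]b, c]%classic :> set R).
  apply/seteqP; split => x /=; rewrite !in_itv /=.
    by move=> /andP[h1 h2]; have [h|h] := leP x b; [left | right]; rewrite ?h1 ?h ?h2.
  by case=> /andP[h1 h2]; apply/andP; split; lra.
rewrite (@ge0_integral_setU _ MR R leb _ _ _ _ (EFin \o f))//; last first.
- rewrite disj_set2E; apply/eqP/seteqP; split => x //= -[]; rewrite !in_itv /=.
  by move=> /andP[_ h1] /andP[h2 _]; move: (lt_le_trans h2 h1); rewrite ltxx.
- by move=> x _; rewrite lee_fin.
apply: leeD => //; apply: (@ge0_subset_integral _ MR R leb _ _ _ _ (EFin \o f)) => //.
- by move=> x _; rewrite lee_fin.
- by move=> x /=; rewrite !in_itv /= => /andP[h1 h2]; rewrite (ltW h1).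
Qed.

Lemma int_itv_period a b c f : (forall x, f (x + c) = f x) -> measurable_fun setT (f : MR -> R) ->
  (forall x, 0 <= f x) ->
  (\int[leb]_(x in `[(a + c)%R, (b + c)%R]%classic) (f x)%:E = \int[leb]_(x in `[a, b]%classic) (f x)%:E)%E.
Proof.
move=> fp mf f0.
rewrite (@ge0_integral_translate R c (EFin \o f))//.
- have -> : [set x | `[(a + c)%R, (b + c)%R]%classic (x + c)] = `[a, b]%classic.
    by apply/seteqP; split=> x /=; rewrite !in_itv /=; lra.
  by apply: eq_integral => x _; rewrite /= fp.
- by apply/measurable_EFinP; exact: measurable_funS mf.
- by move=> x _; rewrite lee_fin.
Qed.

Lemma int_two_periods a f : (forall x, f (x + 2 * pi) = f x) -> measurable_fun setT (f : MR -> R) ->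
  (forall x, 0 <= f x) ->
  (\int[leb]_(x in `[a, (a + 4 * pi)%R]%classic) (f x)%:E <=
   2%:E * \int[leb]_(x in `[a, (a + 2 * pi)%R]%classic) (f x)%:E)%E.
Proof.
move=> fp mf f0; have pi0 := pi_gt0 R.
have -> : (2%:E * \int[leb]_(x in `[a, (a + 2 * pi)%R]%classic) (f x)%:E
   = \int[leb]_(x in `[a, (a + 2 * pi)%R]%classic) (f x)%:E + \int[leb]_(x in `[a, (a + 2 * pi)%R]%classic) (f x)%:E)%E.
  by rewrite (_ : 2 = 1 + 1 :> R)// EFinD ge0_muleDl ?lee_fin// !mul1e.
apply: (le_trans (@int_itv_split_le a (a + 2 * pi) (a + 4 * pi) f _ _ mf f0)); [lra | lra |].
apply: leeD => //; rewrite -(@int_itv_period a (a + 2 * pi) (2 * pi) f fp mf f0).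
by rewrite (_ : a + 2 * pi + 2 * pi = a + 4 * pi)//; ring.
Qed.

Lemma int_four_periods f : (forall x, f (x + 2 * pi) = f x) -> measurable_fun setT (f : MR -> R) ->
  (forall x, 0 <= f x) ->
  (\int[leb]_(x in `[(- 4 * pi)%R, (4 * pi)%R]%classic) (f x)%:E <=
   4%:E * \int[leb]_(x in `[0%R, (2 * pi)%R]%classic) (f x)%:E)%E.
Proof.
move=> fp mf f0; have pi0 := pi_gt0 R.
apply: (le_trans (@int_itv_split_le (- 4 * pi) 0 (4 * pi) f _ _ mf f0)); [lra | lra |].
have I2 := @int_two_periods 0 f fp mf f0.
have I1 := @int_two_periods (- 4 * pi) f fp mf f0.
have E1 := @int_itv_period (- 4 * pi) (- 4 * pi + 2 * pi) (2 * pi) f fp mf f0.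
have E2 := @int_itv_period (- 4 * pi + 2 * pi) (- 4 * pi + 2 * pi + 2 * pi) (2 * pi) f fp mf f0.
rewrite !add0r in I2; rewrite (_ : - 4 * pi + 4 * pi = 0) in I1; last by ring.
rewrite -E1 -E2 in I1.
rewrite (_ : - 4 * pi + 2 * pi + 2 * pi + 2 * pi = 2 * pi) in I1; last by ring.
rewrite (_ : - 4 * pi + 2 * pi + 2 * pi = 0) in I1; last by ring.
apply: (le_trans (leeD I1 I2)).
by rewrite -ge0_muleDl ?lee_fin// -EFinD (_ : 2 + 2 = 4 :> R)//; ring.
Qed.
End interval_integrals.

Section stability.
Variables (R : realType) (T xi : R) (u : R -> R -> R) (w : R -> R).
Hypotheses (piT : pi < T) (xi0 : 0 <= xi <= 2 * pi).
Hypothesis Su : entropy_solution u (ubar xi).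
Hypothesis wE : forall z, `|z| <= pi -> exists y, [/\ - (pi / 2) <= y <= pi / 2,
  y + T * sin y = z & w z = sin y].
Hypothesis mw : measurable_fun setT (w : measurableTypeR R -> R).
Local Notation leb := (@lebesgue_measure R).
Local Notation MR := (measurableTypeR R).
Local Notation s := (xi - pi).

Lemma stability (e : R) : 0 < e ->
  (\int[leb]_(x in `[(xi - 2 * pi)%R, xi]%classic) (`|u x T - w (x - s)|)%:E <= e%:E)%E.
Proof.
move: piT xi0 => piT' /andP[xi0' xi2'] e0.
have [uper [[M uM] [mu [Eu [ct u0]]]]] := Su.
have pi0 := pi_gt0 R; have T0 : 0 < T := lt_trans pi0 piT.
have T0' := ltW T0.
have M0 : 0 <= M by apply: le_trans (uM 0 0 _).
pose Kc : R := 8 * pi * (pi + 2) * 2 + 2 * pi * pi.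
have pi2 : 0 < pi + 2 :> R by lra.
have Kc0 : 0 < Kc by rewrite /Kc addr_gt0// !mulr_gt0.
pose m := e / (4 * Kc).
have m0 : 0 < m by rewrite divr_gt0//; lra.
have mK : Kc * m = e / 4 by rewrite /m; field; lra.
pose dl := Num.min (Num.min pi (m * (pi / 4))) (e / (8 * (T / m + M + 1))).
have Tm0 : 0 < T / m by rewrite divr_gt0.
have TM0 : 0 < T / m + M + 1 by lra.
have mpi0 : 0 < m * (pi / 4) by rewrite mulr_gt0// divr_gt0.
have dl0 : 0 < dl by rewrite /dl !lt_min pi0 mpi0/= divr_gt0// mulr_gt0.
have dlpi : dl <= pi by rewrite /dl !ge_min lexx.
have dlm : dl < m * (pi / 2).
  have h : dl <= m * (pi / 4) by rewrite /dl !ge_min lexx !orbT.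
  have : 0 < m * pi by rewrite mulr_gt0.
  lra.
have dle : 2 * dl * (T / m + M + 1) <= e / 4.
  have h : dl <= e / (8 * (T / m + M + 1)) by rewrite /dl !ge_min lexx !orbT.
  rewrite ler_pdivlMr in h; last by rewrite mulr_gt0.
  lra.
pose e1 := e / 64.
have e10 : 0 < e1 by rewrite divr_gt0.
have [d0 [d00 Hd0]] := ct 0 (lexx 0) e1 e10.
have [dT [dT0 HdT]] := ct T T0' e1 e10.
pose d := Num.min (Num.min d0 dT) (Num.min (m ^+ 2) T).
have dpos : 0 < d by rewrite /d !lt_min d00 dT0 exprn_gt0.
have [dd0 ddT] : d <= d0 /\ d <= dT by rewrite /d !ge_min !lexx ?orbT.
have [dm dT'] : d <= m ^+ 2 /\ d <= T by rewrite /d !ge_min !lexx ?orbT.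
pose s1 := d / 8; pose tau := d / 8; pose s2 := T - d / 2.
have [s10 tau0] : 0 < s1 /\ 0 < tau by rewrite !divr_gt0.
have s12 : s1 <= s2 by rewrite /s1 /s2; lra.
have s2T : s2 + tau < T by rewrite /tau /s2; lra.
pose V := V R m T.
pose E1 t x := xcut R dl (x - s) * `|u x t - V (x - s) t|.
pose F t := fine (\int[leb]_(x in setT) (E1 t x)%:E)%E.
have E1i t : 0 <= t -> leb.-integrable setT (EFin \o E1 t : MR -> \bar R).
  exact: (E1_int R m T s dl s1 s2 tau M u m0 dl0 tau0 s10 s12 s2T mu uM).
have HF t : 0 <= t -> (\int[leb]_(x in setT) (E1 t x)%:E = (F t)%:E)%E.
  by move=> t0; rewrite /F fineK//; apply: (integrable_fin_num measurableT (E1i t t0)).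
have cut01 z := xcut_itv R dl dl0 z.
have mE1 t : 0 <= t -> measurable_fun setT (E1 t : MR -> R).
  by move=> t0; apply/measurable_EFinP; exact: (measurable_int _ (E1i t t0)).
have E10 t x : 0 <= E1 t x by have /andP[h _] := cut01 (x - s); rewrite mulr_ge0.
pose J : set MR := `[(- 4 * pi)%R, (4 * pi)%R]%classic.
have mJ : measurable J by exact: measurable_itv.
have E1J t x : ~ J x -> E1 t x = 0.
  move=> nJ; rewrite /E1 xcut_out ?mul0r//; apply/negP => h; apply: nJ.
  by rewrite /J /= in_itv /=; move: h; rewrite ler_norml; move: dlpi xi0' xi2' pi0; clear -piT xi0 Su wE mw; lra.
have intJ t : (\int[leb]_(x in setT) (E1 t x)%:E = \int[leb]_(x in J) (E1 t x)%:E)%E.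
  rewrite [RHS]integral_mkcond; apply: eq_integral => x _.
  by rewrite patchE; case: ifPn => //; rewrite notin_setE => /E1J ->.
have mdiff t t' : measurable_fun setT ((fun x => `|u x t - u x t'|) : MR -> R).
  by apply: measurable_norm_sub; exact: (slice_u R u mu).
have pdiff t t' x : `|u (x + 2 * pi) t - u (x + 2 * pi) t'| = `|u x t - u x t'|.
  by rewrite !uper.
have cstJ c : 0 <= c -> (\int[leb]_(x in J) (cst c x)%:E = (c * (8 * pi))%:E)%E.
  by move=> c0; rewrite /J int_cst_itv; [congr EFin; ring | move: pi0; clear -piT xi0 Su wE mw; lra].
have JD t t' : (\int[leb]_(x in @per_dom R) (`|u x t - u x t'|)%:E <= e1%:E)%E ->
    (\int[leb]_(x in J) (`|u x t - u x t'|)%:E <= (4 * e1)%:E)%E.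
  move=> h; apply: (le_trans (int_four_periods R (fun x => `|u x t - u x t'|) (pdiff t t') (mdiff t t') (fun x => normr_ge0 _))).
  by rewrite EFinM; apply: lee_wpmul2l; rewrite ?lee_fin.
have cutin x : ~~ (`|x - s| <= pi + dl) -> E1 ^~ x = fun=> 0.
  by move=> h; apply/funext => t; rewrite /E1 xcut_out ?mul0r.
have Vt z t t' : `|t - t'| <= d -> `|V z t - V z t'| <= m.
  move=> h; apply: (le_trans (V_lip R m T m0 T0' z t z t')).
  rewrite subrr normr0 add0r mulrC ler_pdivrMr//; apply: (le_trans h).
  by rewrite -expr2.
have mpi : 0 < m * pi := mulr_gt0 m0 pi0.
have F1 t : s1 <= t <= s1 + tau -> F t <= 4 * e1 + (m * pi + m) * (8 * pi).
  move=> /andP[t1 t2].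
  have t0 : 0 <= t := le_trans (ltW s10) t1.
  have td : `|t - 0| < d0 by rewrite subr0 ger0_norm//; move: t2 dd0 dpos; rewrite /s1 /tau; clear -piT xi0 Su wE mw; lra.
  rewrite -lee_fin -HF// intJ EFinD -cstJ; last first.
    by move: mpi m0; clear -piT xi0 Su wE mw; lra.
  apply: (le_trans (@ge0_int_le_add R J (E1 t) (fun x => `|u x t - u x 0|) (cst (m * pi + m)) mJ (mE1 t t0) (mdiff t 0) (measurable_cst _) (E10 t) (fun x => normr_ge0 _) _ _)).
  - by move=> x /=; move: mpi m0; clear -piT xi0 Su wE mw; lra.
  - move=> x _ /=; have [hx|/cutin h] := boolP (`|x - s| <= pi + dl); last first.
      rewrite (congr1 (fun f => f t) h).
      by have := normr_ge0 (u x t - u x 0); move: mpi m0; clear -piT xi0 Su wE mw; lra.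
    have /andP[c0 c1] := cut01 (x - s).
    have h0 : `|u x 0 - V (x - s) 0| <= m * pi.
      rewrite u0 /ubar distrC.
      have -> : - sin (x - xi) = sin (x - s).
        by rewrite (_ : x - s = x - xi + pi) ?sinDpi//; ring.
      by apply: V0E => //; apply: (le_trans hx); move: dlm; clear -piT xi0 Su wE mw; lra.
    have h1 : `|V (x - s) t - V (x - s) 0| <= m.
      by apply: Vt; rewrite subr0 ger0_norm//; move: t2 dpos; rewrite /s1 /tau; clear -piT xi0 Su wE mw; lra.
    rewrite /E1.
    have -> : u x t - V (x - s) t = (u x t - u x 0) + ((u x 0 - V (x - s) 0) - (V (x - s) t - V (x - s) 0)).
      by ring.
    apply: (le_trans (ler_piMl (normr_ge0 _) c1)).
    apply: (le_trans (ler_normD _ _)); rewrite lerD2l.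
    by apply: (le_trans (ler_normB _ _)); apply: lerD.
  by apply: leeD => //; apply: JD; exact: Hd0.
have F2 t : s2 <= t <= s2 + tau -> F T - (4 * e1 + m * (8 * pi)) <= F t.
  move=> /andP[t1 t2].
  have t0 : 0 <= t by move: t1 dT' T0; rewrite /s2; clear -piT xi0 Su wE mw; lra.
  have td : `|t - T| <= d / 2 by rewrite ler_norml; move: t1 t2 dpos; rewrite /s2 /tau; clear -piT xi0 Su wE mw; lra.
  rewrite lerBlDr -lee_fin -HF// intJ EFinD.
  have mR : measurable_fun setT ((fun x => `|u x t - u x T| + m) : MR -> R).
    by apply: measurable_funD => //; exact: mdiff.
  apply: (le_trans (@ge0_int_le_add R J (E1 T) (E1 t) (fun x => `|u x t - u x T| + m) mJ (mE1 T T0') (mE1 t t0) mR (E10 T) (E10 t) _ _)).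
  - by move=> x; rewrite addr_ge0// ltW.
  - move=> x _; rewrite /E1.
    have /andP[c0 c1] := cut01 (x - s).
    have h1 : `|V (x - s) t - V (x - s) T| <= m by apply: Vt; move: td dpos; clear -piT xi0 Su wE mw; lra.
    have -> : u x T - V (x - s) T = (u x t - V (x - s) t) + (- (u x t - u x T) + (V (x - s) t - V (x - s) T)).
      by ring.
    have h2 : `|- (u x t - u x T) + (V (x - s) t - V (x - s) T)| <= `|u x t - u x T| + m.
      by apply: (le_trans (ler_normD _ _)); rewrite normrN lerD2l.
    apply: (le_trans (ler_wpM2l c0 (ler_normD _ _))); rewrite mulrDr lerD2l.
    exact: (le_trans (ler_piMl (normr_ge0 _) c1)).
  rewrite -intJ HF//; apply: leeD => //.
  apply: (le_trans (@ge0_int_le_add R J _ (fun x => `|u x t - u x T|) (cst m) mJ mR (mdiff t T) (measurable_cst _) _ (fun x => normr_ge0 _) _ _)).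
  - by move=> x; rewrite addr_ge0// ltW.
  - by move=> x /=; rewrite ltW.
  - by [].
  rewrite (cstJ _ (ltW m0)) EFinD; apply: leeD => //; apply: JD; apply: HdT => //; move: td dpos ddT; clear -piT xi0 Su wE mw; lra.
have FT : F T <= 4 * e1 + (m * pi + m) * (8 * pi) + 2 * dl / m * T + (4 * e1 + m * (8 * pi)).
  rewrite -lerBlDr.
  exact: (comparison R m T s dl s1 s2 tau M u m0 dl0 dlm tau0 s10 s12 s2T uper mu uM Eu F _ _ HF F1 F2).
pose D : set MR := `[(xi - 2 * pi)%R, xi]%classic.
have mD : measurable D by exact: measurable_itv.
have mf : measurable_fun setT ((fun x => `|u x T - w (x - s)|) : MR -> R).
  apply: measurable_norm_sub; first exact: (slice_u R u mu).
  apply: (measurableT_comp mw).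
  by apply: continuous_measurable_fun => x; apply: cvgB; [exact: cvg_id | exact: cvg_cst].
have mI a b : measurable_fun setT (\1_(`[a, b]%classic : set R) : MR -> R).
  exact: measurable_indic.
have I0 (a b x : R) : 0 <= (\1_(`[a, b]%classic : set R) x : R) by rewrite indicE; case: (_ \in _).
pose I1 x : R := (M + 1) * \1_(`[(xi - dl)%R, xi]%classic : set R) x.
pose I2 x : R := (M + 1) * \1_(`[(xi - 2 * pi)%R, (xi - 2 * pi + dl)%R]%classic : set R) x.
have mI1 : measurable_fun setT (I1 : MR -> R) by apply: measurable_funM => //; exact: mI.
have mI2 : measurable_fun setT (I2 : MR -> R) by apply: measurable_funM => //; exact: mI.
have I10 x : 0 <= I1 x by rewrite /I1 mulr_ge0// addr_ge0.
have I20 x : 0 <= I2 x by rewrite /I2 mulr_ge0// addr_ge0.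
have mI12 : measurable_fun setT ((fun x => I1 x + I2 x) : MR -> R) by exact: measurable_funD.
have mI3 : measurable_fun setT ((fun x => cst (m * pi) x + (I1 x + I2 x)) : MR -> R).
  by apply: measurable_funD.
have mp0 : 0 <= m * pi by rewrite mulr_ge0 ?ltW.
apply: (le_trans (@ge0_int_le_add R D _ (E1 T) (fun x => cst (m * pi) x + (I1 x + I2 x)) mD mf (mE1 T T0') mI3 (fun x => normr_ge0 _) (E10 T) _ _)).
- by move=> x; rewrite !addr_ge0.
- move=> x; rewrite /D /= in_itv /= => /andP[x1 x2].
  have zp : `|x - s| <= pi by rewrite ler_norml; move: x1 x2; clear -piT xi0 Su wE mw; lra.
  have [y [yp yE ->]] := wE _ zp.
  have zX : `|x - s| <= pi + m * (pi / 2) by apply: (le_trans zp); move: mp0; clear -piT xi0 Su wE mw; lra.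
  have hV := VTE R m T m0 T0' (x - s) y zX piT yp yE zp.
  have [hin|hout] := boolP (`|x - s| <= pi - dl).
    have -> : E1 T x = `|u x T - V (x - s) T| by rewrite /E1 xcut_in// mul1r.
    have -> : u x T - sin y = (u x T - V (x - s) T) + (V (x - s) T - sin y) by ring.
    apply: (le_trans (ler_normD _ _)); rewrite lerD2l.
    by apply: (le_trans hV); rewrite lerDl addr_ge0.
  have bd : `|u x T - sin y| <= M + 1.
    by apply: (le_trans (ler_normB _ _)); apply: lerD; [exact: uM | exact: sin_max].
  apply: (le_trans bd); apply: (@le_trans _ _ (I1 x + I2 x)); last first.
    by rewrite addrA lerDr addr_ge0.
  have [xx|xx] := leP (xi - dl) x.
    have -> : I1 x = M + 1 by rewrite /I1 indicE mem_set ?mulr1// /= in_itv /= xx.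
    by rewrite lerDl.
  have -> : I2 x = M + 1.
    rewrite /I2 indicE mem_set ?mulr1// /= in_itv /= x1 /=.
    rewrite leNgt; apply/negP => h; move/negP: hout; apply.
    by rewrite ler_norml; move: h xx x2; clear -piT xi0 Su wE mw; lra.
  by rewrite lerDr.
have S1 : (\int[leb]_(x in D) (E1 T x)%:E <= (F T)%:E)%E.
  rewrite -HF//; apply: (@ge0_subset_integral _ MR R leb _ _ _ _ (EFin \o E1 T)) => //.
  - by apply/measurable_EFinP; exact: mE1.
  - by move=> x _; rewrite lee_fin.
have S2 : (\int[leb]_(x in D) (cst (m * pi) x + (I1 x + I2 x))%:E <=
    (m * pi * (2 * pi) + ((M + 1) * dl + (M + 1) * dl))%:E)%E.
  apply: (le_trans (@ge0_int_le_add R D _ (cst (m * pi)) (fun x => I1 x + I2 x) mD mI3 (measurable_cst _) mI12 _ _ _ _)).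
  - by move=> x; rewrite !addr_ge0.
  - by [].
  - by move=> x; rewrite !addr_ge0.
  - by [].
  rewrite EFinD; apply: leeD.
    rewrite /D int_cst_itv; last by move: pi0; clear -piT xi0 Su wE mw; lra.
    by rewrite lee_fin (_ : xi - (xi - 2 * pi) = 2 * pi)//; ring.
  apply: (le_trans (@ge0_int_le_add R D _ I1 I2 mD mI12 mI1 mI2 _ I10 I20 _)).
  - by move=> x; rewrite !addr_ge0.
  - by [].
  rewrite EFinD; apply: leeD.
    apply: (le_trans (@int_indic_le R D (xi - dl) xi (M + 1) mD _ _)); [by rewrite gerBl ltW | exact: addr_ge0 |].
    by rewrite lee_fin (_ : xi - (xi - dl) = dl)//; ring.
  apply: (le_trans (@int_indic_le R D (xi - 2 * pi) (xi - 2 * pi + dl) (M + 1) mD _ _)); [by rewrite lerDl ltW | exact: addr_ge0 |].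
  by rewrite lee_fin (_ : xi - 2 * pi + dl - (xi - 2 * pi) = dl)//; ring.
apply: (le_trans (leeD S1 S2)); rewrite -EFinD lee_fin.
have mK' : m * Kc = e / 4 by rewrite mulrC.
rewrite /Kc in mK'.
rewrite (_ : 2 * dl / m * T = 2 * dl * (T / m)) in FT; last by ring.
rewrite /e1 in FT.
have TM1 : 2 * dl * (T / m + M + 1) = 2 * dl * (T / m) + 2 * dl * (M + 1) by ring.
rewrite TM1 in dle.
have mp2 : 0 <= m * pi * pi by rewrite mulr_ge0// ltW.
move: FT mK' dle mp2 e0 mp0; clear -piT xi0 Su wE mw; nra.
Qed.
End stability.

(** * Analyticity of the profile at time T *)

Section kroot.
Variables (R : realType) (T : R).
Hypothesis piT : pi < T.
Let pi0 := pi_gt0 R.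
Let T0 : 0 < T := lt_trans pi0 piT.

Definition hsols x : set R := [set y | - (pi / 2) <= y <= pi / 2 /\
  y + T * sin y = clamp R (- (pi / 2 + T)) (pi / 2 + T) x].
Definition hroot x : R := xget 0 (hsols x).

Let HT : - (pi / 2 + T) <= pi / 2 + T. Proof. by move: pi0 T0; lra. Qed.

Lemma hrootP x : - (pi / 2) <= hroot x <= pi / 2 /\
  hroot x + T * sin (hroot x) = clamp R (- (pi / 2 + T)) (pi / 2 + T) x.
Proof.
have p0 := pi0; have t0 := T0.
have /andP[h1 h2] := clamp_itv R _ _ x HT.
have cf : continuous (fun z : R => z + T * sin z).
  move=> z; apply: cvgD; first exact: cvg_id.
  by apply: cvgM; [exact: cvg_cst | exact: continuous_sin].
have ab : - (pi / 2) <= pi / 2 :> R by lra.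
have [||y yi yE] := @IVT R (fun z : R => z + T * sin z) (- (pi / 2)) (pi / 2)
   (clamp R (- (pi / 2 + T)) (pi / 2 + T) x) ab.
- exact: continuous_subspaceT.
- rewrite sinN sin_pihalf (_ : - (pi / 2) + T * - 1 = - (pi / 2 + T)); last by ring.
  by rewrite mulr1 (min_l HT) (max_r HT) h1.
rewrite in_itv /= in yi.
exact: (@xgetPex _ 0 (hsols x) (ex_intro _ y (conj yi yE))).
Qed.

Let hcos0 (y : R) : - (pi / 2) <= y <= pi / 2 -> 0 <= cos y.
Proof. exact: cos_ge0_pihalf. Qed.

Lemma hslope y1 y2 : - (pi / 2) <= y1 -> y2 <= pi / 2 -> y1 <= y2 ->
  y2 - y1 <= (y2 + T * sin y2) - (y1 + T * sin y1).
Proof.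
move=> h1 h2 le; have t0 := T0.
have [c /andP[c1 c2] E] := MVT_le _ _ _ _ _ le (@is_derive_sin R).
have cc : 0 <= cos c by apply: hcos0; lra.
suff : 0 <= T * (sin y2 - sin y1) by lra.
by rewrite E mulr_ge0 ?(ltW t0)// mulr_ge0//; lra.
Qed.

Lemma hroot_uniq_lip y y' : - (pi / 2) <= y <= pi / 2 -> - (pi / 2) <= y' <= pi / 2 ->
  `|y - y'| <= `|(y + T * sin y) - (y' + T * sin y')|.
Proof.
move=> /andP[h1 h2] /andP[h3 h4].
have [le|/ltW le] := leP y y'.
  rewrite distrC [leRHS]distrC ger0_norm ?subr_ge0//.
  by apply: le_trans (ler_norm _); exact: hslope.
rewrite ger0_norm ?subr_ge0//.
by apply: le_trans (ler_norm _); exact: hslope.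
Qed.

Lemma hroot_lip x x' : `|hroot x - hroot x'| <= `|x - x'|.
Proof.
have [h E] := hrootP x; have [h' E'] := hrootP x'.
apply: (le_trans (hroot_uniq_lip _ _ h h')); rewrite E E'; exact: clamp_lip.
Qed.

Lemma hroot0 : hroot 0 = 0.
Proof.
have p0 := pi0; have t0 := T0.
have [h E] := hrootP 0.
rewrite clamp_id in E; last by lra.
have := hroot_uniq_lip _ 0 h ltac:(lra).
rewrite E sin0 mulr0 addr0 subrr normr0 subr0 => h0.
by apply/eqP; rewrite -normr_le0.
Qed.

Definition hw x : R := sin (hroot x).

Lemma hw_lip x x' : `|hw x - hw x'| <= `|x - x'|.
Proof. exact: le_trans (sin_lip _ _ _) (hroot_lip _ _). Qed.

Lemma hrootN x : hroot (- x) = - hroot x.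
Proof.
have [h E] := hrootP x; have [h' E'] := hrootP (- x).
apply/eqP; rewrite -subr_eq0 -normr_le0.
apply: le_trans (hroot_uniq_lip _ _ h' _) _; first by case/andP: h => *; lra.
rewrite E' sinN mulrN -opprD E clampN ?subrr ?normr0//.
by move: pi0 T0; lra.
Qed.

Lemma hwN x : hw (- x) = - hw x. Proof. by rewrite /hw hrootN sinN. Qed.

Lemma hw_range x : 0 <= x -> 0 <= hw x <= 1.
Proof.
move=> x0; have p0 := pi0; have t0 := T0.
have [/andP[h1 h2] E] := hrootP x.
have c0 : 0 <= clamp R (- (pi / 2 + T)) (pi / 2 + T) x.
  by rewrite /clamp le_max le_min x0 andbT; apply/orP; right; lra.
have y0 : 0 <= hroot x.
  rewrite leNgt; apply/negP => yn.
  have := hslope _ 0 h1 ltac:(lra) (ltW yn); rewrite sin0 E; lra.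
rewrite /hw sin_le1 andbT; apply: sin_ge0_pi; lra.
Qed.

Definition hden x := 1 + T * cos (hroot x).

Lemma hden_ge1 x : 1 <= hden x.
Proof.
have [h _] := hrootP x; have c := hcos0 _ h.
by rewrite /hden lerDl mulr_ge0// ltW.
Qed.

Lemma is_derive_hroot x : `|x| < pi / 2 + T -> is_derive x (1 : R) hroot (hden x)^-1.
Proof.
move=> xX; have t0 := T0; have d0 : 0 < pi / 2 + T - `|x| by rewrite subr_gt0.
apply: (@is_derive_quad _ _ _ _ T (pi / 2 + T - `|x|)) => // k hk.
have xk : `|x + k| <= pi / 2 + T by apply: (le_trans (ler_normD _ _)); lra.
have [g E] := hrootP x; have [g' E'] := hrootP (x + k).
rewrite clamp_id in E; last by rewrite -ler_norml ltW.
rewrite clamp_id in E'; last by rewrite -ler_norml.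
have := hroot_lip (x + k) x; rewrite (_ : x + k - x = k); last by ring.
move: (hden_ge1 x) E E' (sin_taylor1 _ (hroot (x + k)) (hroot x)).
rewrite /hden; set A := 1 + _; move=> mA E E'.
move: (hroot (x + k)) (hroot x) (cos (hroot x)) @A mA E E' => y2 y1 C1 A mA E E'.
set rem := sin y2 - sin y1 - C1 * (y2 - y1) => Hrem Hlip.
have A0 : 0 < A by exact: lt_le_trans mA.
have -> : y2 - y1 - A^-1 * k = - (T / A) * rem.
  have -> : k = A * (y2 - y1) + T * rem by rewrite /rem /A; lra.
  by field; rewrite gt_eqF.
have Hy : (y2 - y1) ^+ 2 <= k ^+ 2.
  by rewrite -real_normK ?num_real// -[k ^+ 2]real_normK ?num_real// ler_sqr ?nnegrE.
rewrite normrM normrN (ger0_norm (_ : 0 <= T / A)); last by rewrite divr_ge0// ltW.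
apply: ler_pM => //; first by rewrite divr_ge0// ltW.
  by rewrite ler_pdivrMr// ler_peMr// ltW.
exact: le_trans Hrem Hy.
Qed.
End kroot.

Section diffpoly.
(* dp d M f: f is a polynomial of degree at most d, with coefficients of
   absolute sum at most M, in functions gen i bounded by 2, the derivatives of
   which are again such polynomials, of degree 5 and norm K. *)
Variables (R : realType) (I : Type) (gen : I -> R -> R) (K : R).
Hypothesis K0 : 0 <= K.

Inductive dp : nat -> R -> (R -> R) -> Prop :=
| dp_gen i : dp 1 1 (gen i)
| dp_const d (M c : R) : `|c| <= M -> dp d M (fun=> c)
| dp_mul d1 d2 M1 M2 f g : dp d1 M1 f -> dp d2 M2 g -> dp (d1 + d2) (M1 * M2) (fun x => f x * g x)
| dp_add d M1 M2 f g : dp d M1 f -> dp d M2 g -> dp d (M1 + M2) (fun x => f x + g x)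
| dp_weak d d' M M' f : (d <= d')%N -> M <= M' -> dp d M f -> dp d' M' f.

Lemma dp_ge0 d M f : dp d M f -> 0 <= M.
Proof.
elim=> //.
- by move=> d' M' c h; exact: le_trans h.
- by move=> *; rewrite mulr_ge0.
- by move=> *; rewrite addr_ge0.
- by move=> *; apply: le_trans; eassumption.
Qed.

Lemma dp_bound d M f x : (forall i, `|gen i x| <= 2) -> dp d M f -> `|f x| <= M * 2 ^+ d.
Proof.
move=> gB; elim=> {d M f}.
- by move=> i; rewrite mul1r expr1.
- move=> d M c h; apply: (le_trans h); rewrite ler_peMr//; first exact: le_trans h.
  by rewrite exprn_ege1//; lra.
- move=> d1 d2 M1 M2 f g _ h1 _ h2.
  rewrite exprD mulrACA; exact: norm_mul_le.
- by move=> d M1 M2 f g _ h1 _ h2; rewrite mulrDl; exact: norm_add_le.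
- move=> d d' M M' f dd MM Hf h; apply: (le_trans h); apply: ler_pM => //.
  + exact: dp_ge0 Hf.
  + by rewrite ler_weXn2l//; lra.
Qed.

Variable r : R.
Hypothesis gen_derive : forall i, exists2 g', dp 5 K g' &
  forall x, `|x| < r -> is_derive x (1 : R) (gen i) (g' x).

Lemma dp_derive d M f : dp d M f -> exists2 f', dp (d + 4) (d%:R * K * M) f' &
  forall x, `|x| < r -> is_derive x (1 : R) f (f' x).
Proof.
elim=> {d M f}.
- by move=> i; have [g' h1 h2] := gen_derive i; exists g' => //; rewrite mul1r mulr1.
- move=> d M c h; exists (fun=> 0); last by move=> x _; exact: is_derive_const.
  by apply: dp_const; rewrite normr0 !mulr_ge0//; exact: le_trans h.
- move=> d1 d2 M1 M2 f g Hf [f' h1 h2] Hg [g' k1 k2].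
  exists (fun x => f' x * g x + f x * g' x); last first.
    by move=> x xr; apply: is_derive_mul; [exact: h2 | exact: k2].
  rewrite natrD (_ : (d1%:R + d2%:R) * K * (M1 * M2) = (d1%:R * K * M1) * M2 + M1 * (d2%:R * K * M2)); last by ring.
  apply: dp_add; first by rewrite addnAC; exact: dp_mul.
  by rewrite -addnA; exact: dp_mul.
- move=> d M1 M2 f g Hf [f' h1 h2] Hg [g' k1 k2].
  exists (fun x => f' x + g' x); last first.
    by move=> x xr; exact: (is_deriveD (h2 x xr) (k2 x xr)).
  by rewrite mulrDr; exact: dp_add.
- move=> d d' M M' f dd MM Hf [f' h1 h2]; exists f' => //.
  apply: dp_weak h1; first by rewrite leq_add2r.
  have M0 := dp_ge0 _ _ _ Hf.
  by rewrite -!mulrA; apply: ler_pM => //; rewrite ?mulr_ge0 ?ler_nat// ler_wpM2l.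
Qed.

Lemma dp_family f : dp 1 1 f -> exists F : nat -> R -> R, [/\ F 0%N = f,
  (forall n, dp (1 + 4 * n) ((5 * K) ^+ n * n`!%:R) (F n)) &
  forall n x, `|x| < r -> is_derive x (1 : R) (F n) (F n.+1 x)].
Proof.
move=> Hf.
have H (x : nat * R * (R -> R)) : exists f', dp x.1.1 x.1.2 x.2 ->
    dp (x.1.1 + 4) (x.1.1%:R * K * x.1.2) f' /\ (forall z, `|z| < r -> is_derive z (1 : R) x.2 (f' z)).
  have [h|h] := pselect (dp x.1.1 x.1.2 x.2); last by exists x.2.
  by have [f' h1 h2] := dp_derive _ _ _ h; exists f'.
have [D HD] := choice H.
pose N n := ((1 + 4 * n)%N, (5 * K) ^+ n * n`!%:R : R).
pose F := fix F n := if n is n'.+1 then D (N n', F n') else f.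
have HF n : dp (1 + 4 * n) ((5 * K) ^+ n * n`!%:R) (F n).
  elim: n => [|n IH]; first by rewrite muln0 expr0 mul1r.
  have [h _] := HD (N n, F n) IH.
  apply: dp_weak h => /=; first by rewrite mulnS addnCA addnC.
  rewrite exprS factS natrM.
  have c0 : 0 <= (5 * K) ^+ n * n`!%:R by rewrite mulr_ge0// exprn_ge0// mulr_ge0.
  have -> : 5 * K * (5 * K) ^+ n * (n.+1%:R * n`!%:R) = (5 * n.+1%:R * K) * ((5 * K) ^+ n * n`!%:R) by ring.
  apply: ler_wpM2r => //; apply: ler_wpM2r => //.
  by rewrite natrD natrM -natr1; have := ler0n R n; lra.
exists F; split=> // n x xr.
by have [_ h] := HD (N n, F n) (HF n); exact: h.
Qed.
End diffpoly.

Section taylor.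
Variable R : realType.

Lemma is_derive_pow (n : nat) (x : R) :
  is_derive x (1 : R) (fun s : R => s ^+ n.+1) (n.+1%:R * x ^+ n).
Proof.
have idd : is_derive x (1 : R) (fun s : R => s) 1.
  apply: (@is_derive_quad _ _ _ _ 0 1) => // h _.
  by rewrite (_ : _ - _ - _ = 0) ?normr0 ?mul0r//; ring.
elim: n => [|n IH].
  have -> : (fun s : R => s ^+ 1) = (fun s => s) by apply/funext => s; rewrite expr1.
  by rewrite expr0 mulr1.
have -> : (fun s : R => s ^+ n.+2) = (fun s => s * s ^+ n.+1).
  by apply/funext => s; rewrite exprS.
apply: (is_derive_eq (is_derive_mul R _ _ _ _ _ idd IH)).
by rewrite -[n.+2%:R]natr1 exprS; ring.
Qed.

Lemma fact_cancel (n : nat) (c z : R) :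
  c / n.+1`!%:R * (n.+1%:R * z) = c * z / n`!%:R.
Proof.
have n0 : n.+1%:R != 0 :> R by rewrite pnatr_eq0.
have f0 : n`!%:R != 0 :> R by rewrite pnatr_eq0 -lt0n fact_gt0.
rewrite factS natrM; move: (n.+1%:R : R) (n`!%:R : R) n0 f0 => p q n0 f0.
by field; rewrite n0 f0.
Qed.

Lemma derive_cmp (f f' : R -> R) (c : R) (n : nat) (t : R) : 0 <= t ->
  f 0 = 0 -> (forall s : R, 0 <= s <= t -> is_derive s (1 : R) f (f' s)) ->
  (forall s : R, 0 <= s <= t -> `|f' s| <= c * s ^+ n / n`!%:R) ->
  `|f t| <= c * t ^+ n.+1 / n.+1`!%:R.
Proof.
move=> t0 f0 Hd Hb.
have pw := is_derive_pow n.
have key (sg : R) : sg * sg = 1 -> sg * f t <= c * t ^+ n.+1 / n.+1`!%:R.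
  move=> sg1.
  pose g s := c / n.+1`!%:R * s ^+ n.+1 + (- sg) * f s.
  have Hg s : 0 <= s <= t -> is_derive s (1 : R) g (c / n.+1`!%:R * (n.+1%:R * s ^+ n) + (- sg) * f' s).
    move=> st; have h1 := is_derive_cstmul R _ (c / n.+1`!%:R) _ _ (pw s).
    have h2 := is_derive_cstmul R _ (- sg) _ _ (Hd s st).
    exact: (is_deriveD h1 h2).
  have gd (x : R) : x \in `]0, t[ ->
      is_derive x (1 : R) g (c / n.+1`!%:R * (n.+1%:R * x ^+ n) + (- sg) * f' x).
    by rewrite in_itv /= => /andP[h1 h2]; apply: Hg; rewrite (ltW h1) (ltW h2).
  have gc : {within `[0, t], continuous g}.
    apply: derivable_within_continuous => x; rewrite in_itv /= => xt.
    by have [] := Hg x xt.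
  have [x xt E] := MVT_segment t0 gd gc.
  rewrite in_itv /= in xt.
  have g0 : g 0 = 0 by rewrite /g f0 expr0n /= !mulr0 addr0.
  rewrite g0 !subr0 in E.
  have hx : 0 <= c / n.+1`!%:R * (n.+1%:R * x ^+ n) + (- sg) * f' x.
    have -> : c / n.+1`!%:R * (n.+1%:R * x ^+ n) = c * x ^+ n / n`!%:R.
      exact: fact_cancel.
    have h1 : `|sg * f' x| <= c * x ^+ n / n`!%:R.
      rewrite normrM (_ : `|sg| = 1) ?mul1r; first exact: Hb.
      apply/eqP; rewrite -(@eqrXn2 _ 2)// expr1n real_normK ?num_real// expr2 sg1//.
    by have := ler_norm (sg * f' x); lra.
  have : 0 <= g t by rewrite E mulr_ge0.
  rewrite /g; have -> : c / n.+1`!%:R * t ^+ n.+1 = c * t ^+ n.+1 / n.+1`!%:R by ring.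
  lra.
rewrite ler_norml; apply/andP; split.
  by have := key (- 1) ltac:(lra); lra.
by have := key 1 ltac:(lra); lra.
Qed.

Lemma taylor01 (n : nat) : forall (F : nat -> R -> R) (B : R),
  (forall (k : nat) (s : R), 0 <= s <= 1 -> is_derive s (1 : R) (F k) (F k.+1 s)) ->
  (forall s : R, 0 <= s <= 1 -> `|F n s| <= B) ->
  forall s : R, 0 <= s <= 1 ->
  `|F 0%N s - \sum_(k < n) F k 0 / k`!%:R * s ^+ k| <= B * s ^+ n / n`!%:R.
Proof.
elim: n => [|n IH] F B HF HB s s01.
  by rewrite big_ord0 subr0 expr0 mulr1 divr1; exact: HB.
have IH' := IH (fun k => F k.+1) B (fun k => HF k.+1) HB.
apply: (@derive_cmp (fun s => F 0%N s - \sum_(k < n.+1) F k 0 / k`!%:R * s ^+ k)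
  (fun s => F 1%N s - \sum_(k < n) F k.+1 0 / k`!%:R * s ^+ k)).
- by case/andP: s01.
- rewrite big_ord_recl /= expr0 mulr1 divr1 big1 ?addr0 ?subrr// => i _.
  by rewrite expr0n /= mulr0.
- move=> x xs; have x01 : 0 <= x <= 1 by case/andP: xs => h1 h2; case/andP: s01 => *; apply/andP; split; lra.
  apply: (is_deriveB (HF 0%N x x01)).
  have sumd m : is_derive x (1 : R) (fun s : R => \sum_(k < m.+1) F k 0 / k`!%:R * s ^+ k)
      (\sum_(k < m) F k.+1 0 / k`!%:R * x ^+ k).
    elim: m => [|m IHm].
      rewrite big_ord0.
      have -> : (fun s : R => \sum_(k < 1) F k 0 / k`!%:R * s ^+ k) = fun=> F 0%N 0.
        by apply/funext => z; rewrite big_ord_recl big_ord0 /= expr0 mulr1 divr1 addr0.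
      exact: is_derive_const.
    have -> : (fun s : R => \sum_(k < m.+2) F k 0 / k`!%:R * s ^+ k) =
        (fun s : R => \sum_(k < m.+1) F k 0 / k`!%:R * s ^+ k) + (fun s => F m.+1 0 / m.+1`!%:R * s ^+ m.+1).
      by apply/funext => z; rewrite big_ord_recr.
    rewrite big_ord_recr /=.
    apply: (is_deriveD IHm).
    have := is_derive_cstmul R _ (F m.+1 0 / m.+1`!%:R) _ _ (is_derive_pow m x).
    by move=> H; apply: (is_derive_eq H); rewrite fact_cancel mulrAC.
  exact: sumd.
- move=> x xs; apply: IH'; case/andP: xs => h1 h2; case/andP: s01 => *; apply/andP; split; lra.
Qed.
End taylor.

Section series.
Variables (R : realType) (T a : R).
Hypotheses (piT : pi < T) (a0 : 0 <= a <= pi).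
Let pi0 := pi_gt0 R.
Let T0 : 0 < T := lt_trans pi0 piT.

Inductive gidx := gS | gC | gD | gE | gI.

Definition gen (i : gidx) (x : R) : R :=
  match i with
  | gS => sin (hroot R T (a + asin x))
  | gC => cos (hroot R T (a + asin x))
  | gD => (hden R T (a + asin x))^-1
  | gE => (cos (asin x))^-1
  | gI => x
  end.

Let cas (x : R) : `|x| < 1 -> 0 < cos (asin x).
Proof.
rewrite ltr_norml => /andP[x1 x2]; apply: cos_gt0_pihalf.
by rewrite asin_gtNpi2 ?asin_ltpi2 ?x1 ?x2 ?(ltW x1) ?(ltW x2).
Qed.

Let Dasin (x : R) : `|x| < 1 -> is_derive x (1 : R) asin (gen gE x).
Proof.
rewrite ltr_norml => xx; rewrite /gen cos_asin; last by case/andP: xx => *; rewrite !ltW.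
exact: is_derive1_asin.
Qed.

Let DY (x : R) : `|x| < 1 -> is_derive x (1 : R) (fun x => hroot R T (a + asin x)) (gen gD x * gen gE x).
Proof.
move=> x1; have Da : is_derive x (1 : R) (fun x => a + asin x) (gen gE x).
  by rewrite -[gen gE x]add0r; apply: (is_deriveD (is_derive_const R a x) (Dasin _ x1)).
apply: (@is_derive1_comp R (hroot R T) (fun x => a + asin x)).
apply: is_derive_hroot => //.
move: x1; rewrite ltr_norml => /andP[x1 x2].
have b1 : - (pi / 2) < asin x by rewrite asin_gtNpi2// x1 ltW.
have b2 : asin x < pi / 2 by rewrite asin_ltpi2// x2 ltW.
by rewrite ltr_norml; move: pi0 piT a0 => p0 pT /andP[a1 a2]; apply/andP; split; lra.
Qed.

Local Notation dp := (dp R gidx gen).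

Let dp1 i : dp 1 1 (gen i). Proof. exact: dp_gen. Qed.

Lemma gen_derive i : exists2 g', dp 5 T g' &
  forall x : R, `|x| < 1 -> is_derive x (1 : R) (gen i) (g' x).
Proof.
have T1 : 1 <= T by have := pi_ge2 R; move: piT; lra.
have YS (x : R) : `|x| < 1 -> is_derive x (1 : R) (gen gS) (gen gC x * (gen gD x * gen gE x)).
  by move=> x1; apply: (@is_derive1_comp R sin (fun x => hroot R T (a + asin x))); exact: DY.
have YC (x : R) : `|x| < 1 -> is_derive x (1 : R) (gen gC) (- gen gS x * (gen gD x * gen gE x)).
  by move=> x1; apply: (@is_derive1_comp R cos (fun x => hroot R T (a + asin x))); exact: DY.
have w1 d f : (d <= 5)%N -> dp d 1 f -> dp 5 T f by move=> d5; exact: dp_weak.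
have one2 : 1 * 1 = 1 :> R by rewrite mulr1.
have dde : dp 2 1 (fun x => gen gD x * gen gE x).
  by rewrite -[X in dp _ X]one2; exact: (dp_mul _ _ _ 1 1 1 1 _ _ (dp1 gD) (dp1 gE)).
case: i.
- exists (fun x => gen gC x * (gen gD x * gen gE x)) => //.
  apply: (w1 3) => //; rewrite -[X in dp _ X]one2.
  exact: (dp_mul _ _ _ 1 2 1 1 _ _ (dp1 gC) dde).
- exists (fun x => (-1) * (gen gS x * (gen gD x * gen gE x))).
    apply: (w1 3) => //; rewrite -[X in dp _ X]one2.
    apply: (dp_mul _ _ _ 0 3 1 1 (fun=> -1)).
      by apply: dp_const; rewrite normrN normr1.
    rewrite -[X in dp _ X]one2.
    exact: (dp_mul _ _ _ 1 2 1 1 _ _ (dp1 gS) dde).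
  by move=> x x1; apply: (is_derive_eq (YC x x1)); ring.
- exists (fun x => T * (gen gS x * (gen gD x * (gen gD x * (gen gD x * gen gE x))))).
    rewrite -[X in dp _ X]mulr1.
    apply: (dp_mul _ _ _ 0 5 T 1 (fun=> T)).
      by apply: dp_const; rewrite ger0_norm// ltW.
    have d3 : dp 3 1 (fun x => gen gD x * (gen gD x * gen gE x)).
      by rewrite -[X in dp _ X]one2; exact: (dp_mul _ _ _ 1 2 1 1 _ _ (dp1 gD) dde).
    have d4 : dp 4 1 (fun x => gen gD x * (gen gD x * (gen gD x * gen gE x))).
      by rewrite -[X in dp _ X]one2; exact: (dp_mul _ _ _ 1 3 1 1 _ _ (dp1 gD) d3).
    by rewrite -[X in dp _ X]one2; exact: (dp_mul _ _ _ 1 4 1 1 _ _ (dp1 gS) d4).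
  move=> x x1.
  have Dh : is_derive x (1 : R) (fun x => hden R T (a + asin x)) (T * (- gen gS x * (gen gD x * gen gE x))).
    rewrite -[T * _]add0r.
    exact: (is_deriveD (is_derive_const R 1 x) (is_derive_cstmul R _ T _ _ (YC x x1))).
  have h0 : hden R T (a + asin x) != 0.
    by rewrite gt_eqF// (lt_le_trans ltr01)// hden_ge1.
  apply: (is_derive_eq (@is_deriveV R (fun x => hden R T (a + asin x)) x _ 1 h0 Dh)).
  rewrite /GRing.scale /= /gen; field.
  by rewrite h0 gt_eqF// cas.
- exists (fun x => gen gI x * (gen gE x * (gen gE x * gen gE x))).
    apply: (w1 4) => //.
    have d2 : dp 2 1 (fun x => gen gE x * gen gE x).
      by rewrite -[X in dp _ X]one2; exact: (dp_mul _ _ _ 1 1 1 1 _ _ (dp1 gE) (dp1 gE)).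
    have d3 : dp 3 1 (fun x => gen gE x * (gen gE x * gen gE x)).
      by rewrite -[X in dp _ X]one2; exact: (dp_mul _ _ _ 1 2 1 1 _ _ (dp1 gE) d2).
    by rewrite -[X in dp _ X]one2; exact: (dp_mul _ _ _ 1 3 1 1 _ _ (dp1 gI) d3).
  move=> x x1.
  have Dc : is_derive x (1 : R) (fun x => cos (asin x)) (- sin (asin x) * gen gE x).
    by apply: (@is_derive1_comp R cos asin); exact: Dasin.
  have c0 : cos (asin x) != 0 by rewrite gt_eqF// cas.
  apply: (is_derive_eq (@is_deriveV R (fun x => cos (asin x)) x _ 1 c0 Dc)).
  rewrite asinK; last by rewrite in_itv /=; move: x1; rewrite ltr_norml => /andP[*]; rewrite !ltW.
  by rewrite /GRing.scale /= /gen; field.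
- exists (fun=> 1).
    by apply: (w1 0%N) => //; apply: dp_const; rewrite normr1.
  move=> x _; apply: (@is_derive_quad _ _ _ _ 0 1) => // h _.
  by rewrite /= (_ : _ - _ - _ = 0) ?normr0 ?mul0r//; ring.
Qed.

Lemma gen_le2 i (x : R) : `|x| <= 1 / 2 -> `|gen i x| <= 2.
Proof.
move=> x1; have x1' : `|x| < 1 by lra.
case: i => /=.
- by apply: (le_trans (sin_max _)); lra.
- by apply: (le_trans (cos_max _)); lra.
- have h := hden_ge1 R T piT (a + asin x).
  have h' := lt_le_trans ltr01 h.
  rewrite normfV gtr0_norm//; apply: (@le_trans _ _ 1); last lra.
  by rewrite invf_le1.
- have c0 := cas _ x1'; rewrite normfV gtr0_norm//.
  have c2 : cos (asin x) ^+ 2 = 1 - x ^+ 2.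
    rewrite cos2sin2 asinK// in_itv /=.
    by move: x1; rewrite ler_norml => /andP[*]; apply/andP; split; lra.
  have x2 : x ^+ 2 <= (1 / 2) ^+ 2.
    by rewrite -real_normK ?num_real// ler_sqr ?nnegrE//; lra.
  rewrite invf_ple ?posrE//; nra.
- by apply: (le_trans x1); lra.
Qed.

Definition rho : R := (80 * T)^-1.

Lemma rho_gt0 : 0 < rho. Proof. by rewrite invr_gt0 mulr_gt0. Qed.

Lemma hw_series : exists c : nat -> R, (forall k, `|c k| <= 2) /\
  forall (n : nat) (tau : R), `|tau| <= 1 / 2 ->
  `|hw R T (a + asin (rho * tau)) - \sum_(k < n) c k * tau ^+ k| <= 2 * (1 / 2) ^+ n.
Proof.
have [F [F0 dpF DF]] := dp_family R gidx gen T (ltW T0) 1 gen_derive _ (dp1 gS).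
have t0 := T0; have r0 := rho_gt0.
have r1 : rho <= 1 / 2.
  rewrite /rho invf_ple ?posrE ?mulr_gt0//; have := pi_ge2 R; move: piT; lra.
have FB n (x : R) : `|x| <= 1 / 2 -> `|F n x| * rho ^+ n <= 2 * n`!%:R.
  move=> x1; have := dp_bound R gidx gen _ _ _ x (fun i => gen_le2 i x x1) (dpF n).
  move=> /(ler_wpM2r (exprn_ge0 n (ltW r0))) /le_trans; apply.
  rewrite exprD expr1 exprM (_ : 2 ^+ 4 = 16); last by ring.
  have -> : (5 * T) ^+ n * n`!%:R * (2 * 16 ^+ n) * rho ^+ n = 2 * n`!%:R * ((5 * T) * 16 * rho) ^+ n.
    by rewrite !exprMn; ring.
  rewrite (_ : 5 * T * 16 * rho = 1) ?expr1n ?mulr1//.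
  by rewrite /rho; field; rewrite gt_eqF.
have fn (n : nat) : 0 < n`!%:R :> R by rewrite ltr0n fact_gt0.
exists (fun k => rho ^+ k * F k 0 / k`!%:R); split.
  move=> k; rewrite !normrM normfV (gtr0_norm (fn k)) ler_pdivrMr//.
  rewrite (ger0_norm (exprn_ge0 _ (ltW r0))) mulrC; apply: FB; rewrite normr0; lra.
move=> n tau tau1.
pose al := rho * tau.
have al1 : `|al| <= 1 / 2.
  rewrite normrM (gtr0_norm r0); have := normr_ge0 tau; nra.
have als (s : R) : 0 <= s <= 1 -> `|al * s + 0| <= 1 / 2.
  move=> /andP[s0 s1]; rewrite addr0 normrM (ger0_norm s0).
  by apply: le_trans al1; rewrite ler_piMr.
pose G k (s : R) := al ^+ k * F k (al * s + 0).
have := @taylor01 R n G (2 * n`!%:R * (1 / 2) ^+ n) _ _ 1.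
rewrite ler01 lexx => /(_ _ _ isT) H.
have E0 : G 0%N 1 = hw R T (a + asin (rho * tau)) by rewrite /G expr0 mul1r F0 mulr1 addr0.
have ES : \sum_(k < n) G k 0 / k`!%:R * 1 ^+ k = \sum_(k < n) rho ^+ k * F k 0 / k`!%:R * tau ^+ k.
  apply: eq_bigr => k _; rewrite /G expr1n mulr1 mulr0 addr0 /al exprMn; ring.
rewrite E0 ES in H; apply: (le_trans (H _ _)).
- move=> k s s01; rewrite /G.
  have h21 : 1 / 2 < 1 :> R by lra.
  have D1 := DF k (al * s + 0) (le_lt_trans (als _ s01) h21).
  have D2 := is_derive_affine R (F k) al 0 s _ D1.
  by apply: (is_derive_eq (is_derive_cstmul R _ (al ^+ k) _ _ D2)); rewrite exprSr mulrA.
- move=> s s01; rewrite /G normrM normrX /al normrM (gtr0_norm r0) exprMn.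
  have h1 := FB n _ (als _ s01).
  have h2 : `|tau| ^+ n <= (1 / 2) ^+ n by apply: lerXn2r; rewrite ?nnegrE//.
  rewrite mulrC mulrA.
  have p1 : 0 <= `|F n (al * s + 0)| * rho ^+ n by rewrite mulr_ge0// exprn_ge0// ltW.
  have p2 : 0 <= `|tau| ^+ n by rewrite exprn_ge0.
  exact: ler_pM.
rewrite expr1n mulr1 le_eqVlt; apply/orP; left; apply/eqP.
by field; rewrite gt_eqF.
Qed.
End series.

Section pieces.
Variables (R : realType).
Implicit Types (h al be : R).

Lemma clamp_sin h be : 0 < h <= pi / 2 -> `|be| <= pi - h ->
  clamp R (- sin h) (sin h) (sin be) = sin (clamp R (- h) h be).
Proof.
move=> /andP[h0 hp].
have p0 := pi_gt0 R.
have smono (x z : R) : - (pi / 2) <= x -> x <= z -> z <= pi / 2 -> sin x <= sin z.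
  move=> h1 h2 h3; have [c cc E] := MVT_le _ _ _ _ _ h2 (@is_derive_sin R).
  have c0 : 0 <= cos c by apply: cos_ge0_pihalf; lra.
  by rewrite -subr_ge0 E mulr_ge0// subr_ge0.
have sh : 0 <= sin h by apply: sin_ge0_pi; lra.
wlog b0 : be / 0 <= be => [W hb|].
  have [b0|/ltW b0] := leP 0 be; first exact: W.
  rewrite -[be]opprK sinN clampN// (clampN _ _ _ (ltW h0)) sinN; congr (- _).
  by apply: W; rewrite ?oppr_ge0 ?normrN.
rewrite ger0_norm// => bp.
have [bh|hb] := leP be h.
  rewrite (clamp_id _ _ _ be); last by lra.
  rewrite clamp_id//; apply/andP; split.
    by rewrite -sinN; apply: smono; lra.
  by apply: smono; lra.
have -> : clamp R (- h) h be = h.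
  by rewrite /clamp (min_l (ltW hb)) max_r//; lra.
have sb : sin h <= sin be.
  have [b2|b2] := leP be (pi / 2); first by apply: smono; lra.
  have -> : sin be = sin (pi - be) by rewrite sinB sinpi cospi mul0r; lra.
  by apply: smono; lra.
by rewrite /clamp (min_l sb) max_r//; lra.
Qed.

Lemma hw_pieces T h al (piT : pi < T) (J : nat) : 0 < h -> 0 <= al ->
  \sum_(j < J) (hw R T ((2 * j%:R + 1) * h + clamp R (- h) h (al - (2 * j%:R + 1) * h))
     - hw R T (2 * j%:R * h)) = hw R T (Num.min al (2 * J%:R * h)).
Proof.
move=> h0 al0; elim: J => [|J IH].
  by rewrite big_ord0 mulr0 mul0r min_r// /hw hroot0// sin0.
rewrite big_ord_recr /= IH.
have J0 := ler0n R J.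
have Jh : 0 <= J%:R * h by rewrite mulr_ge0// ltW.
have [h1|h1] := leP al (2 * J%:R * h).
  rewrite (min_l (_ : al <= 2 * J.+1%:R * h)); last by rewrite -natr1; lra.
  rewrite /clamp min_r; last lra.
  rewrite max_l; last lra.
  by rewrite (_ : (2 * J%:R + 1) * h + - h = 2 * J%:R * h) ?subrr ?addr0//; ring.
rewrite addrC subrK; congr (hw R T _).
have [h2|h2] := leP al (2 * J.+1%:R * h).
  rewrite clamp_id; first by ring.
  by rewrite -natr1 in h2; apply/andP; split; lra.
rewrite /clamp min_l; last by rewrite -natr1 in h2; lra.
by rewrite max_r; [rewrite -natr1; ring | lra].
Qed.
End pieces.

(** * ReLU programs as Fourier neural operators *)

Section relu_programs.
Variable R : realType.

Definition relu (x : R) : R := Num.max x 0.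
Notation hid := #|{: 'I_9 * 'I_8}|.
Notation state := 'cV[R]_9.
Notation block := ('M[R]_(9, hid) * 'M[R]_(hid, 9) * 'cV[R]_hid)%type.

Definition mk (l : seq R) : state := \col_i nth 0 l i.
Definition rg (r : state) (k : nat) : R := r (inord k) ord0.

Lemma rg_mk l k : (k < 9)%N -> rg (mk l) k = nth 0 l k.
Proof. by move=> k9; rewrite /rg mxE inordK. Qed.

Definition step (b : block) (r : state) : state := b.1.1 *m relu_mx (b.1.2 *m r + b.2).
Definition Blk (f : state -> state) := exists b, forall r, f r = step b r.
Definition Prog (n : nat) (F : state -> state) :=
  exists bs : seq block, size bs = n /\ forall r, F r = foldl (fun r b => step b r) r bs.

Lemma Prog_id : Prog 0 id. Proof. by exists [::]. Qed.

Lemma Prog_blk f : Blk f -> Prog 1 f.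
Proof. by move=> [b Hb]; exists [:: b]. Qed.

Lemma Prog_comp n k F G : Prog n F -> Prog k G -> Prog (n + k) (G \o F).
Proof.
move=> [bs [sb Hb]] [cs [sc Hc]]; exists (bs ++ cs); split; first by rewrite size_cat sb sc.
by move=> r; rewrite foldl_cat /= Hc Hb.
Qed.

Definition aff (g : state -> R) := exists (b : 'rV[R]_9) (c : R),
  forall r, g r = (b *m r) ord0 ord0 + c.

Lemma aff_rg k : aff (fun r => rg r k).
Proof.
exists (delta_mx ord0 (inord k)), 0 => r; rewrite addr0 -rowE.
by rewrite mxE.
Qed.

Lemma aff_cst c : aff (fun=> c).
Proof. by exists 0, c => r; rewrite mul0mx mxE add0r. Qed.

Lemma aff_add f g : aff f -> aff g -> aff (fun r => f r + g r).
Proof.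
move=> [b [c H]] [b' [c' H']]; exists (b + b'), (c + c') => r.
by rewrite H H' mulmxDl [in RHS]mxE; ring.
Qed.

Lemma aff_scale k f : aff f -> aff (fun r => k * f r).
Proof.
move=> [b [c H]]; exists (k *: b), (k * c) => r.
by rewrite H -scalemxAl [in RHS]mxE; ring.
Qed.

Lemma aff_opp f : aff f -> aff (fun r => - f r).
Proof.
move=> Hf; have := aff_scale (-1) _ Hf.
by congr aff; apply/funext => r; rewrite mulN1r.
Qed.

Notation term := (R * 'rV[R]_9 * R)%type.
Definition tval (t : term) (r : state) : R := t.1.1 * relu ((t.1.2 *m r) ord0 ord0 + t.2).
Definition pl (e : nat) (g : state -> R) := exists s : seq term,
  size s = e /\ forall r, g r = \sum_(t <- s) tval t r.

Lemma pl_relu g : aff g -> pl 1 (fun r => relu (g r)).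
Proof.
move=> [b [c H]]; exists [:: (1, b, c)]; split=> // r.
by rewrite big_seq1 /tval /= mul1r H.
Qed.

Lemma pl_scale e k g : pl e g -> pl e (fun r => k * g r).
Proof.
move=> [s [se H]]; exists [seq (k * t.1.1, t.1.2, t.2) | t <- s]; split; first by rewrite size_map.
move=> r; rewrite H big_map mulr_sumr; apply: eq_bigr => t _.
by rewrite /tval /= mulrA.
Qed.

Lemma pl_add e e' g g' : pl e g -> pl e' g' -> pl (e + e') (fun r => g r + g' r).
Proof.
move=> [s [se H]] [s' [se' H']]; exists (s ++ s'); split; first by rewrite size_cat se se'.
by move=> r; rewrite H H' big_cat.
Qed.

Lemma pl_opp e g : pl e g -> pl e (fun r => - g r).
Proof.
move=> Hg; have := pl_scale _ (-1) _ Hg.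
by congr pl; apply/funext => r; rewrite mulN1r.
Qed.

Lemma reluB x : relu x - relu (- x) = x.
Proof. by rewrite /relu /Order.max; repeat case: ifP; intros; lra. Qed.

Lemma pl_aff g : aff g -> pl 2 g.
Proof.
move=> Hg; have := pl_add _ _ _ _ (pl_relu _ Hg) (pl_opp _ _ (pl_relu _ (aff_opp _ Hg))).
by congr pl; apply/funext => r; rewrite reluB.
Qed.

Lemma pl_le e e' g : (e <= e')%N -> pl e g -> pl e' g.
Proof.
move=> ee [s [se H]]; exists (s ++ nseq (e' - e) (0, 0, 0)); split.
  by rewrite size_cat size_nseq se subnKC.
move=> r; rewrite H big_cat /= [X in _ + X]big1_seq ?addr0// => t /andP[_].
by move=> /nseqP[-> _]; rewrite /tval /= mul0r.
Qed.

Lemma Blk_mk (F : state -> seq R) :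
  (forall k, (k < 9)%N -> pl 8 (fun r => nth 0 (F r) k)) -> Blk (fun r => mk (F r)).
Proof.
move=> H.
have H' (i : 'I_9) : exists s : seq term, size s = 8%N /\
    forall r, nth 0 (F r) i = \sum_(t <- s) tval t r by exact: H.
have [S HS] := choice H'.
pose tt (x : 'I_9 * 'I_8) : term := nth (0, 0, 0) (S x.1) x.2.
pose A : 'M[R]_(9, hid) := \matrix_(i, k) (if (enum_val k).1 == i then (tt (enum_val k)).1.1 else 0).
pose B : 'M[R]_(hid, 9) := \matrix_(k, j) (tt (enum_val k)).1.2 ord0 j.
pose c : 'cV[R]_hid := \col_k (tt (enum_val k)).2.
exists (A, B, c) => r; apply/matrixP => i j; rewrite ord1 mxE /step /=.
have [sz ->] := HS i.
rewrite mxE.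
pose G (x : 'I_9 * 'I_8) := (if x.1 == i then (tt x).1.1 else 0) * relu (((tt x).1.2 *m r) ord0 ord0 + (tt x).2).
have -> : \sum_j0 A i j0 * relu_mx (B *m r + c) j0 ord0 = \sum_(k < hid) G (enum_val k).
  apply: eq_bigr => k _; rewrite /G /A !mxE; congr (_ * relu (_ + _)).
  by apply: eq_bigr => l _; rewrite !mxE.
rewrite -(big_enum_val G) /=.
have -> : \sum_(x in {: 'I_9 * 'I_8}) G x = \sum_(a : 'I_9) \sum_(k : 'I_8) G (a, k).
  by rewrite pair_bigA /=; apply: eq_bigr => -[].
rewrite (bigD1 i)//= [X in _ + X]big1 ?addr0; last first.
  by move=> a ai; apply: big1 => k _; rewrite /G /= (negbTE ai) mul0r.
rewrite (big_nth (0, 0, 0)) big_mkord sz; apply: eq_bigr => k _.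
by rewrite /G /= eqxx.
Qed.

Lemma measurable_mulmx p q (A : 'M[R]_(p, q)) (s : measurableTypeR R -> 'cV[R]_q) :
  (forall i, measurable_fun setT (fun x => s x i ord0)) ->
  forall i, measurable_fun setT (fun x => (A *m s x) i ord0).
Proof.
move=> ms k.
have -> : (fun x => (A *m s x) k ord0) = (fun x => \sum_l A k l * s x l ord0).
  by apply/funext => x; rewrite mxE.
by apply: measurable_sum => l; apply: measurable_funM.
Qed.

Lemma Prog_measurable n F : Prog n F -> forall (r : measurableTypeR R -> state),
  (forall i, measurable_fun setT (fun x => r x i ord0)) ->
  forall i, measurable_fun setT (fun x => F (r x) i ord0).
Proof.
move=> [bs [_ HF]] r mr i.
have -> : (fun x => F (r x) i ord0) = (fun x => foldl (fun r b => step b r) (r x) bs i ord0).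
  by apply/funext => x; rewrite HF.
elim: bs r mr i {HF} => //= b bs IH r mr i.
apply: IH => {}i.
apply: measurable_mulmx => k.
have -> : (fun x => relu_mx (b.1.2 *m r x + b.2) k ord0) =
    (fun x => Num.max ((b.1.2 *m r x) k ord0 + b.2 k ord0) 0).
  by apply/funext => x; rewrite !mxE.
apply: measurable_funTS; apply: measurable_maxr => //.
by apply: measurable_funD => //; exact: measurable_mulmx.
Qed.
End relu_programs.

Section fno_of_prog.
Variable R : realType.
Notation hid := #|{: 'I_9 * 'I_8}|.
Notation state := 'cV[R]_9.
Notation block := ('M[R]_(9, hid) * 'M[R]_(hid, 9) * 'cV[R]_hid)%type.

Lemma sum_cos_grid (N : nat) (th : R) : (3 <= N)%N ->
  \sum_(j < N) cos (th - 2 * grid R j) = 0.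
Proof.
move=> N3; have N0 : 0 < N%:R :> R by rewrite ltr0n; case: N N3.
pose w : R := 2 * pi / N%:R.
have w0 : 0 < sin w.
  apply: sin_gt0_pi; rewrite /w divr_gt0 ?mulr_gt0 ?pi_gt0//=.
  rewrite ltr_pdivrMr// mulrC ltr_pM2l ?pi_gt0// ltr_nat//.
pose f (j : nat) : R := sin (th - 2 * (w * j%:R) - w).
have E (n : nat) : \sum_(j < n) (2 * sin w * cos (th - 2 * (w * j.+1%:R))) = f 0%N - f n.
  elim: n => [|n IH]; first by rewrite big_ord0 subrr.
  rewrite big_ord_recr /= IH; set X := th - _.
  have -> : f n = sin (X + w) by rewrite /f /X -natr1; congr sin; ring.
  have -> : f n.+1 = sin (X - w) by [].
  by rewrite sinD sinB; ring.
have := E N; rewrite -mulr_sumr.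
have -> : f 0%N - f N = 0.
  have -> : f 0%N = sin (th - 2 * (w * N%:R) - w + pi + pi + pi + pi).
    by rewrite /f /w; congr sin; field; rewrite gt_eqF.
  by rewrite !sinDpi !opprK subrr.
move/eqP; rewrite mulf_eq0 mulf_eq0 pnatr_eq0 /= (gt_eqF w0) /= => /eqP E0.
rewrite -[RHS]E0; apply: eq_bigr => j _; congr (cos (_ - 2 * _)).
by rewrite /grid /w; field; rewrite gt_eqF.
Qed.

Section construction.
Variables (L' : nat) (bs : seq block).
Hypothesis sz : size bs = L'.+1.
Let b0 : block := (0, 0, 0).
Let Bk l : block := nth b0 bs l.
Let k0 : 'I_hid := enum_rank (ord0, ord0).
Let e0 : 'cV[R]_hid := delta_mx k0 ord0.
Let zs : state := mk R [:: 1].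
Let zc : state := mk R [:: 0; 1].

Let Wl (l : nat) : 'M[R]_hid :=
  if l is l'.+1 then (Bk l).1.2 *m (Bk l').1.1 else ((Bk 0).1.2 *m zs) *m e0^T.
Let PBl (l i : nat) : 'M[R]_hid :=
  if (l == 0%N) && (i == 2%N) then 2 *: (((Bk 0).1.2 *m zc) *m e0^T) else 0.

Definition net_of : FNO R := @MkFNO R hid 1 2 L'.+1
  (\matrix_(i, j) (if j == ord0 then (if i == ord0 then 1 else -1) else 0)) 0
  (e0 *m \row_(j < 2) (if j == ord0 then 1 else -1)) 0
  (fun l => Wl l) (fun _ _ => 0) (fun l i => PBl l i)
  (fun l i => if i == 1%N :> nat then (Bk l).2 else 0) (fun _ _ => 0)
  (row ord0 (Bk L').1.1).

Variable N : nat.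
Hypothesis N3 : (3 <= N)%N.
Variable xi : R.
Local Notation z x := (x - (xi - pi)).

Let r0 (x : R) : state := mk R [:: sin (z x); cos (z x)].
Let rl (x : R) (l : nat) : state := foldl (fun r b => step R b r) (r0 x) (take l bs).

Let rlS x l : (l < L'.+1)%N -> rl x l.+1 = step R (Bk l) (rl x l).
Proof.
move=> lL; rewrite /rl (take_nth b0) ?sz// -cats1 foldl_cat //.
Qed.

Let r0E x : r0 x = sin (z x) *: zs + cos (z x) *: zc.
Proof.
apply/matrixP => i j; rewrite !mxE.
by case: i => -[|[|i]] hi /=; rewrite ?nth_nil ?mulr0 ?mulr1 ?addr0 ?add0r.
Qed.

Let e0e0 : e0^T *m e0 = 1%:M.
Proof.
by rewrite /e0 trmx_delta mul_delta_mx; apply/matrixP => i j; rewrite !ord1 !mxE.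
Qed.

Let ubarE x : ubar xi x = sin (z x).
Proof. by rewrite /ubar (_ : z x = x - xi + pi) ?sinDpi//; ring. Qed.

Let liftE x : fno_lift net_of (ubar xi x) x = sin (z x) *: e0.
Proof.
rewrite /fno_lift /= !addr0 -mulmxA ubarE.
rewrite (_ : _ *m relu_mx _ = (sin (z x))%:M); first by rewrite mul_mx_scalar.
apply/matrixP => i j; rewrite !ord1 mxE !big_ord_recl big_ord0 !mxE.
rewrite !big_ord_recl !big_ord0 !mxE /= !mul0r !addr0 !mul1r !mulN1r mulr1n.
exact: reluB.
Qed.

(* The frequency-2 part averages to 0 on a grid of at least 3 points, so the mode
   k = 1 of the first layer yields cos z without aliasing error. *)
Let beta x : N%:R^-1 * (\sum_(j < N) sin (x - grid R j) * sin (z (grid R j))) = - (cos (z x) / 2).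
Proof.
have N0 : N%:R != 0 :> R by rewrite pnatr_eq0; case: N N3.
have -> : \sum_(j < N) sin (x - grid R j) * sin (z (grid R j)) =
    \sum_(j < N) (- (cos (z x) / 2) - cos (x + xi - 2 * grid R j) / 2).
  apply: eq_bigr => j _.
  have -> : z (grid R j) = grid R j - xi + pi by ring.
  have -> : z x = (x - grid R j) + (grid R j - xi) + pi by ring.
  have -> : x + xi - 2 * grid R j = (x - grid R j) - (grid R j - xi) by ring.
  rewrite sinDpi cosDpi; move: (x - grid R j) (grid R j - xi) => A B.
  by rewrite cosD cosB; field.
have S2 : \sum_(j < N) - (cos (x + xi - 2 * grid R j) / 2) = 0.
  by rewrite sumrN -mulr_suml sum_cos_grid// mul0r oppr0.
rewrite big_split /= S2 addr0.
by rewrite sumr_const card_ord -(mulr_natl (- (cos (z x) / 2))) mulKf.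
Qed.

Let biasE (l : 'I_(fno_depth net_of)) x : fno_bias l x = (Bk l).2.
Proof.
rewrite /fno_bias /= !big_ord_recl big_ord0 /= !scaler0 !subr0 !add0r !addr0.
by rewrite /wnum /= subrr mul0r cos0 scale1r.
Qed.

Let KE (l : 'I_(fno_depth net_of)) v x : fno_K N l v x =
  - (PBl l 2 *m (N%:R^-1 *: \sum_(j < N) (sin (x - grid R j) *: v (grid R j)))).
Proof.
rewrite /fno_K /= !big_ord_recl big_ord0 /= !mul0mx !sub0r addr0.
have P0 : PBl l 0 = 0 by rewrite /PBl andbF.
have P1 : PBl l 1 = 0 by rewrite /PBl andbF.
rewrite /bump /= P0 P1 !mul0mx oppr0 !add0r.
congr (- (_ *m (_ *: _))); apply: eq_bigr => j _.
by rewrite /wnum /= (_ : 2%:R - 1%:R = 1) ?mul1r//; ring.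
Qed.

Let layer0 (l : 'I_(fno_depth net_of)) x : l = 0%N :> nat ->
  fno_layer N l (fun x => sin (z x) *: e0) x = relu_mx ((Bk 0).1.2 *m r0 x + (Bk 0).2).
Proof.
move=> l0; rewrite /fno_layer biasE KE /= l0 /PBl /=.
have -> : \sum_(j < N) (sin (x - grid R j) *: (sin (z (grid R j)) *: e0)) =
    (\sum_(j < N) sin (x - grid R j) * sin (z (grid R j))) *: e0.
  by rewrite scaler_suml; apply: eq_bigr => j _; rewrite scalerA.
rewrite scalerA beta r0E -!scalemxAr -scalemxAl -!mulmxA e0e0 !mulmx1.
rewrite scalerA (_ : - (cos (z x) / 2) * 2 = - cos (z x)); last by field.
rewrite scaleNr opprK mulmxDr -!scalemxAr; congr relu_mx.
by rewrite addrAC.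
Qed.

Let layerS (l : 'I_(fno_depth net_of)) (l' : nat) v x : l = l'.+1 :> nat ->
  fno_layer N l v x = relu_mx ((Bk l).1.2 *m ((Bk l').1.1 *m v x) + (Bk l).2).
Proof.
move=> ll; rewrite /fno_layer biasE KE /= /PBl ll /=.
by rewrite mul0mx oppr0 addr0 -mulmxA.
Qed.

Let foldl_enum (S : Type) (f : 'I_(fno_depth net_of) -> S -> S) (v : S) (P : nat -> S -> Prop) :
  P 0%N v -> (forall (l : 'I_(fno_depth net_of)) w, P l w -> P l.+1 (f l w)) ->
  P (fno_depth net_of) (foldl (fun v l => f l v) v (enum 'I_(fno_depth net_of))).
Proof.
move=> P0 PS; set L := fno_depth _ in f PS *.
have H (s : seq 'I_L) (k : nat) (w : S) : map val s = iota k (size s) -> P k w ->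
    P (k + size s)%N (foldl (fun v l => f l v) w s).
  elim: s k w => [|l s IH] k w /=; first by rewrite addn0.
  move=> [lk es] Pk; rewrite addnS -addSn; apply: IH => //.
  by rewrite -lk; apply: PS; rewrite lk.
have := H (enum 'I_L) 0%N v; rewrite val_enum_ord size_enum_ord => /(_ erefl P0).
by rewrite add0n.
Qed.

Lemma net_ofE x : fno_eval net_of N (ubar xi) x =
  rg R (foldl (fun r b => step R b r) (mk R [:: sin (z x); cos (z x)]) bs) 0.
Proof.
rewrite /fno_eval.
have -> : (fun x => fno_lift net_of (ubar xi x) x) = (fun x => sin (z x) *: e0).
  by apply/funext => t; exact: liftE.
pose P (k : nat) (v : R -> 'cV[R]_hid) := if k is k'.+1 then
   forall x, v x = relu_mx ((Bk k').1.2 *m rl x k' + (Bk k').2) else v = (fun x => sin (z x) *: e0).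
have H := @foldl_enum _ (fun l v => @fno_layer R net_of N l v) (fun x => sin (z x) *: e0) P erefl.
have {}H : P L'.+1 (foldl (fun v l => @fno_layer R net_of N l v) (fun x => sin (z x) *: e0) (enum 'I_(fno_depth net_of))).
  apply: H => l w.
  case E : (nat_of_ord l) => [|l'] /=.
    move=> -> t; rewrite (layer0 _ _ E) {1}/rl take0 //=.
  move=> Hw t; rewrite (layerS _ _ _ _ E) Hw.
  have lL : (l' < L'.+1)%N by have := ltn_ord l; rewrite E; exact: ltnW.
  by rewrite -[X in _ *m X]/(step R (Bk l') (rl t l')) -rlS// E.
rewrite /= in H; rewrite /= H.
have -> : foldl (fun r b => step R b r) (mk R [:: sin (z x); cos (z x)]) bs = rl x L'.+1.
  by rewrite /rl -sz take_size.
rewrite rlS// /rg -row_mul mxE; congr (_ _ ord0).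
by apply/val_inj; rewrite /= inordK.
Qed.

End construction.

Lemma fno_of_prog (n : nat) F : Prog R n.+1 F -> exists net : FNO R,
  [/\ fno_kmax net = 1%N, fno_dv net = hid, fno_depth net = n.+1, fno_width net = 2%N &
   forall N, (3 <= N)%N -> forall xi x : R, fno_eval net N (ubar xi) x =
     rg R (F (mk R [:: sin (x - (xi - pi)); cos (x - (xi - pi))])) 0].
Proof.
move=> [bs [sb HF]]; exists (net_of n bs); split=> // N N3 xi x.
by rewrite HF; exact: net_ofE.
Qed.
End fno_of_prog.

(** * Approximation of the profile *)

Section relu_arith.
Variable R : realType.
Local Notation relu := (relu R).
Implicit Types (x p tau : R) (n : nat).

Definition tent x : R := 2 * relu x - 4 * relu (x - 1 / 2).
Definition sq n x : R := x - \sum_(i < n) (1 / 4) ^+ i.+1 * iter i.+1 tent x.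

Lemma tent_itv x : 0 <= x <= 1 ->
  0 <= tent x <= 1 /\ x - x ^+ 2 = tent x / 4 + (tent x - tent x ^+ 2) / 4.
Proof.
move=> /andP[x0 x1]; rewrite /tent /relu (max_l x0).
have [h|h] := leP (x - 1 / 2) 0.
  by split; [lra | field].
by split; [lra | field].
Qed.

Lemma sq_err n x : 0 <= x <= 1 -> 0 <= sq n x - x ^+ 2 <= (1 / 4) ^+ n / 4.
Proof.
move=> x01.
have H m : 0 <= iter m tent x <= 1 /\
    sq m x - x ^+ 2 = (1 / 4) ^+ m * (iter m tent x - iter m tent x ^+ 2).
  elim: m => [|m [IH1 IH2]]; first by rewrite /sq big_ord0 subr0 expr0 mul1r.
  have [t1 t2] := tent_itv _ IH1.
  rewrite iterS; split=> //.
  have -> : sq m.+1 x = sq m x - (1 / 4) ^+ m.+1 * tent (iter m tent x).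
    by rewrite /sq big_ord_recr /= opprD addrA.
  move: t2; set v := tent _ => t2.
  have -> : sq m x - (1 / 4) ^+ m.+1 * v - x ^+ 2 = (sq m x - x ^+ 2) - (1 / 4) ^+ m.+1 * v by ring.
  by rewrite IH2 t2 [(1 / 4) ^+ m.+1]exprSr; field.
have [/andP[h1 h2] ->] := H n.
have p0 : 0 <= (1 / 4) ^+ n :> R by rewrite exprn_ge0.
move: (iter n tent x) ((1 / 4) ^+ n) h1 h2 p0 => t q h1 h2 p0.
have b0 : 0 <= t - t ^+ 2 by nra.
have b1 : t - t ^+ 2 <= 1 / 4 by have := sqr_ge0 (2 * t - 1); nra.
by apply/andP; split; nra.
Qed.

Definition prodn n p tau : R := sq n (`|p + tau| / 2) - sq n (`|p - tau| / 2).

Lemma prodn_err n p tau : `|p| <= 1 -> `|tau| <= 1 -> `|prodn n p tau - p * tau| <= (1 / 4) ^+ n.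
Proof.
move=> p1 t1.
have n1 := le_trans (ler_normD p tau) (lerD p1 t1).
have n2 := le_trans (ler_normB p tau) (lerD p1 t1).
have [e1 e2] := (normr_ge0 (p + tau), normr_ge0 (p - tau)).
have /andP[h1 h2] := sq_err n (`|p + tau| / 2) ltac:(lra).
have /andP[h3 h4] := sq_err n (`|p - tau| / 2) ltac:(lra).
have E : (`|p + tau| / 2) ^+ 2 - (`|p - tau| / 2) ^+ 2 = p * tau.
  by rewrite !expr_div_n !real_normK ?num_real//; field.
have q0 : 0 <= (1 / 4) ^+ n :> R by rewrite exprn_ge0.
rewrite /prodn -E ler_norml; lra.
Qed.

Definition horn n p (cs : seq R) tau : R := foldl (fun p c => c + prodn n p tau) p cs.

Lemma horn_err n (cs : seq R) tau : (0 < n)%N -> `|tau| <= 1 / 2 ->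
  (forall c, c \in cs -> `|c| <= 1 / 4) ->
  forall p q, `|q| <= 1 / 2 -> `|p - q| <= 2 * (1 / 4) ^+ n ->
  `|horn n p cs tau - foldl (fun q c => c + q * tau) q cs| <= 2 * (1 / 4) ^+ n.
Proof.
move=> n0 t1.
have q4 : (1 / 4) ^+ n <= 1 / 4 :> R.
  case: n n0 => // n _; rewrite exprS ler_piMr//.
  by rewrite exprn_ile1//; lra.
have q0 : 0 <= (1 / 4) ^+ n :> R by rewrite exprn_ge0.
elim: cs => //= c cs IH Hc p q q1 pq.
have c1 : `|c| <= 1 / 4 by apply: Hc; rewrite mem_head.
have p1 : `|p| <= 1.
  by rewrite -(subrK q p); apply: (le_trans (ler_normD _ _)); lra.
have qt : `|q * tau| <= 1 / 2 * (1 / 2) by exact: norm_mul_le.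
apply: IH.
- by move=> d dcs; apply: Hc; rewrite in_cons dcs orbT.
- by apply: (le_trans (ler_normD _ _)); lra.
have -> : c + prodn n p tau - (c + q * tau) = (prodn n p tau - p * tau) + (p - q) * tau by ring.
have h1 := prodn_err n p tau p1 ltac:(lra).
have h2 := norm_mul_le R _ _ _ _ pq t1.
apply: (le_trans (ler_normD _ _)); lra.
Qed.

Lemma horner_sum (c : nat -> R) tau n :
  foldl (fun q c => c + q * tau) 0 [seq c k | k <- rev (iota 0 n)] = \sum_(k < n) c k * tau ^+ k.
Proof.
rewrite map_rev foldl_rev.
have H m : foldr (fun x z => x + z * tau) 0 [seq c k | k <- iota m n] = \sum_(k < n) c (m + k)%N * tau ^+ k.
  elim: n m => [|n IH] m; first by rewrite big_ord0.
  rewrite /= IH big_ord_recl /= addn0 expr0 mulr1; congr (_ + _).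
  rewrite mulr_suml; apply: eq_bigr => k _.
  by rewrite /bump ?add1n addnS addSn exprSr mulrA.
by rewrite H; apply: eq_bigr => k _; rewrite add0n.
Qed.

Definition clampr b x : R := relu (x + b) - relu (x - b) - b.

Lemma clamprE b x : 0 <= b -> clampr b x = clamp R (- b) b x.
Proof.
move=> b0; rewrite /clampr /relu /clamp /Order.max /Order.min.
by repeat case: ifP; intros; lra.
Qed.

Definition unit_clamp x : R := relu x - relu (x - 1).

Lemma unit_clampE x : unit_clamp x = clamp R 0 1 x.
Proof.
rewrite /unit_clamp /relu /clamp /Order.max /Order.min.
by repeat case: ifP; intros; lra.
Qed.

Definition sgn_out dl v s : R :=
  relu (unit_clamp v - unit_clamp (- s / dl)) - relu (unit_clamp v - unit_clamp (s / dl)).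

Lemma sgn_out_le1 dl v s : `|sgn_out dl v s| <= 1.
Proof.
rewrite /sgn_out !unit_clampE.
have /andP[? ?] := clamp_itv R 0 1 v ler01.
have /andP[? ?] := clamp_itv R 0 1 (- s / dl) ler01.
have /andP[? ?] := clamp_itv R 0 1 (s / dl) ler01.
rewrite ler_norml /relu /Order.max.
by repeat case: ifP; intros; apply/andP; split; lra.
Qed.

Lemma sgn_out_pos dl v s : 0 < dl -> dl <= s -> sgn_out dl v s = clamp R 0 1 v.
Proof.
move=> dl0 sd; rewrite /sgn_out !unit_clampE.
have -> : clamp R 0 1 (- s / dl) = 0 by apply: clamp01_le0; rewrite pmulr_lle0 ?invr_gt0//; lra.
have -> : clamp R 0 1 (s / dl) = 1 by apply: clamp01_ge1; rewrite ler_pdivlMr// mul1r.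
have /andP[? ?] := clamp_itv R 0 1 v ler01.
by rewrite /relu subr0 max_l// max_r ?subr0//; lra.
Qed.

Lemma sgn_out_neg dl v s : 0 < dl -> s <= - dl -> sgn_out dl v s = - clamp R 0 1 v.
Proof.
move=> dl0 sd; rewrite /sgn_out !unit_clampE.
have -> : clamp R 0 1 (s / dl) = 0 by apply: clamp01_le0; rewrite pmulr_lle0 ?invr_gt0//; lra.
have -> : clamp R 0 1 (- s / dl) = 1 by apply: clamp01_ge1; rewrite ler_pdivlMr// mul1r; lra.
have /andP[? ?] := clamp_itv R 0 1 v ler01.
by rewrite /relu subr0 max_r ?sub0r; [rewrite max_l | lra].
Qed.
End relu_arith.

Local Ltac aff_tac := lazymatch goal with
  | |- aff _ (fun r => @?f r + @?g r) => apply: (aff_add _ f g); aff_tac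
  | |- aff _ (fun r => - @?f r) => apply: (aff_opp _ f); aff_tac
  | |- aff _ (fun r => ?k * @?f r) => apply: (aff_scale _ k f); aff_tac
  | |- aff _ (fun r => rg _ _ ?k) => exact: (aff_rg _ k)
  | |- aff _ (fun=> ?c) => exact: (aff_cst _ c)
  end.
Local Ltac pl_tac := lazymatch goal with
  | |- pl _ _ (fun r => relu _ (@?f r)) => refine (pl_relu _ f _); aff_tac
  | |- pl _ _ ?h => lazymatch h with
    | context [relu] => lazymatch goal with
      | |- pl _ _ (fun r => @?f r + @?g r) => refine (pl_add _ _ _ f g _ _); pl_tac
      | |- pl _ _ (fun r => - @?f r) => refine (pl_opp _ _ f _); pl_tac
      | |- pl _ _ (fun r => ?k * @?f r) => refine (pl_scale _ _ k f _); pl_tac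
      end
    | _ => refine (pl_aff _ h _); aff_tac
    end
  end.
Local Ltac blk := apply: Blk_mk => -[|[|[|[|[|[|[|[|[|?]]]]]]]]] //= _;
  (eapply pl_le; [ | pl_tac]; by []).

Section programs.
Variable R : realType.
Local Notation relu := (relu R).
Local Notation mk := (mk R).
Local Notation rg := (rg R).
Local Notation Prog := (Prog R).
Local Notation state := 'cV[R]_9.
Implicit Types (r : state).

(* The nine registers hold sin z, cos z, |sin z|, the running sum over the
   pieces, the local variable tau, the Horner value, and the two tent iterates
   and partial sum of the squaring network. *)
Definition st_init r := mk [:: rg r 0; rg r 1; relu (rg r 0) + relu (- rg r 0); 0; 0; 0; 0; 0; 0].
Definition st_tau (ca sa sh q : R) r := mk [:: rg r 0; rg r 1; rg r 2; rg r 3;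
  q * (relu ((ca * rg r 2 + - (sa * rg r 1)) + sh)
       + - relu ((ca * rg r 2 + - (sa * rg r 1)) + - sh) + - sh); 0; 0; 0; 0].
Definition st_mul r := mk [:: rg r 0; rg r 1; rg r 2; rg r 3; rg r 4; rg r 5;
  2^-1 * (relu (rg r 5 + rg r 4) + relu (- (rg r 5 + rg r 4)));
  2^-1 * (relu (rg r 5 + - rg r 4) + relu (- (rg r 5 + - rg r 4)));
  2^-1 * (relu (rg r 5 + rg r 4) + relu (- (rg r 5 + rg r 4)))
  + - (2^-1 * (relu (rg r 5 + - rg r 4) + relu (- (rg r 5 + - rg r 4))))].
Definition st_tent (k : nat) r := mk [:: rg r 0; rg r 1; rg r 2; rg r 3; rg r 4; rg r 5;
  2 * relu (rg r 6) + - (4 * relu (rg r 6 + - (1 / 2)));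
  2 * relu (rg r 7) + - (4 * relu (rg r 7 + - (1 / 2)));
  rg r 8 + (1 / 4) ^+ k.+1 * ((2 * relu (rg r 7) + - (4 * relu (rg r 7 + - (1 / 2))))
    + - (2 * relu (rg r 6) + - (4 * relu (rg r 6 + - (1 / 2)))))].
Definition st_add (c : R) r := mk [:: rg r 0; rg r 1; rg r 2; rg r 3; rg r 4; c + rg r 8; 0; 0; 0].
Definition st_acc (k0 : R) r := mk [:: rg r 0; rg r 1; rg r 2; rg r 3 + 8 * rg r 5 + - k0; 0; 0; 0; 0; 0].
Definition st_fin1 (d : R) r := mk [:: 0; 0; 0; relu (rg r 3) + - relu (rg r 3 + -1);
  relu (d * - rg r 0) + - relu (d * - rg r 0 + -1); relu (d * rg r 0) + - relu (d * rg r 0 + -1); 0; 0; 0].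
Definition st_fin2 r := mk [:: relu (rg r 3 + - rg r 4) + - relu (rg r 3 + - rg r 5); 0; 0; 0; 0; 0; 0; 0; 0].

Lemma Blk_init : Blk R st_init.
Proof. blk. Qed.
Lemma Blk_tau ca sa sh q : Blk R (st_tau ca sa sh q).
Proof. blk. Qed.
Lemma Blk_mul : Blk R st_mul.
Proof. blk. Qed.
Lemma Blk_tent k : Blk R (st_tent k).
Proof. blk. Qed.
Lemma Blk_add c : Blk R (st_add c).
Proof. blk. Qed.
Lemma Blk_acc k0 : Blk R (st_acc k0).
Proof. blk. Qed.
Lemma Blk_fin1 d : Blk R (st_fin1 d).
Proof. blk. Qed.
Lemma Blk_fin2 : Blk R st_fin2.
Proof. blk. Qed.

Lemma relu_abs (x : R) : relu x + relu (- x) = `|x|.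
Proof. by rewrite /relu; case: (norm_cases R x) => -[h ->]; rewrite /Order.max; repeat case: ifP; intros; lra. Qed.

Lemma prog_tents n : exists F, Prog n F /\ forall s c b a t p x y z : R,
  F (mk [:: s; c; b; a; t; p; x; y; z]) = mk [:: s; c; b; a; t; p; iter n (tent R) x; iter n (tent R) y;
   z + \sum_(i < n) (1 / 4) ^+ i.+1 * (iter i.+1 (tent R) y - iter i.+1 (tent R) x)].
Proof.
elim: n => [|n [F [PF HF]]].
  exists id; split; first exact: Prog_id.
  by move=> *; rewrite big_ord0 addr0.
exists (st_tent n \o F); split.
  by rewrite -addn1; apply: Prog_comp => //; apply: Prog_blk; exact: Blk_tent.
move=> s c b a t p x y z; rewrite /= HF /st_tent !rg_mk//=.
by rewrite big_ord_recr /= addrA.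
Qed.

Lemma prog_mul n (c0 : R) : exists F, Prog n.+2 F /\ forall s c b a t p x y z : R,
  F (mk [:: s; c; b; a; t; p; x; y; z]) = mk [:: s; c; b; a; t; c0 + prodn R n p t; 0; 0; 0].
Proof.
have [F [PF HF]] := prog_tents n.
exists (st_add c0 \o (F \o st_mul)); split.
  have -> : n.+2 = ((1 + n) + 1)%N by rewrite addn1 add1n.
  apply: Prog_comp; last by apply: Prog_blk; exact: Blk_add.
  by apply: Prog_comp => //; apply: Prog_blk; exact: Blk_mul.
move=> s c b a t p x y z; rewrite /= /st_mul !rg_mk//= HF /st_add !rg_mk//=.
rewrite !relu_abs /prodn /sq; congr (mk [:: _; _; _; _; _; _ + _; _; _; _]).
rewrite ![2^-1 * _]mulrC.
under eq_bigr do rewrite mulrBr.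
by rewrite sumrB; ring.
Qed.

Lemma prog_horn n (cs : seq R) : exists F, Prog (size cs * n.+2) F /\
  forall s c b a t p : R, F (mk [:: s; c; b; a; t; p; 0; 0; 0])
   = mk [:: s; c; b; a; t; horn R n p cs t; 0; 0; 0].
Proof.
elim: cs => [|c0 cs [F [PF HF]]].
  by exists id; split=> //; exact: Prog_id.
have [G [PG HG]] := prog_mul n c0.
exists (F \o G); split; first by rewrite /= mulSn; exact: Prog_comp.
by move=> *; rewrite /= HG HF.
Qed.

Record piece := Piece { pca : R; psa : R; psh : R; pq : R; pcs : seq R; pk : R }.

Definition ptau (P : piece) (c b : R) := pq P * clampr R (psh P) (b * pca P - c * psa P).
Definition pval n (P : piece) (c b : R) := 8 * horn R n 0 (pcs P) (ptau P c b) - pk P.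

Lemma prog_piece n P : exists F, Prog (size (pcs P) * n.+2 + 2) F /\
  forall s c b a t p : R, F (mk [:: s; c; b; a; t; p; 0; 0; 0])
   = mk [:: s; c; b; a + pval n P c b; 0; 0; 0; 0; 0].
Proof.
have [F [PF HF]] := prog_horn n (pcs P).
exists (st_acc (pk P) \o (F \o st_tau (pca P) (psa P) (psh P) (pq P))); split.
  have -> : (size (pcs P) * n.+2 + 2 = (1 + size (pcs P) * n.+2) + 1)%N by rewrite add1n addn1 addn2.
  apply: Prog_comp; last by apply: Prog_blk; exact: Blk_acc.
  by apply: Prog_comp => //; apply: Prog_blk; exact: Blk_tau.
move=> s c b a t p; rewrite /= /st_tau !rg_mk//= HF /st_acc !rg_mk//=.
have -> : pq P * (relu (pca P * b + - (psa P * c) + psh P)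
    + - relu (pca P * b + - (psa P * c) + - psh P) + - psh P) = ptau P c b.
  by rewrite /ptau /clampr [b * _]mulrC [c * _]mulrC.
by rewrite /pval addrA.
Qed.

Lemma prog_pieces n k (Ps : seq piece) : all (fun P => size (pcs P) == k) Ps ->
  exists F, Prog (size Ps * (k * n.+2 + 2)) F /\
  forall s c b a t p : R, exists t' p', F (mk [:: s; c; b; a; t; p; 0; 0; 0])
   = mk [:: s; c; b; a + \sum_(P <- Ps) pval n P c b; t'; p'; 0; 0; 0].
Proof.
elim: Ps => [|P Ps IH] /=.
  move=> _; exists id; split; first exact: Prog_id.
  by move=> s c b a t p; exists t, p; rewrite big_nil addr0.
move=> /andP[/eqP sP /IH[F [PF HF]]].
have [G [PG HG]] := prog_piece n P.
exists (F \o G); split.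
  by rewrite mulSn; apply: Prog_comp => //; rewrite -sP.
move=> s c b a t p; rewrite /= HG.
have [t' [p' ->]] := HF s c b (a + pval n P c b) 0 0.
by exists t', p'; rewrite big_cons (addrA a (pval n P c b)).
Qed.

Lemma prog_total n k (Ps : seq piece) (dl : R) : all (fun P => size (pcs P) == k) Ps ->
  exists F, Prog (size Ps * (k * n.+2 + 2)).+3 F /\
  forall s c : R, rg (F (mk [:: s; c])) 0 =
    sgn_out R dl (\sum_(P <- Ps) pval n P c `|s|) s.
Proof.
move=> HP; have [F [PF HF]] := prog_pieces n k Ps HP.
exists (st_fin2 \o (st_fin1 dl^-1 \o (F \o st_init))); split.
  rewrite -addn1; apply: Prog_comp; last by apply: Prog_blk; exact: Blk_fin2.
  rewrite -addn1; apply: Prog_comp; last by apply: Prog_blk; exact: Blk_fin1.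
  rewrite -add1n; apply: Prog_comp => //; apply: Prog_blk; exact: Blk_init.
move=> s c; rewrite /= /st_init !rg_mk//= relu_abs.
have [t' [p' ->]] := HF s c `|s| 0 0 0.
rewrite /st_fin1 /st_fin2 !rg_mk//= add0r /sgn_out /unit_clamp.
by rewrite ![dl^-1 * _]mulrC.
Qed.
End programs.

Section approximation.
Variables (R : realType) (T : R).
Hypothesis piT : pi < T.
Local Notation rho := (rho R T).
Local Notation hw := (hw R T).
Local Notation mk := (mk R).
Local Notation rg := (rg R).

Lemma quarter_le_half n : (1 / 4) ^+ n <= (1 / 2) ^+ n :> R.
Proof. by apply: lerXn2r; rewrite ?nnegrE; lra. Qed.

Lemma horn_series (c : nat -> R) n tau : (0 < n)%N -> `|tau| <= 1 / 2 -> (forall k, `|c k| <= 2) ->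
  `|8 * horn R n 0 [seq c k / 8 | k <- rev (iota 0 n)] tau - \sum_(k < n) c k * tau ^+ k|
    <= 16 * (1 / 4) ^+ n.
Proof.
move=> n0 t1 c2.
have q0 : 0 <= (1 / 4) ^+ n :> R by rewrite exprn_ge0.
have H := horn_err R n [seq c k / 8 | k <- rev (iota 0 n)] tau n0 t1 _ 0 0.
rewrite subrr normr0 in H.
have -> : \sum_(k < n) c k * tau ^+ k = 8 * \sum_(k < n) (c k / 8) * tau ^+ k.
  by rewrite mulr_sumr; apply: eq_bigr => k _; field.
rewrite -(horner_sum R (fun k => c k / 8)) -mulrBr normrM ger0_norm//.
rewrite (_ : 16 * _ = 8 * (2 * (1 / 4) ^+ n)); last by ring.
rewrite ler_pM2l//; apply: H; [|lra|lra].
move=> d /mapP[k _ ->]; rewrite normrM [`|8^-1|]ger0_norm//; have := c2 k; lra.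
Qed.

Lemma piece_approx (h a k0 : R) n : (0 < n)%N -> 0 < h <= rho / 2 ->
  exists P : piece R, size (pcs R P) = n /\ (h <= a <= pi - h -> forall al, 0 <= al <= pi ->
    `|pval R n P (cos al) (sin al) - (hw (a + clamp R (- h) h (al - a)) - k0)| <= 18 * (1 / 2) ^+ n).
Proof.
move=> n0 /andP[h0 hr].
have p0 := pi_gt0 R; have p2 := pi_ge2 R; have r0 := rho_gt0 R T piT.
have h2 : h <= 1.
  have : rho <= 1; last lra.
  by rewrite invf_le1; move: piT; lra.
have [ha|ha] := boolP (h <= a <= pi - h); last first.
  exists (Piece R 0 0 0 0 (nseq n 0) 0); rewrite /= size_nseq; split=> //.
have api : 0 <= a <= pi by lra.
have [c [c2 Hc]] := hw_series R T a piT api.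
exists (Piece R (cos a) (sin a) (sin h) rho^-1 [seq c k / 8 | k <- rev (iota 0 n)] k0).
rewrite /= size_map size_rev size_iota; split=> // _ al al0.
set be := clamp R (- h) h (al - a).
have /andP[be1 be2] : - h <= be <= h by apply: clamp_itv; lra.
have sh0 : 0 <= sin h by apply: sin_ge0_pi; lra.
have shh : `|sin be| <= h.
  have := sin_lip R be 0; rewrite sin0 !subr0 => /le_trans; apply.
  by rewrite ler_norml be1 be2.
rewrite /pval /=; set tau := ptau R _ _ _.
have tE : tau = rho^-1 * sin be.
  rewrite /tau /ptau /= clamprE// /be -clamp_sin; last 2 first.
  - by apply/andP; split; lra.
  - by rewrite ler_norml; lra.
  by rewrite sinB.
have t1 : `|tau| <= 1 / 2.
  have ri : 0 < rho^-1 by rewrite invr_gt0.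
  rewrite tE normrM (gtr0_norm ri) (_ : 1 / 2 = rho^-1 * (rho / 2)).
    by rewrite ler_pM2l//; lra.
  by rewrite mulKf ?gt_eqF// mul1r.
have tK : asin (rho * tau) = be.
  rewrite tE mulVKf ?gt_eqF// sinK// in_itv /=; lra.
have E1 := horn_series c n tau n0 t1 c2.
have E2 := Hc n tau t1; rewrite tK in E2.
have := quarter_le_half n.
set H := horn _ _ _ _ _ in E1 *; set S := \sum_(k < n) _ in E1 E2.
have -> : 8 * H - k0 - (hw (a + be) - k0) = (8 * H - S) - (hw (a + be) - S) by ring.
move=> q; apply: (le_trans (ler_normB _ _)); lra.
Qed.

Lemma pieces_approx (M n : nat) : (0 < n)%N -> (0 < M)%N -> pi / (2 * M%:R) <= rho / 2 ->
  exists Ps : seq (piece R), [/\ size Ps = M, all (fun P => size (pcs R P) == n) Ps &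
  forall al, 0 <= al <= pi ->
    `|\sum_(P <- Ps) pval R n P (cos al) (sin al) - hw al| <= M%:R * (18 * (1 / 2) ^+ n)].
Proof.
move=> n0 M0 hr; set h := pi / _ in hr.
have M0' : 0 < M%:R :> R by rewrite ltr0n.
have h0 : 0 < h by rewrite divr_gt0 ?pi_gt0// mulr_gt0.
have Mh : 2 * M%:R * h = pi by rewrite /h; field; rewrite gt_eqF.
have hh : 0 < h <= rho / 2 by rewrite h0.
have [P HP] := choice (fun j : nat => piece_approx h ((2 * j%:R + 1) * h) (hw (2 * j%:R * h)) n n0 hh).
exists [seq P j | j <- iota 0 M]; split.
- by rewrite size_map size_iota.
- by rewrite all_map; apply/allP => j _ /=; rewrite (HP j).1.
move=> al al0.
have -> : hw al = hw (Num.min al (2 * M%:R * h)) by rewrite Mh min_l//; lra.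
rewrite -hw_pieces//; last lra.
rewrite big_map -[M in iota 0 M]subn0 big_mkord -sumrB.
apply: (le_trans (ler_norm_sum _ _ _)).
rewrite -[in leRHS](card_ord M) mulr_natl -sumr_const; apply: ler_sum => j _.
apply: (HP j).2 => //.
have j0 : 0 <= j%:R :> R := ler0n R j.
have jM : j%:R + 1 <= M%:R :> R by rewrite natr1 ler_nat.
by rewrite -Mh; apply/andP; split; nra.
Qed.

Lemma prog_approx (M n : nat) : (0 < n)%N -> (0 < M)%N -> pi / (2 * M%:R) <= rho / 2 ->
  exists F, Prog R (M * (n * n.+2 + 2)).+3 F /\ forall z : R,
   let o := rg (F (mk [:: sin z; cos z])) 0 in
   `|o| <= 1 /\ (`|z| <= pi -> (1 / 2) ^+ n <= `|sin z| ->
      `|o - hw z| <= M%:R * (18 * (1 / 2) ^+ n)).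
Proof.
move=> n0 M0 hr; have [Ps [sP aP HP]] := pieces_approx M n n0 M0 hr.
have d0 : 0 < (1 / 2) ^+ n :> R by rewrite exprn_gt0.
have [F [PF HF]] := prog_total R n n Ps ((1 / 2) ^+ n) aP.
exists F; split; first by rewrite -sP.
move=> z o; rewrite /o HF; split; first exact: sgn_out_le1.
rewrite ler_norml => /andP[z1 z2] sz.
have [z0|z0] := leP 0 z.
  have s0 : 0 <= sin z by apply: sin_ge0_pi; lra.
  rewrite ger0_norm// in sz *; rewrite sgn_out_pos//.
  have /andP[w0 w1] := hw_range R T piT z z0.
  rewrite -[X in _ - X](clamp_id R 0 1); last by rewrite w0.
  by apply: (le_trans (clamp_lip _ _ _ _ _ ler01)); apply: HP; lra.
have s0 : 0 <= sin (- z) by apply: sin_ge0_pi; lra.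
have sE : `|sin z| = sin (- z) by rewrite -normrN -sinN ger0_norm.
rewrite sE -[cos z]cosN; rewrite sE sinN in sz.
rewrite sgn_out_neg//; last lra.
have zp : 0 <= - z by lra.
have /andP[w0 w1] := hw_range R T piT (- z) zp.
rewrite -[z in hw z]opprK hwN// opprK addrC distrC.
rewrite -[X in _ - X](clamp_id R 0 1); last by rewrite w0.
by apply: (le_trans (clamp_lip _ _ _ _ _ ler01)); apply: HP; lra.
Qed.
End approximation.

Section cell.
Variable R : realType.
Local Notation leb := (@lebesgue_measure R).
Local Notation MR := (measurableTypeR R).

(* The integral of a nonnegative function, measurable or not, is a supremum over
   the simple functions below it. *)
Lemma ge0_integral_mono (D : set MR) (f g : MR -> \bar R) :
  (forall x, D x -> (0 <= f x)%E) -> (forall x, D x -> (f x <= g x)%E) ->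
  (\int[leb]_(x in D) f x <= \int[leb]_(x in D) g x)%E.
Proof.
move=> f0 fg; rewrite !ge0_integralE//; last by move=> x Dx; exact: le_trans (f0 x Dx) (fg x Dx).
apply: ereal_sup_le => _ [h hf <-]; exists h => // x.
apply: (le_trans (hf x)); rewrite /patch; case: ifP => // /set_mem; exact: fg.
Qed.

Lemma sin_ge_half (eta y : R) : 0 < eta <= 1 / 2 -> eta <= y <= pi - eta -> eta / 2 <= sin y.
Proof.
have p0 := pi_ge2 R; move=> /andP[e0 e1].
wlog : y / y <= pi / 2 => [W|y2 /andP[y0 y1]].
  have [h|h] := leP y (pi / 2); first exact: W.
  move=> /andP[y0 y1]; have -> : sin y = sin (pi - y) by rewrite sinB sinpi cospi mul0r; lra.
  by apply: W; lra.
have c1 : 1 / 2 <= cos eta.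
  have := cos_lip R 0 eta; rewrite cos0 sub0r normrN (gtr0_norm e0) => h.
  have := le_trans (ler_norm _) h; lra.
have s1 : eta * cos eta <= sin eta by apply: sin_ge_xcos; lra.
have s2 : eta * (1 / 2) <= eta * cos eta by rewrite ler_pM2l.
have [c cc E] := MVT_le _ _ _ _ _ y0 (@is_derive_sin R).
have c0 : 0 <= cos c by apply: cos_ge0_pihalf; lra.
have : 0 <= cos c * (y - eta) by rewrite mulr_ge0//; lra.
by rewrite -E; lra.
Qed.

Lemma cell_bound (f : R -> R) (K d xi : R) : measurable_fun setT (f : MR -> R) ->
  (forall x, 0 <= f x) -> 0 <= K -> 0 < d <= 1 / 4 ->
  (forall x, f x <= 2) ->
  (forall x, `|x - (xi - pi)| <= pi -> d <= `|sin (x - (xi - pi))| -> f x <= K) ->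
  (\int[leb]_(x in `[(xi - 2 * pi)%R, xi]%classic) (f x)%:E <= (K * (2 * pi) + 16 * d)%:E)%E.
Proof.
move=> mf f0 K0 /andP[d0 d1] f2 fK; have p0 := pi_ge2 R.
pose I (a b : R) (x : R) := 2 * \1_(`[a, b]%classic : set R) x : R.
have mI a b : measurable_fun setT (I a b : MR -> R).
  by apply: measurable_funM => //; exact: measurable_indic.
have I0 a b x : 0 <= I a b x by rewrite mulr_ge0.
have I1 a b x : a <= x <= b -> I a b x = 2.
  by move=> h; rewrite /I indicE mem_set ?mulr1//= in_itv.
pose A := I (xi - 2 * pi) (xi - 2 * pi + 2 * d); pose B := I (xi - pi - 2 * d) (xi - pi + 2 * d).
pose C := I (xi - 2 * d) xi.
have [A0 [B0 C0]] : (forall x, 0 <= A x) /\ (forall x, 0 <= B x) /\ (forall x, 0 <= C x).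
  by split; [exact: I0|split; exact: I0].
pose BC x := B x + C x; pose ABC x := A x + BC x.
have mBC : measurable_fun setT (BC : MR -> R) by apply: measurable_funD; exact: mI.
have mABC : measurable_fun setT (ABC : MR -> R) by apply: measurable_funD => //; exact: mI.
have BC0 x : 0 <= BC x by rewrite addr_ge0.
have ABC0 x : 0 <= ABC x by rewrite addr_ge0.
have mD : measurable (`[(xi - 2 * pi)%R, xi]%classic : set MR) by exact: measurable_itv.
have S1 := @ge0_int_le_add R _ ABC A BC mD mABC (mI _ _) mBC ABC0 A0 BC0 (fun x _ => lexx _).
have S2 := @ge0_int_le_add R _ BC B C mD mBC (mI _ _) (mI _ _) BC0 B0 C0 (fun x _ => lexx _).
have iA : (\int[leb]_(x in `[(xi - 2 * pi)%R, xi]%classic) (A x)%:E <= (4 * d)%:E)%E.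
  by rewrite (_ : 4 * d = 2 * (xi - 2 * pi + 2 * d - (xi - 2 * pi))); [apply: int_indic_le => //; lra|ring].
have iB : (\int[leb]_(x in `[(xi - 2 * pi)%R, xi]%classic) (B x)%:E <= (8 * d)%:E)%E.
  by rewrite (_ : 8 * d = 2 * (xi - pi + 2 * d - (xi - pi - 2 * d))); [apply: int_indic_le => //; lra|ring].
have iC : (\int[leb]_(x in `[(xi - 2 * pi)%R, xi]%classic) (C x)%:E <= (4 * d)%:E)%E.
  by rewrite (_ : 4 * d = 2 * (xi - (xi - 2 * d))); [apply: int_indic_le => //; lra|ring].
have S0 := @ge0_int_le_add R _ f (cst K) ABC mD mf (measurable_cst _) mABC f0 (fun _ => K0) ABC0.
have -> : K * (2 * pi) + 16 * d = K * (xi - (xi - 2 * pi)) + (4 * d + (8 * d + 4 * d)) by ring.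
apply: (le_trans (S0 _)).
  move=> x /=; rewrite in_itv /= => /andP[x1 x2].
  have [hA|hA] := leP x (xi - 2 * pi + 2 * d).
    have := BC0 x; have := f2 x; rewrite /ABC /A I1 ?x1//; lra.
  have [hC|hC] := leP (xi - 2 * d) x.
    have := B0 x; have := f2 x; have := A0 x; rewrite /ABC /BC /C I1 ?x2 ?hC//; lra.
  have [hB|hB] := boolP (xi - pi - 2 * d <= x <= xi - pi + 2 * d).
    have := C0 x; have := f2 x; have := A0 x; rewrite /ABC /BC /B I1//; lra.
  have := ABC0 x; suff : f x <= K by lra.
  apply: fK; first by rewrite ler_norml; lra.
  have [s0|s0] := leP (xi - pi) x.
    have h := sin_ge_half (2 * d) (x - (xi - pi)) ltac:(lra) ltac:(lra).
    by apply: le_trans (ler_norm _); lra.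
  have h := sin_ge_half (2 * d) (- (x - (xi - pi))) ltac:(lra) ltac:(lra).
  by rewrite -normrN -sinN; apply: le_trans (ler_norm _); lra.
rewrite int_cst_itv; last lra.
rewrite [leRHS]EFinD; apply: leeD => //.
apply: (le_trans S1); rewrite EFinD; apply: leeD => //.
apply: (le_trans S2); rewrite EFinD; exact: leeD.
Qed.
End cell.

Section error.
Variables (R : realType) (T : R).
Hypothesis piT : pi < T.
Local Notation leb := (@lebesgue_measure R).
Local Notation MR := (measurableTypeR R).
Local Notation hw := (hw R T).

Lemma measurable_hw (c : R) : measurable_fun setT ((fun x => hw (x - c)) : MR -> R).
Proof.
apply: continuous_measurable_fun; apply: (@continuous_of_lip _ _ 1) => x y.
rewrite mul1r; apply: (le_trans (hw_lip R T piT _ _)).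
by rewrite (_ : x - c - (y - c) = x - y)//; ring.
Qed.

Lemma error_bound (o : R -> R) (xi K d : R) (u : R -> R -> R) : 0 <= xi <= 2 * pi ->
  entropy_solution u (ubar xi) ->
  (forall z, o (z + 2 * pi) = o z) -> measurable_fun setT ((fun x => o (x - (xi - pi))) : MR -> R) ->
  0 <= K -> 0 < d <= 1 / 4 ->
  (forall z, `|o z| <= 1) ->
  (forall z, `|z| <= pi -> d <= `|sin z| -> `|o z - hw z| <= K) ->
  (\int[leb]_(x in @per_dom R) (`|u x T - o (x - (xi - pi))|)%:E
    <= (2 * (d + (K * (2 * pi) + 16 * d)))%:E)%E.
Proof.
move=> /andP[xi0 xi2] Su op mo K0 dd o1 oK; have p0 := pi_gt0 R.
have d0 : 0 < d by case/andP: dd.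
have [uper [_ [mu _]]] := Su.
have mu' : measurable_fun setT (u ^~ T : MR -> R) by exact: (measurable_fun_pair2 T mu).
have hw1 z : `|hw z| <= 1 by apply: (le_trans (sin_max _)).
pose s := xi - pi.
pose f x := `|u x T - o (x - s)|; pose g x := `|u x T - hw (x - s)|; pose h x := `|o (x - s) - hw (x - s)|.
have mf : measurable_fun setT (f : MR -> R) by apply: measurable_norm_sub.
have mg : measurable_fun setT (g : MR -> R) by apply: measurable_norm_sub => //; exact: measurable_hw.
have mh : measurable_fun setT (h : MR -> R) by apply: measurable_norm_sub => //; exact: measurable_hw.
have Ig : (\int[leb]_(x in `[(xi - 2 * pi)%R, xi]%classic) (g x)%:E <= d%:E)%E.
  apply: (@stability R T xi u hw) => //; first by rewrite xi0.
    move=> z zp; have [h1 h2] := hrootP R T piT z; exists (hroot R T z); split=> //.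
    rewrite h2 clamp_id//; move: zp piT; rewrite ler_norml => *; lra.
  by have := measurable_hw 0; congr measurable_fun; apply/funext => x; rewrite subr0.
have Ih : (\int[leb]_(x in `[(xi - 2 * pi)%R, xi]%classic) (h x)%:E <= (K * (2 * pi) + 16 * d)%:E)%E.
  apply: (cell_bound _ h) => //.
  - by move=> x; exact: normr_ge0.
  - move=> x; rewrite /h; apply: (le_trans (ler_normB _ _)).
    by have := o1 (x - s); have := hw1 (x - s); lra.
  - by move=> x xp sx; exact: oK.
have If : (\int[leb]_(x in `[(xi - 2 * pi)%R, xi]%classic) (f x)%:E <= (d + (K * (2 * pi) + 16 * d))%:E)%E.
  have mD : measurable (`[(xi - 2 * pi)%R, xi]%classic : set MR) by exact: measurable_itv.
  apply: (le_trans (@ge0_int_le_add R _ f g h mD mf mg mh (fun x => normr_ge0 _) (fun x => normr_ge0 _) (fun x => normr_ge0 _) _)).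
    move=> x _; rewrite /f (_ : u x T - o (x - s) = (u x T - hw (x - s)) - (o (x - s) - hw (x - s))); last by ring.
    exact: ler_normB.
  by rewrite EFinD; exact: leeD.
have fper x : f (x + 2 * pi) = f x by rewrite /f uper addrAC op.
have H := @int_two_periods R (xi - 2 * pi) f fper mf (fun x => normr_ge0 _).
rewrite (_ : xi - 2 * pi + 2 * pi = xi) in H; last by ring.
rewrite (_ : xi - 2 * pi + 4 * pi = xi + 2 * pi) in H; last by ring.
apply: (@le_trans _ _ (\int[leb]_(x in `[(xi - 2 * pi)%R, (xi + 2 * pi)%R]%classic) (f x)%:E)%E).
  apply: (@ge0_subset_integral _ MR R leb _ _ _ _ (EFin \o f)) => //.
  - exact: measurable_itv.
  - by apply/measurable_EFinP; exact: measurable_funS mf.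
  - by move=> x _; rewrite lee_fin normr_ge0.
  - move=> x; rewrite /per_dom /= !in_itv /= => /andP[h1 h2].
    by apply/andP; split; lra.
by apply: (le_trans H); rewrite EFinM; apply: lee_wpmul2l.
Qed.
End error.

Lemma halving_steps (R : realType) (K : R) : exists2 c : R, 0 < c &
  forall eps : R, 0 < eps -> eps <= 1 / 2 ->
  exists n, [/\ (2 <= n)%N, K * (1 / 2) ^+ n <= eps & n%:R <= c * ln eps^-1].
Proof.
have l2 : 0 < ln 2 :> R by rewrite ln_gt0// ltr1n.
have [m m2 Km] : exists2 m, (2 <= m)%N & K <= 2 ^+ m.
  exists (Num.bound `|K|).+2 => //.
  apply: (le_trans (ler_norm K)); apply: (le_trans (ltW (archi_boundP (normr_ge0 K)))).
  by rewrite -natrX ler_nat; apply: ltnW; apply: (leq_trans _ (ltn_expl _ _)); rewrite // ltnW.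
exists (m.+2%:R / ln 2); first by rewrite divr_gt0// ltr0n.
move=> eps e0 e2; set l := ln eps^-1.
have l2l : ln 2 <= l.
  by rewrite ler_ln ?posrE ?invr_gt0// -[leLHS]invrK lef_pV2 ?posrE ?invr_gt0//; lra.
have q0 : 0 <= l / ln 2 by rewrite divr_ge0//; lra.
have q1 : 1 <= l / ln 2 by rewrite ler_pdivlMr// mul1r.
have /andP[k1 k2] := truncn_itv q0.
set k := Num.truncn _ in k1 k2.
exists (m + k.+1)%N; split.
- exact: (leq_trans m2 (leq_addr _ _)).
- have eK : eps^-1 <= 2 ^+ k.+1.
    rewrite -ler_ln ?posrE ?invr_gt0 ?exprn_gt0// lnXn// -/l -(mulr_natl (ln 2)) -ler_pdivrMr//.
    exact: ltW.
  have p1 : 0 < 2 ^+ k.+1 :> R by rewrite exprn_gt0.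
  have p2 : 0 < 2 ^+ m :> R by rewrite exprn_gt0.
  have -> : (1 / 2) ^+ (m + k.+1) = (2 ^+ m * 2 ^+ k.+1)^-1 :> R.
    by rewrite mul1r exprVn exprD.
  rewrite ler_pdivrMr; last by rewrite mulr_gt0.
  rewrite mulrCA.
  have h : 1 <= eps * 2 ^+ k.+1 by rewrite -ler_pdivrMl// mulr1.
  by apply: (le_trans Km); rewrite ler_peMr// ltW.
- rewrite -mulrA [_^-1 * _]mulrC.
  set q := l / ln 2 in k1 k2 q0 q1 *.
  have m0 : 0 <= m%:R :> R by exact: ler0n.
  have -> : m.+2%:R = m%:R + 2 :> R by rewrite -addn2 natrD.
  have -> : (m + k.+1)%:R = m%:R + k%:R + 1 :> R by rewrite addnS -natr1 natrD.
  have : m%:R <= m%:R * q by rewrite ler_peMr.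
  lra.
Qed.

Theorem theorem3p6 (R : realType) (T : R) (hT : pi < T) :
  exists C : R, 0 < C /\
  forall eps : R, 0 < eps -> eps <= 1 / 2 ->
  forall N : nat, (3 <= N)%N ->
  exists net : FNO R,
    fno_kmax net = 1%N /\
    (fno_dv net)%:R <= C /\
    (fno_depth net)%:R <= C * ln (eps^-1) ^+ 2 /\
    (fno_size net)%:R <= C * ln (eps^-1) ^+ 2 /\
    forall G : R -> R -> R,
      (forall xi : R, exists u : R -> R -> R,
          entropy_solution u (ubar xi) /\ forall x, G xi x = u x T) ->
      (((2 * pi)^-1)%:E *
        \int[@lebesgue_measure R]_(xi in @per_dom R)
           \int[@lebesgue_measure R]_(x in @per_dom R)
              (`|G xi x - fno_eval net N (ubar xi) x|)%:E
       <= eps%:E)%E.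
Proof.
have p0 := pi_gt0 R.
have r0 := rho_gt0 R T hT.
pose M := (Num.bound (pi / rho R T)).+1.
have Mr : pi / (2 * M%:R) <= rho R T / 2.
  have b0 : 0 <= pi / rho R T by rewrite divr_ge0// ltW.
  have h : pi / rho R T <= M%:R by apply: (le_trans (ltW (archi_boundP b0))); rewrite ler_nat.
  rewrite ler_pdivrMr// in h; rewrite ler_pdivrMr ?mulr_gt0 ?ltr0n//; lra.
pose D := #|{: 'I_9 * 'I_8}|.
pose K : R := M%:R * 18.
have K0 : 0 <= K by rewrite mulr_ge0.
have [c c0 Hc] := halving_steps R (2 * (1 + (K * (2 * pi) + 16))).
pose A : nat := ((5 * M + 3) * (7 * (D * D) + 10 * D + 6))%N.
exists (D%:R + A%:R * c ^+ 2); split.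
  by apply: ltr_wpDl => //; rewrite mulr_gt0 ?exprn_gt0// ltr0n /A muln_gt0 !addn_gt0 !orbT.
move=> eps e0 e2 N N3.
have [n [n2 nK nl]] := Hc eps e0 e2.
have n0 : (0 < n)%N by exact: ltnW.
have [F [PF HF]] := prog_approx R T hT M n n0 isT Mr.
have [net [nk nd nL nw nE]] := fno_of_prog R _ _ PF.
have dL : (fno_depth net <= (5 * M + 3) * (n * n))%N.
  have h1 : (n * n.+2 + 2 <= 5 * (n * n))%N by clear -n2; nia.
  rewrite nL -addn3 mulnDl; apply: leq_add.
    by rewrite [(5 * M)%N]mulnC -mulnA leq_mul2l h1 orbT.
  by rewrite leq_pmulr// muln_gt0 n0.
have dS : (fno_size net <= A * (n * n))%N.
  rewrite /fno_size nk nd nw -/D /A.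
  have d1 : (0 < fno_depth net)%N by rewrite nL.
  apply: (@leq_trans (fno_depth net * (7 * (D * D) + 10 * D + 6))%N).
    by move: (D) (fno_depth net) d1 => a b; clear; nia.
  by rewrite mulnAC leq_mul2r dL orbT.
have nn : (n * n)%:R <= c ^+ 2 * ln eps^-1 ^+ 2 :> R.
  by rewrite natrM -expr2 -exprMn lerXn2r// nnegrE ?ler0n// (le_trans _ nl).
have bnd k : (k <= A * (n * n))%N -> k%:R <= (D%:R + A%:R * c ^+ 2) * ln eps^-1 ^+ 2.
  move=> kA; apply: (@le_trans _ _ (A%:R * (n * n)%:R)); first by rewrite -natrM ler_nat.
  apply: (@le_trans _ _ (A%:R * (c ^+ 2 * ln eps^-1 ^+ 2))); first exact: ler_wpM2l.
  by rewrite mulrDl mulrA lerDr mulr_ge0// sqr_ge0.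
exists net; split=> //; split; first by rewrite nd lerDl mulr_ge0// sqr_ge0.
split; first by apply: bnd; apply: (leq_trans dL); rewrite /A -mulnA leq_mul2l leq_pmull ?orbT// addn_gt0 orbT.
split; first exact: bnd.
move=> G HG.
pose d : R := (1 / 2) ^+ n.
have d0 : 0 < d by rewrite exprn_gt0.
have d4 : d <= 1 / 4.
  rewrite /d; case: (n) n2 => [|[|k]]// _; rewrite !exprS.
  have : (1 / 2) ^+ k <= 1 :> R by rewrite exprn_ile1//; lra.
  lra.
pose o z := rg R (F (mk R [:: sin z; cos z])) 0.
have op z : o (z + 2 * pi) = o z.
  have E : z + 2 * pi = z + pi + pi by ring.
  by rewrite /o E !sinDpi !cosDpi !opprK.
have mo xi : measurable_fun setT ((fun x => o (x - (xi - pi))) : measurableTypeR R -> R).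
  apply: (Prog_measurable R _ _ PF (fun x => mk R [:: sin (x - (xi - pi)); cos (x - (xi - pi))])).
  move=> i; have ms : continuous (fun x : R => x - (xi - pi)).
    by move=> x; apply: cvgB; [exact: cvg_id | exact: cvg_cst].
  apply: (continuous_measurable_fun (f := (fun x : R => mk R [:: sin (x - (xi - pi)); cos (x - (xi - pi))] i ord0))).
  case: i => -[|[|i]] hi x; rewrite /mk.
  - under [X in continuous_at _ X]funext do rewrite mxE /=.
    exact: (continuous_comp (ms x) (@continuous_sin R _)).
  - under [X in continuous_at _ X]funext do rewrite mxE /=.
    exact: (continuous_comp (ms x) (@continuous_cos R _)).
  - under [X in continuous_at _ X]funext do rewrite mxE /= nth_nil.
    exact: cvg_cst.
have inner (xi : R) : @per_dom R xi -> (\int[@lebesgue_measure R]_(x in @per_dom R)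
    (`|G xi x - fno_eval net N (ubar xi) x|)%:E <= eps%:E)%E.
  rewrite /per_dom /= in_itv /= => xi2.
  have [u [Su Gu]] := HG xi.
  have dd : 0 < d <= 1 / 4 by rewrite d0.
  have oK z : `|z| <= pi -> d <= `|sin z| -> `|o z - hw R T z| <= K * d.
    by move=> z1 z2; rewrite -mulrA; exact: (HF z).2.
  have H := @error_bound R T hT o xi (K * d) d u xi2 Su op (mo xi)
    (mulr_ge0 K0 (ltW d0)) dd (fun z => (HF z).1) oK.
  rewrite (_ : (fun x => _) = (fun x => (`|u x T - o (x - (xi - pi))|)%:E)); last first.
    by apply/funext => x; rewrite Gu nE.
  apply: (le_trans H); rewrite lee_fin; apply: le_trans nK.
  by rewrite -/d le_eqVlt; apply/orP; left; apply/eqP; ring.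
have I2 : (\int[@lebesgue_measure R]_(x in @per_dom R) (cst eps x)%:E = (eps * (2 * pi - 0))%:E)%E.
  by apply: int_cst_itv; rewrite mulr_ge0// ltW.
have pp : 0 < (2 * pi)^-1 :> R by rewrite invr_gt0 mulr_gt0.
apply: (@le_trans _ _ ((2 * pi)^-1%:E * (eps * (2 * pi - 0))%:E)%E); last first.
  by rewrite -EFinM lee_fin subr0 mulrCA mulVf ?mulr1// gt_eqF// mulr_gt0.
apply: lee_wpmul2l; first by rewrite lee_fin ltW.
rewrite -I2; apply: ge0_integral_mono => // xi _.
by apply: integral_ge0 => x _; rewrite lee_fin.
Qed.
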